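(* Let $T>0$, $\epsilon>0$, $\alpha\in\left(\frac12,1\right)$, $x_0\in\mathbb{R}^n$, and let $f:\mathbb{R}^+\times\mathbb{R}^n\to\mathbb{R}^n$ and $g:\mathbb{R}^+\times\mathbb{R}^n\to\mathbb{R}^n\otimes\mathbb{R}^m$ be functions for which there are constants $K,L>0$ such that for all $t,t_1,t_2\ge0$ and $x_1,x_2\in\mathbb{R}^n$, $$|f(t_1,x_1)-f(t_2,x_2)|\vee\Vert g(t_1,x_1)-g(t_2,x_2)\Vert\le K\left(|t_1-t_2|+|x_1-x_2|\right),\qquad |f(t,0)|^2\vee\Vert g(t,0)\Vert^2\le L.$$ Let $x_\epsilon$ be the solution on $[0,T]$ of $$x_\epsilon(t)=x_0+\frac1{\Gamma(\alpha)}\int_0^t(t-s)^{\alpha-1}f\left(\tfrac s\epsilon,x_\epsilon(s)\right)ds+\frac1{\Gamma(\alpha)}\int_0^t(t-s)^{\alpha-1}g\left(\tfrac s\epsilon,x_\epsilon(s)\right)dB_s .$$ For an integer $N\ge1$ let $\Delta t=T/N$, $t_n=n\Delta t$ ($0\le n\le N$), $\Delta B_i=B(t_{i+1})-B(t_i)$, and let $(x_n)_{0\le n\le N}$ be the Euler–Maruyama approximation, defined by the initial value $x_0$ and, for $1\le n\le N$, $$x_n=x_0+\frac{(\Delta t)^\alpha}{\Gamma(\alpha+1)}\sum_{i=0}^{n-1}\left[(n-i)^\alpha-(n-i-1)^\alpha\right]f\left(\tfrac{t_i}\epsilon,x_i\right)+\frac{(\Delta t)^{\alpha-1}}{\Gamma(\alpha)}\sum_{i=0}^{n-1}(n-i)^{\alpha-1}g\left(\tfrac{t_i}\epsilon,x_i\right)\Delta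 B_i .$$ Then $$\max_{0\le n\le N}\mathbb{E}\left(|x_\epsilon(t_n)-x_n|^2\right)\lesssim(\Delta t)^{2\alpha-1}+\left(\frac{\Delta t}{\epsilon}\right)^2,$$ where $A\lesssim B$ means $A\le CB$ with a constant $C>0$ independent of $\Delta t$ and $\epsilon$.
   Context: $B_t=B(t)$ is an $m$-dimensional Brownian motion on a complete probability space $(\Omega,\mathcal{F},P)$; stochastic integrals are Itô integrals. $|\cdot|$ is the Euclidean norm on $\mathbb{R}^n$, $\Vert\cdot\Vert$ is the norm of $\mathbb{R}^n\otimes\mathbb{R}^m$ ($n\times m$ matrices), $\mathbb{R}^+=[0,\infty)$, and $a\vee b=\max\{a,b\}$. The solution $x_\epsilon$ is an adapted process in $L^2(\Omega;C([0,T];\mathbb{R}^n))$, i.e. a continuous process with $\mathbb{E}\sup_{t\in[0,T]}|x_\epsilon(t)|^2<\infty$. The integral equation is the integral form of the Caputo fractional stochastic differential equation ${}^CD_0^\alpha x_\epsilon(t)=f(t/\epsilon,x_\epsilon(t))dt+g(t/\epsilon,x_\epsilon(t))dB_t$, $x_\epsilon(0)=x_0$. *)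

(* Defs.v *)
From HB Require Import structures.
From mathcomp Require Import all_boot all_order all_algebra.
From mathcomp Require Import all_classical all_reals all_analysis.
Set Implicit Arguments.
Unset Strict Implicit.
Unset Printing Implicit Defensive.
Import Order.TTheory GRing.Theory Num.Theory.
Import numFieldNormedType.Exports.
Local Open Scope classical_set_scope.
Local Open Scope ring_scope.

(* The library's `|A| on matrices is the sup norm. This one is the Euclidean
   norm on columns and the Hilbert-Schmidt norm of R^p (x) R^q on matrices. *)
Definition frob (R : realType) (p q : nat) (A : 'M[R]_(p, q)) : R :=
  Num.sqrt (\sum_(i < p) \sum_(j < q) A i j ^+ 2).

Definition Gamma (R : realType) (a : R) : R :=
  \int[lebesgue_measure]_(u in `]0, +oo[) (u `^ (a - 1) * expR (- u)).

Section stochastic_integral.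
Context {R : realType} {d : measure_display} {Omega : measurableType d}.
Variable P : probability Omega R.

(* Only the indices t >= 0 are meaningful, here and in the processes below. *)
Record filtration (F : R -> set (set Omega)) : Prop := Filtration {
  filtration_sigma : forall t : R, 0 <= t -> sigma_algebra setT (F t);
  filtration_measurable : forall t : R, 0 <= t -> F t `<=` measurable;
  filtration_mono : forall s t : R, 0 <= s -> s <= t -> F s `<=` F t }.

Definition measurable_wrt (G : set (set Omega)) (p q : nat)
    (X : Omega -> 'M[R]_(p, q)) : Prop :=
  forall i j (U : set R), measurable U -> G [set w | U (X w i j)].

(* B is an m-dimensional Brownian motion relative to F: the increment over
   [s, t] has law N(0, (t - s) I) and is independent of F_s. Both clauses are
   tested on the pi-system of boxes, which generates the Borel sets of R^m.
   The second parameter of normal_prob is the standard deviation. *)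
Record brownian (F : R -> set (set Omega)) (m : nat)
    (B : R -> Omega -> 'cV[R]_m) : Prop := Brownian {
  brownian_adapted : forall t : R, 0 <= t -> measurable_wrt (F t) (B t);
  brownian_start : {ae P, forall w, B 0 w = 0};
  brownian_continuous :
    {ae P, forall w, {within `[0, +oo[, continuous (fun t => B t w)}};
  brownian_gauss : forall (s t : R) (U : 'I_m -> set R), 0 <= s -> s < t ->
    (forall j, measurable (U j)) ->
    P [set w | forall j, U j (B t w j ord0 - B s w j ord0)] =
    (\big[*%E/1%E]_(j < m) normal_prob 0 (Num.sqrt (t - s)) (U j))%E;
  brownian_indep : forall (s t : R) (E : set Omega) (U : 'I_m -> set R),
    0 <= s -> s < t -> F s E -> (forall j, measurable (U j)) ->
    P (E `&` [set w | forall j, U j (B t w j ord0 - B s w j ord0)]) =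
    (P E * P [set w | forall j, U j (B t w j ord0 - B s w j ord0)%R])%E }.

(* Stands for the process sum_(i < steps) 1_]grid i, grid i.+1](s) coef i. *)
Record simple_process (n m : nat) := SimpleProcess {
  steps : nat;
  grid : nat -> R;
  coef : nat -> Omega -> 'M[R]_(n, m) }.

Definition simple_value (n m : nat) (S : simple_process n m) (s : R)
    (w : Omega) : 'M[R]_(n, m) :=
  \sum_(i < steps S) (s \in `]grid S i, grid S i.+1])%:R *: coef S i w.

Definition simple_integral (m : nat) (B : R -> Omega -> 'cV[R]_m) (n : nat)
    (S : simple_process n m) (w : Omega) : 'cV[R]_n :=
  \sum_(i < steps S) coef S i w *m (B (grid S i.+1) w - B (grid S i) w).

Record simple_adapted (F : R -> set (set Omega)) (t : R) (n m : nat)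
    (S : simple_process n m) : Prop := SimpleAdapted {
  simple_grid : forall i, (i <= steps S)%N -> 0 <= grid S i <= t;
  simple_mono : forall i, (i < steps S)%N -> grid S i <= grid S i.+1;
  simple_coef : forall i, (i < steps S)%N ->
    measurable_wrt (F (grid S i)) (coef S i);
  simple_bounded : exists M : R,
    forall i w, (i < steps S)%N -> frob (coef S i w) <= M }.

(* For each u in [0, t], H restricted to [0, u] x Omega is measurable for
   Borel([0, u]) (x) F_u. *)
Definition progressive (F : R -> set (set Omega)) (t : R) (n m : nat)
    (H : R -> Omega -> 'M[R]_(n, m)) : Prop :=
  forall (u : R) i j (U : set R), 0 <= u <= t -> measurable U ->
  <<s `[0, u] `*` setT,
      [set C | exists2 A : set R, measurable A /\ A `<=` `[0, u] &
               exists2 E, F u E & C = A `*` E] >>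
    ((`[0, u] `*` setT) `&` [set z | U (H z.1 z.2 i j)]).

(* I is (a version of) the Ito integral of H against B over [0, t]: H is
   progressively measurable with E int_0^t ||H||^2 ds < oo, and I is the
   L^2(P)-limit of the integrals of bounded simple adapted processes that
   converge to H in L^2(ds x P). *)
Definition ito_integral (F : R -> set (set Omega)) (m : nat)
    (B : R -> Omega -> 'cV[R]_m) (t : R) (n : nat)
    (H : R -> Omega -> 'M[R]_(n, m)) (I : Omega -> 'cV[R]_n) : Prop :=
  [/\ progressive F t H,
      (\int[P]_w \int[lebesgue_measure]_(s in `[0%R, t])
         (frob (H s w) ^+ 2)%:E < +oo)%E,
      measurable_wrt measurable I
    & exists S : nat -> simple_process n m,
      [/\ forall k, simple_adapted F t (S k),
          (\int[P]_w \int[lebesgue_measure]_(s in `[0%R, t])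
             (frob (H s w - simple_value (S k) s w)%R ^+ 2)%:E)%E
            @[k --> \oo] --> 0%E
        & ('E_P[fun w => (frob (I w - simple_integral B (S k) w) ^+ 2)%R])%E
            @[k --> \oo] --> 0%E]].

Definition vint (n : nat) (t : R) (h : R -> 'cV[R]_n) : 'cV[R]_n :=
  \col_(i < n) \int[lebesgue_measure]_(s in `[0, t]) (h s i ord0).

(* The stochastic convolution at time t is, for each fixed t, the Ito integral
   over [0, t] of the integrand (t - s)^(alpha - 1) g(s / eps, x(s)). The value
   of `^ at s = t is irrelevant: {t} is Lebesgue-null. *)
Record fsde_solution (F : R -> set (set Omega)) (n m : nat)
    (B : R -> Omega -> 'cV[R]_m) (T alpha eps : R) (x0 : 'cV[R]_n)
    (f : R -> 'cV[R]_n -> 'cV[R]_n) (g : R -> 'cV[R]_n -> 'M[R]_(n, m))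
    (x : R -> Omega -> 'cV[R]_n) : Prop := FsdeSolution {
  solution_adapted : forall t : R, 0 <= t <= T -> measurable_wrt (F t) (x t);
  solution_continuous :
    forall w, {within `[0, T], continuous (fun t => x t w)};
  solution_L2 :
    (\int[P]_w ereal_sup [set (frob (x t w) ^+ 2)%:E | t in `[0%R, T]]
      < +oo)%E;
  solution_eq : forall t : R, 0 <= t <= T ->
    exists2 I : Omega -> 'cV[R]_n,
      ito_integral F B t
        (fun s w => (t - s) `^ (alpha - 1) *: g (s / eps) (x s w)) I
    & {ae P, forall w, x t w = x0
        + (Gamma alpha)^-1 *:
            vint t (fun s => (t - s) `^ (alpha - 1) *: f (s / eps) (x s w))
        + (Gamma alpha)^-1 *: I w} }.

Record euler_maruyama (n m : nat) (B : R -> Omega -> 'cV[R]_m)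
    (T alpha eps : R) (x0 : 'cV[R]_n)
    (f : R -> 'cV[R]_n -> 'cV[R]_n) (g : R -> 'cV[R]_n -> 'M[R]_(n, m))
    (N : nat) (y : nat -> Omega -> 'cV[R]_n) : Prop := EulerMaruyama {
  em_start : forall w, y 0%N w = x0;
  em_step : forall (k : nat) w, (1 <= k <= N)%N ->
    let dt := T / N%:R in
    let t (i : nat) := i%:R * dt in
    y k w = x0
      + (dt `^ alpha / Gamma (alpha + 1)) *:
          \sum_(i < k) ((k - i)%:R `^ alpha - (k - i - 1)%:R `^ alpha) *:
            f (t i / eps) (y i w)
      + (dt `^ (alpha - 1) / Gamma alpha) *:
          \sum_(i < k) (k - i)%:R `^ (alpha - 1) *:
            (g (t i / eps) (y i w) *m (B (t i.+1) w - B (t i) w)) }.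

End stochastic_integral.

(* Main.v *)
Require Import Defs.
From HB Require Import structures.
From mathcomp Require Import all_boot all_order all_algebra.
From mathcomp Require Import all_classical all_reals all_analysis.
From mathcomp Require Import measurable_realfun.
From mathcomp Require Import ring lra.
Set Implicit Arguments.
Unset Strict Implicit.
Unset Printing Implicit Defensive.
Import Order.TTheory GRing.Theory Num.Theory.
Import numFieldNormedType.Exports.
Local Open Scope classical_set_scope.
Local Open Scope ring_scope.

(* At the grid points both x and the Euler scheme are of the form
   x0 + Gamma(alpha)^-1 (drift integral + Ito integral), the scheme with
   piecewise constant coefficients and with the kernel of its noise term frozen
   at the left end of each cell. Cauchy-Schwarz for the drift and the Ito
   inequality for the noise therefore bound the mean square error at t_n by the
   integral over [0, t_n] of the squared kernel (t_n - s)^(2 alpha - 2) times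
   the mean square coefficient error, plus the L^2 error of freezing the kernel,
   of order dt^(2 alpha - 1). Over one cell the coefficient error is at most a
   multiple of (dt/eps)^2 + dt^(2 alpha - 1) + the error at its left end, by the
   Lipschitz condition and the mean square Hoelder continuity of x. A Gronwall
   inequality for the kernel (t - s)^(2 alpha - 2), integrable as alpha > 1/2,
   closes the estimate. It also bounds the second moments of x uniformly in eps,
   which makes the Hoelder constant independent of eps. *)

(** The integrand of the noise term changes with the horizon t, so x(t) - x(t') is not an Ito
    integral over [t', t] but a difference of two integrals with different kernels. All integrands
    are therefore extended by 0 to the whole time line, where integrals with different horizons can
    be subtracted, and one Ito inequality serves the moment bound, the Hoelder bound and the error
    of the scheme. Freezing thus costs no more than shifting the horizon by dt, and the L^2 estimate
    behind the Hoelder continuity of x controls it as well. The Gronwall inequality is run on bounds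
    for the mean square coefficient or its error, because these are what reappears under the
    integral. Its constant is fixed before eps, N and the processes are introduced, which is what
    makes the final constant independent of them. *)

(** * Integrals of the kernel (t - s)^(p - 1) *)

Section kernel.
Variable R : realType.
Implicit Types p t s a b : R.
Local Notation mu := (@lebesgue_measure R).

Lemma is_derive_powR_sub p t s : s < t ->
  is_derive s 1 (fun u : R => (t - u) `^ p) (- (p * (t - s) `^ (p - 1))).
Proof.
move=> st.
have dp : is_derive (t - s) 1 (@powR R ^~ p) (p * (t - s) `^ (p - 1)).
  by apply: is_derive1_powR; rewrite subr_gt0.
have db : is_derive s 1 (fun u : R => t - u) (- 1).
  by have := is_deriveB (is_derive_cst t s 1) (is_derive_id s 1); rewrite sub0r.
by have := @is_derive1_comp _ (@powR R ^~ p) (fun u : R => t - u) _ _ _ dp db; rewrite mulrN1.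
Qed.

Lemma is_derive_kernel p t s : p != 0 -> s < t ->
  is_derive s 1 (fun u : R => - ((t - u) `^ p / p)) ((t - s) `^ (p - 1)).
Proof.
move=> p0 st.
have := is_deriveZ (- p^-1) (is_derive_powR_sub p st).
rewrite (_ : _ *: - _ = (t - s) `^ (p - 1)); last first.
  by rewrite /GRing.scale /=; field.
congr (is_derive _ _ _ _); apply/funext => u /=.
by rewrite /GRing.scale /= mulNr mulrC.
Qed.

Lemma integral_kernel_lt p t a b : 0 < p -> a <= b -> b < t ->
  (\int[mu]_(s in `[a, b]) ((t - s) `^ (p - 1))%:E =
   (((t - a) `^ p - (t - b) `^ p) / p)%:E)%E.
Proof.
move=> p0; rewrite le_eqVlt => /predU1P[<- _|ab bt].
  by rewrite set_itv1 integral_set1 subrr mul0r.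
have pn0 : p != 0 by rewrite gt_eqF.
have D s : s < t -> is_derive s 1 (fun u : R => - ((t - u) `^ p / p)) ((t - s) `^ (p - 1)).
  exact: is_derive_kernel.
have C s : s < t -> {for s, continuous (fun u : R => - ((t - u) `^ p / p))}.
  move=> st; apply: differentiable_continuous; apply/derivable1_diffP.
  by have [] := D _ st.
rewrite (@continuous_FTC2 _ _ (fun u => - ((t - u) `^ p / p))) //.
- by rewrite -EFinD; congr EFin; ring.
- apply: derivable_within_continuous => s; rewrite in_itv /= => /andP[_ sb].
  by have [] := is_derive_powR_sub (p - 1) (le_lt_trans sb bt).
- split.
  + by move=> s; rewrite in_itv /= => /andP[_ sb]; have [] := D s (lt_trans sb bt).
  + by apply: cvg_at_right_filter; exact: C (lt_trans ab bt).
  + by apply: cvg_at_left_filter; exact: C.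
- move=> s; rewrite in_itv /= => /andP[_ sb].
  by rewrite derive1E; have [_ ->] := D s (lt_trans sb bt).
Qed.

Lemma measurable_kernel p t : measurable_fun setT (fun s : R => (t - s) `^ (p - 1)).
Proof.
apply: (measurableT_comp (measurable_powR (p - 1))) => //.
exact: measurable_funB.
Qed.

(** For p < 1 the integrand is singular at t, so the fundamental theorem of calculus stops short of
    b = t. That case is the monotone limit of the integrals over [[a, t - e i]]. *)
Lemma integral_kernel p t a b : 0 < p -> a <= b -> b <= t ->
  (\int[mu]_(s in `[a, b]) ((t - s) `^ (p - 1))%:E =
   (((t - a) `^ p - (t - b) `^ p) / p)%:E)%E.
Proof.
move=> p0 ab; rewrite le_eqVlt => /predU1P[bt|]; last exact: integral_kernel_lt.
subst b; move: ab; rewrite le_eqVlt => /predU1P[<-|at_].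
  by rewrite set_itv1 integral_set1 subrr mul0r.
have ta0 : 0 < t - a by rewrite subr_gt0.
pose e (i : nat) : R := (t - a) / i.+1%:R.
have e0 i : 0 < e i by rewrite divr_gt0.
have ea i : a <= t - e i.
  by rewrite lerBrDr addrC -lerBrDr ler_pdivrMr // ler_peMr // ?ler1n // ltW.
rewrite -integral_itv_bndo_bndc; last first.
  by apply/measurable_EFinP; apply: measurable_funTS; exact: measurable_kernel.
have U : `[a, t[%classic = \bigcup_i `[a, t - e i]%classic.
  apply/seteqP; split => s /=.
    rewrite in_itv /= => /andP[as_ st].
    have ts0 : 0 < t - s by rewrite subr_gt0.
    (* This index i satisfies (t - a) / (t - s) < i + 1, that is e i < t - s. *)
    exists (Num.trunc ((t - a) / (t - s))) => //=.
    rewrite in_itv /= as_ /= lerBrDr addrC -lerBrDr ler_pdivrMr //.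
    rewrite mulrC -ler_pdivrMr // ltW //.
    by rewrite truncnS_gt.
  move=> [i _] /=; rewrite !in_itv /= => /andP[-> /le_lt_trans]; apply.
  by rewrite ltrBlDr ltrDl.
rewrite U.
have H : (\int[mu]_(s in `[a, (t - e i)%R]) ((t - s) `^ (p - 1))%:E)%E @[i --> \oo] -->
    (\int[mu]_(s in \bigcup_i `[a, (t - e i)%R]%classic) ((t - s) `^ (p - 1))%:E)%E.
  apply: ge0_nondecreasing_set_cvg_integral => //.
  - move=> i j ij; apply/subsetPset => s /=; rewrite !in_itv /= => /andP[-> /= /le_trans]; apply.
    by rewrite lerD2l lerN2 ler_wpM2l // ?(ltW ta0) // lef_pV2 ?posrE // ler_nat.
  - by move=> i; apply/measurable_EFinP; apply: measurable_funTS; exact: measurable_kernel.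
  - by move=> i s _; rewrite lee_fin powR_ge0.
apply: (cvg_unique _ H) => //.
rewrite (_ : (fun i => _) = (fun i => (((t - a) `^ p - (e i) `^ p) / p)%:E)); last first.
  apply/funext => i; rewrite integral_kernel_lt //; last by rewrite ltrBlDr ltrDl.
  by congr ((_ - _ `^ _) / _)%:E; ring.
apply: cvg_EFin; first exact: nearW.
apply: cvgMl; rewrite subrr powR0 ?gt_eqF //; apply: cvgB; first exact: cvg_cst.
apply: (proj1 (cvg_at_rightP _ _ _) (powR_cvg0 p0) e); split=> //.
rewrite -[X in _ --> X](mulr0 (t - a)); apply: cvgMr.
exact: cvg_harmonic.
Qed.
End kernel.

(** * Gronwall inequality for a weakly singular kernel *)

Section gronwall.

(** The integral of a nonnegative function is a supremum over the simple functions below it, hence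
    monotone. This form applies to integrands known only through bounds, such as the supremum over a
    path in [solution_L2] or [phi (sigma s)] in the Gronwall inequality. *)
Lemma le_integral_nomeas d (X : measurableType d) (R : realType)
    (nu : measure X R) (D : set X) (h k : X -> \bar R) :
  (forall x, D x -> (0 <= h x)%E) -> (forall x, D x -> (h x <= k x)%E) ->
  (\int[nu]_(x in D) h x <= \int[nu]_(x in D) k x)%E.
Proof.
move=> h0 hk; rewrite integral_mkcond [leRHS]integral_mkcond.
have h0' x : (0 <= (h \_ D) x)%E.
  by rewrite patchE; case: ifPn => // /set_mem; exact: h0.
have hk' x : ((h \_ D) x <= (k \_ D) x)%E.
  by rewrite !patchE; case: ifPn => // /set_mem; exact: hk.
have k0' x : (0 <= (k \_ D) x)%E by exact: le_trans (hk' x).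
rewrite !ge0_integralTE //; apply: ereal_sup_le => _ [f /= fh <-].
by exists f => //= x; exact: le_trans (hk' x).
Qed.

Variable R : realType.
Local Notation mu := (@lebesgue_measure R).

(** In the norm weighted by exp(- lam t) the integral operator becomes small. Within distance [dl]
    of t the kernel itself has little mass; farther away the weight gains exp(- lam dl) against the
    total mass T^p / p. *)
Lemma kernel_exp_small (p T eta : R) : 0 < p -> 0 <= T -> 0 < eta ->
  exists2 lam, 0 <= lam & forall t, 0 <= t <= T ->
  (\int[mu]_(s in `]0%R, t]) ((t - s) `^ (p - 1) * expR (lam * s))%:E
    <= (eta * expR (lam * t))%:E)%E.
Proof.
move=> p0 T0 eta0.
(* Chosen so that the mass dl^p / p of the kernel near t is eta / 2. *)
pose dl := (p * eta / 2) `^ p^-1.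
have dl0 : 0 < dl by rewrite powR_gt0 // divr_gt0 // mulr_gt0.
have dlp : dl `^ p = p * eta / 2.
  by rewrite -powRrM mulVf ?gt_eqF // powRr1 // divr_ge0 // mulr_ge0 // ltW.
(* Chosen so that (T^p / p) / (lam dl) = eta / 2, which suffices because exp(- z) <= 1 / z. *)
pose lam := 2 * T `^ p / (p * eta * dl).
have lam0 : 0 <= lam.
  by rewrite divr_ge0 ?mulr_ge0 ?powR_ge0 // ?(ltW p0) ?(ltW eta0) ?(ltW dl0).
exists lam => // t /andP[t0 tT].
pose m := Num.max 0 (t - dl).
have m0 : 0 <= m by rewrite le_max lexx.
have mt : m <= t by rewrite ge_max t0 /= gerBl ltW.
have tT_p : t `^ p <= T `^ p by apply: ge0_ler_powR; rewrite ?nnegrE // ltW.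
have small : expR (- (lam * dl)) * (T `^ p / p) <= eta / 2.
  have [T00|Tn0] := eqVneq (T `^ p) 0.
    by rewrite T00 mul0r mulr0 divr_ge0 // ltW.
  have Tp0 : 0 < T `^ p by rewrite lt_neqAle eq_sym Tn0 powR_ge0.
  have l0 : 0 < lam * dl by rewrite mulr_gt0 // divr_gt0 // !mulr_gt0.
  have : lam * dl <= expR (lam * dl).
    by apply: le_trans (expR_ge1Dx _); rewrite lerDr.
  rewrite expRN => le1; rewrite mulrC ler_pdivrMr ?expR_gt0 //.
  apply: le_trans (ler_wpM2l _ le1); last by rewrite divr_ge0 // ltW.
  rewrite le_eqVlt; apply/orP; left; apply/eqP; rewrite /lam; field.
  by rewrite !gt_eqF.
have mk q D : measurable_fun D (fun s : R => ((t - s) `^ (p - 1) * q)%:E).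
  apply/measurable_EFinP; apply: measurable_funTS; apply: measurable_funM => //.
  exact: measurable_kernel.
have mh D : measurable_fun D (fun s : R => ((t - s) `^ (p - 1) * expR (lam * s))%:E).
  apply/measurable_EFinP; apply: measurable_funTS; apply: measurable_funM.
    exact: measurable_kernel.
  apply: measurableT_comp => //; exact: measurable_funM.
have ge a b : a <= b -> b <= t -> forall q, 0 <= q -> (\int[mu]_(s in `[a, b]) ((t - s) `^ (p - 1) * q)%:E =
   (((t - a) `^ p - (t - b) `^ p) / p * q)%:E)%E.
  move=> ab bt q q0; under eq_integral do rewrite EFinM.
  rewrite ge0_integralZr //.
  - by rewrite integral_kernel.
  - by apply/measurable_EFinP; apply: measurable_funTS; exact: measurable_kernel.
  - by move=> s _; rewrite lee_fin powR_ge0.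
rewrite integral_itv_obnd_cbnd; last exact: mh.
have -> : `[0, t]%classic = `[0, m[%classic `|` `[m, t]%classic :> set R.
  apply/seteqP; split => s /=; rewrite !in_itv /=.
    by move=> /andP[s0 st]; case: (ltP s m) => sm; [left; rewrite s0|right].
  by move=> [/andP[-> /ltW /le_trans ->]|/andP[/(le_trans m0) -> ->]].
rewrite ge0_integral_setU //=; last 3 first.
- exact: mh.
- by move=> s _; rewrite lee_fin mulr_ge0 ?powR_ge0 ?expR_ge0.
- rewrite disj_set2E; apply/eqP; rewrite -subset0 => s [] /=.
  by rewrite !in_itv /= => /andP[_ sm] /andP[/le_lt_trans/(_ sm)]; rewrite ltxx.
have -> : eta * expR (lam * t) = eta / 2 * expR (lam * t) + eta / 2 * expR (lam * t) by field.
rewrite EFinD; apply: leeD.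
  apply: (@le_trans _ _ (\int[mu]_(s in `[0%R, m]) ((t - s) `^ (p - 1) * (expR (- (lam * dl)) * expR (lam * t)))%:E)%E).
    rewrite -integral_itv_bndo_bndc; last exact: mk.
    apply: le_integral_nomeas.
    - by move=> s _; rewrite lee_fin mulr_ge0 ?powR_ge0 ?expR_ge0.
    - move=> s /=; rewrite in_itv /= => /andP[s0 sm].
      rewrite lee_fin ler_wpM2l ?powR_ge0 // -expRD ler_expR.
      rewrite -mulrN -mulrDr ler_wpM2l //.
      move: sm; rewrite /m lt_max ltNge s0 /= => /ltW; lra.
  rewrite ge // ?mulr_ge0 ?expR_ge0 // lee_fin mulrA ler_wpM2r ?expR_ge0 // mulrC.
  apply: le_trans small; rewrite ler_wpM2l ?expR_ge0 // ler_wpM2r ?invr_ge0 ?(ltW p0) //.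
  rewrite subr0; apply: le_trans tT_p; by rewrite gerBl powR_ge0.
apply: (@le_trans _ _ (\int[mu]_(s in `[m, t]) ((t - s) `^ (p - 1) * expR (lam * t))%:E)%E).
  apply: le_integral_nomeas.
  - by move=> s _; rewrite lee_fin mulr_ge0 ?powR_ge0 ?expR_ge0.
  - move=> s /=; rewrite in_itv /= => /andP[ms st].
    by rewrite lee_fin ler_wpM2l ?powR_ge0 // ler_expR ler_wpM2l.
rewrite ge ?expR_ge0 // lee_fin ler_wpM2r ?expR_ge0 // subrr powR0 ?gt_eqF // subr0.
rewrite ler_pdivrMr //; apply: (@le_trans _ _ (dl `^ p)); last by rewrite dlp; lra.
apply: ge0_ler_powR; rewrite ?nnegrE ?subr_ge0 // ?(ltW p0) ?(ltW dl0) //.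
by rewrite /m lerBlDr -lerBlDl le_max lexx orbT.
Qed.

(* With I = R and sigma = id this is the continuous inequality; with I = nat, time
   a grid and sigma the index of the cell containing s it is a discrete one.
   M only makes the supremum of exp(- lam t) phi finite; for large lam the
   integral operator at least halves that supremum. *)
Lemma singular_gronwall (p T c : R) : 0 < p -> 0 <= T -> 0 <= c ->
  exists2 C, 0 <= C &
  forall (I : Type) (S : set I) (time : I -> R) (sigma : R -> I) (phi : I -> R)
    (a M : R), 0 <= a ->
    (forall i, S i -> 0 <= time i <= T) ->
    (forall i s, S i -> 0 < s <= time i -> S (sigma s) /\ time (sigma s) <= s) ->
    (forall i, S i -> 0 <= phi i <= M) ->
    (forall i, S i -> ((phi i)%:E <= a%:E + c%:E *
       \int[mu]_(s in `]0%R, time i])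
          ((time i - s) `^ (p - 1) * phi (sigma s))%:E)%E) ->
  forall i, S i -> phi i <= C * a.
Proof.
move=> p0 T0 c0.
(* This gives c * eta <= 1/2; c + 1 replaces c because c may be 0. *)
pose eta := (2 * (c + 1))^-1.
have c10 : 0 < c + 1 by rewrite ltr_wpDl.
have eta0 : 0 < eta by rewrite invr_gt0 mulr_gt0.
have [lam lam0 small] := kernel_exp_small p0 T0 eta0.
exists (2 * expR (lam * T)); first by rewrite mulr_ge0 ?expR_ge0.
move=> I S time sigma phi a M a0 ST Ssig phiM phile i0 Si0.
pose E := [set expR (- (lam * time i)) * phi i | i in S].
have Eub : has_ubound E.
  exists M => _ [i Si <-]; have /andP[p0t pM] := phiM _ Si.
  apply: le_trans pM; rewrite ler_piMl // -expR0 ler_expR oppr_le0 mulr_ge0 //.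
  by have /andP[] := ST _ Si.
have Esup : has_sup E by split => //; exists (expR (- (lam * time i0)) * phi i0), i0.
have Ele i : S i -> phi i <= sup E * expR (lam * time i).
  move=> Si; rewrite -ler_pdivrMr ?expR_gt0 // -expRN mulrC.
  by apply: sup_upper_bound => //; exists i.
have E0 : 0 <= sup E.
  have : expR (- (lam * time i0)) * phi i0 <= sup E by apply: sup_upper_bound => //; exists i0.
  by apply: le_trans; rewrite mulr_ge0 ?expR_ge0 //; have /andP[] := phiM _ Si0.
have step i : S i -> phi i <= (a + sup E / 2) * expR (lam * time i).
  move=> Si; have /andP[t_ge0 tT] := ST _ Si; set t := time i in t_ge0 tT *.
  rewrite -lee_fin; apply: le_trans (phile _ Si) _.
  apply: (@le_trans _ _ (a%:E + c%:E * (sup E * (eta * expR (lam * t)))%:E)%E).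
    rewrite leeD2l // lee_wpmul2l ?lee_fin //.
    apply: (@le_trans _ _ (\int[mu]_(s in `]0%R, t]) ((sup E)%:E * ((t - s) `^ (p - 1) * expR (lam * s))%:E))%E).
      apply: le_integral_nomeas => s /=; rewrite in_itv /= => /(Ssig _ _ Si)[Ss ss].
        by rewrite lee_fin mulr_ge0 ?powR_ge0 //; have /andP[] := phiM _ Ss.
      rewrite -EFinM lee_fin mulrCA ler_wpM2l ?powR_ge0 //.
      apply: le_trans (Ele _ Ss) _; rewrite ler_wpM2l // ler_expR.
      by rewrite ler_wpM2l.
    rewrite ge0_integralZl_EFin //.
    - by rewrite EFinM lee_wpmul2l ?lee_fin // small // t_ge0.
    - by move=> s _; rewrite lee_fin mulr_ge0 ?powR_ge0 ?expR_ge0.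
    - apply/measurable_EFinP; apply: measurable_funTS; apply: measurable_funM.
        exact: measurable_kernel.
      apply: measurableT_comp => //; exact: measurable_funM.
  rewrite -EFinM -EFinD lee_fin mulrDl lerD //.
    by rewrite ler_peMr // -expR0 ler_expR mulr_ge0.
  rewrite !mulrA ler_wpM2r ?expR_ge0 // [c * _]mulrC -mulrA ler_wpM2l //.
  rewrite /eta ler_pdivrMr ?mulr_gt0 // mulrCA mulrA divff // ?mul1r.
  by rewrite lerDl.
have sup_le : sup E <= a + sup E / 2.
  apply: sup_le_ub; first by exists (expR (- (lam * time i0)) * phi i0), i0.
  by move=> _ [i Si <-]; rewrite mulrC expRN ler_pdivrMr ?expR_gt0 //; exact: step.
have sup2 : sup E <= 2 * a by lra.
apply: le_trans (Ele _ Si0) _.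
rewrite mulrAC ler_pM ?expR_ge0 // ler_expR ler_wpM2l //.
by have /andP[] := ST _ Si0.
Qed.
End gronwall.

(** * Reflection of Lebesgue measure and two explicit integrals *)

Section reflect.
Variable R : realType.
Local Notation mu := (@lebesgue_measure R).

(** The preimage of ]a, b] is [v - b, v - a[, of the same length, and Lebesgue measure is determined
    by its values on such intervals. *)
Lemma lebesgue_measure_reflect (v : R) (A : set R) : measurable A ->
  pushforward mu ((fun u => v - u) : _ -> measurableTypeR R) A = mu A.
Proof.
move=> mA; apply/esym/lebesgue_measure_unique => //=.
  exact: measurable_funB.
move=> mf _ [[a b]] _ <-.
rewrite /pushforward.
have -> : (fun u : R => v - u) @^-1` `]a, b]%classic = `[v - b, v - a[%classic :> set R.
  apply/seteqP; split => u /=; rewrite !in_itv /= => /andP[? ?]; apply/andP; split; lra.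
rewrite !lebesgue_measure_itv/=.
rewrite !lte_fin ltrD2l ltrN2 -!EFinB; case: ifPn => // _; congr EFin; ring.
Qed.

Lemma integral_reflect (v : R) (f : R -> \bar R) : measurable_fun setT f ->
  (forall u, (0 <= f u)%E) ->
  (\int[mu]_u f (v - u)%R = \int[mu]_u f u)%E.
Proof.
move=> mf f0.
transitivity (\int[pushforward mu ((fun u => (v - u)%R) : _ -> measurableTypeR R)]_u f u)%E.
  rewrite ge0_integral_pushforward //.
  exact: measurable_funB.
apply: eq_measure_integral => [|mv A mA _]; first exact: measurable_funB.
exact: lebesgue_measure_reflect.
Qed.

(** The reflection u -> v - u turns this into [integral_kernel] over [0, v]. *)
Lemma integral_powR (p v : R) : 0 < p -> 0 <= v ->
  (\int[mu]_(u in `]0%R, v]) (u `^ (p - 1))%:E = (v `^ p / p)%:E)%E.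
Proof.
move=> p0 v0; have := @integral_kernel R p v 0 v p0 v0 (lexx _).
rewrite subrr powR0 ?gt_eqF // !subr0 => <-.
rewrite -(@integral_itv_bndo_bndc _ _ v); last first.
  by apply/measurable_EFinP; apply: measurable_funTS; exact: measurable_kernel.
rewrite integral_mkcond [RHS]integral_mkcond -(@integral_reflect v).
- apply: eq_integral => u _; rewrite !patchE; congr (if _ then _ else _).
  by apply/idP/idP; rewrite !inE /= !in_itv /= => /andP[? ?]; apply/andP; split; lra.
- apply/measurable_restrict => //.
  apply/measurable_EFinP; apply: measurable_funTS; exact: measurable_powR.
- by move=> u; rewrite patchE; case: ifPn => // _; rewrite lee_fin powR_ge0.
Qed.

Lemma integral_expRN_tail (u : R) :
  (\int[mu]_(v in `[u, +oo[) (expR (- v))%:E = (expR (- u))%:E)%E.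
Proof.
rewrite (@ge0_continuous_FTC2y _ _ (fun v => - expR (- v)) _ 0).
- by rewrite -EFinB sub0r opprK.
- by move=> x _; rewrite expR_ge0.
- apply: continuous_subspaceT => x; apply: continuous_comp; first exact: opp_continuous.
  exact: continuous_expR.
- rewrite -oppr0; apply: cvgN; exact: cvgr_expR.
- move=> x _; exact: derivableN.
- apply: cvg_at_right_filter; apply: cvgN; apply: continuous_comp; first exact: opp_continuous.
  exact: continuous_expR.
- by move=> x _; rewrite derive1E derive_val /GRing.scale /= ; ring.
Qed.

End reflect.

(** * Integration against a measure with a density *)

Section density.
Context d (X : measurableType d) (R : realType).
Variables (m nu : {measure set X -> \bar R}) (p : X -> R).
Hypothesis mp : measurable_fun setT p.
Hypothesis p0 : forall x, 0 <= p x.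
Hypothesis nuE : forall A, measurable A -> nu A = (\int[m]_(x in A) (p x)%:E)%E.

Import HBNNSimple.

Let integral_density_nnsfun (f : {nnsfun X >-> R}) :
  (\int[nu]_x (f x)%:E = \int[m]_x ((f x)%:E * (p x)%:E))%E.
Proof.
rewrite integralT_nnsfun sintegralE.
have mi y : measurable_fun setT (fun x => ((p x)%:E * (y * \1_(f @^-1` [set y]) x)%:E)%E).
  apply: emeasurable_funM; first exact/measurable_EFinP.
  by apply/measurable_EFinP; apply: measurable_funM.
under [RHS]eq_integral => x _.
  rewrite muleC fimfunE -fsumEFin // ge0_mule_fsumr; last first.
    by move=> r; rewrite EFinM nnfun_muleindic_ge0.
  over.
rewrite ge0_integral_fsum //; last first.
  by move=> y x _; rewrite mule_ge0 ?lee_fin // -lee_fin EFinM nnfun_muleindic_ge0.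
apply: eq_fsbigr => y _.
have [y0|y0] := ltP y 0.
  rewrite preimage_nnfun0 // measure0 mule0; apply/esym/integral0_eq => x _.
  by rewrite indicE in_set0 mulr0 mule0.
rewrite nuE // integral_mkcond -ge0_integralZl_EFin //; last 2 first.
- by move=> x _; rewrite patchE; case: ifPn => // _; rewrite lee_fin.
- apply/measurable_restrict => //; apply: measurable_funTS; exact/measurable_EFinP.
apply: eq_integral => x _; rewrite patchE indicE.
by case: ifPn => _; rewrite ?mulr1 ?mulr0 ?mule0 // muleC.
Qed.

Lemma ge0_integral_density (f : X -> \bar R) :
  measurable_fun setT f -> (forall x, (0 <= f x)%E) ->
  (\int[nu]_x f x = \int[m]_x (f x * (p x)%:E))%E.
Proof.
move=> mf f0.
pose f_ := nnsfun_approx measurableT mf.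
transitivity (lim (\int[nu]_x (f_ n x)%:E @[n --> \oo])%E).
  rewrite -monotone_convergence//=.
  - apply: eq_integral => ? /[!inE] xD; apply/esym/cvg_lim => //=.
    exact: cvg_nnsfun_approx.
  - by move=> n; exact/measurable_EFinP/measurable_funTS.
  - by move=> n ? _; rewrite lee_fin.
  - by move=> ? _ ? ? mn; rewrite lee_fin; exact/lefP/nd_nnsfun_approx.
under eq_fun do rewrite integral_density_nnsfun.
rewrite -monotone_convergence//=.
- apply: eq_integral => x _; apply: cvg_lim => //=.
  apply: cvgeMr => //; exact: cvg_nnsfun_approx.
- move=> n; apply: emeasurable_funM; last exact/measurable_EFinP.
  exact/measurable_EFinP/measurable_funTS.
- by move=> n x _; rewrite mule_ge0 ?lee_fin.
- move=> x _ ? ? mn; rewrite lee_wpmul2r ?lee_fin //; exact/lefP/nd_nnsfun_approx.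
Qed.
End density.

(** * First and second moments of the centred normal laws *)

Section gauss.
Variable R : realType.
Local Notation mu := (@lebesgue_measure R).
Local Notation N := (@normal_prob R 0).

(* Left unevaluated (it is 1): any finite value yields a constant. *)
Definition gauss_m2 : R := fine (\int[mu]_x (x ^+ 2 * normal_pdf 0 1 x)%:E)%E.

(** Since x^2 / 4 <= exp(x^2 / 4), one has x^2 exp(- x^2 / 2) <= 4 exp(- x^2 / 4): the integrand is
    dominated by a multiple of the normal density of variance 2. *)
Lemma gauss_m2_lty : (\int[mu]_x (x ^+ 2 * normal_pdf 0 (1 : R) x)%:E < +oo)%E.
Proof.
have s2 : Num.sqrt 2 != 0 :> R by rewrite gt_eqF // sqrtr_gt0.
pose c : R := 4 * normal_peak 1 / normal_peak (Num.sqrt 2).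
have c0 : 0 <= c by rewrite divr_ge0 ?mulr_ge0 ?normal_peak_ge0.
apply: (@le_lt_trans _ _ (\int[mu]_x (c%:E * (normal_pdf 0 (Num.sqrt 2) x)%:E))%E).
  apply: le_integral_nomeas => x _.
    by rewrite lee_fin mulr_ge0 ?sqr_ge0 ?normal_pdf_ge0.
  rewrite -EFinM lee_fin !normal_pdfE ?oner_neq0 // /normal_fun subr0.
  rewrite sqr_sqrtr // expr1n.
  have -> : c * (normal_peak (Num.sqrt 2) * expR (- x ^+ 2 / (2 *+ 2))) =
     normal_peak 1 * (4 * expR (- x ^+ 2 / (2 *+ 2))).
    by rewrite /c; field; rewrite gt_eqF // normal_peak_gt0.
  rewrite mulrCA ler_wpM2l ?normal_peak_ge0 //.
  have -> : - x ^+ 2 / (1 *+ 2) = - (x ^+ 2 / 4) + - (x ^+ 2 / 4) by field.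
  have -> : - x ^+ 2 / (2 *+ 2) = - (x ^+ 2 / 4) by field.
  rewrite expRD mulrA ler_wpM2r ?expR_ge0 // expRN ler_pdivrMr ?expR_gt0 //.
  have := @expR_ge1Dx R (x ^+ 2 / 4); lra.
rewrite ge0_integralZl_EFin //.
- by rewrite integral_normal_pdf mule1 ltry.
- by move=> x _; rewrite lee_fin normal_pdf_ge0.
- by apply/measurable_EFinP; exact: measurable_normal_pdf.
Qed.

Lemma ge0_integral_normal_prob s (f : R -> \bar R) : s != 0 ->
  measurable_fun setT f -> (forall x, (0 <= f x)%E) ->
  (\int[N s]_x f x = \int[mu]_x (f x * (normal_pdf 0 s x)%:E))%E.
Proof.
move=> s0 mf f0; apply: (@ge0_integral_density _ _ _ lebesgue_measure (N s) (normal_pdf 0 s)) => //.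
- exact: measurable_normal_pdf.
- by move=> x; exact: normal_pdf_ge0.
Qed.

Lemma normal_prob_sqr s : 0 < s ->
  (\int[N s]_x (x ^+ 2)%:E = (s ^+ 2 * gauss_m2)%:E)%E.
Proof.
move=> s0; have sn0 : s != 0 by rewrite gt_eqF.
rewrite ge0_integral_normal_prob //; last 2 first.
- by apply/measurable_EFinP; exact: exprn_measurable.
- by move=> x; rewrite lee_fin sqr_ge0.
have c2 : continuous (fun x : R => x ^+ 2 * normal_pdf 0 1 x).
  move=> x; apply: cvgM; first exact: exprn_continuous.
  by apply: continuous_normal_pdf; exact: oner_neq0.
have d1 : (fun x : R => x / s)^`()%classic = cst (s^-1).
  apply/funext => x; rewrite derive1E.
  by rewrite derive_val /GRing.scale /= mulr0 add0r mulr1.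
have E : (\int[mu]_x (x ^+ 2 * normal_pdf 0 (1 : R) x)%:E =
   \int[mu]_x ((s ^- 2)%:E * ((x ^+ 2)%:E * (normal_pdf 0 s x)%:E)))%E.
  rewrite (@increasing_ge0_integration_by_substitutionT _ (fun x => x / s)).
  - apply: eq_integral => x _; rewrite d1 -!EFinM.
    transitivity (((x / s) ^+ 2 * normal_pdf 0 1 (x / s)) * s^-1)%:E; first by [].
    congr EFin; rewrite !normal_pdfE ?oner_neq0 // /normal_fun /normal_peak !subr0 !expr1n.
    have -> : Num.sqrt (s ^+ 2 * pi *+ 2) = s * Num.sqrt (1 * pi *+ 2).
      by rewrite -mulrnAr sqrtrM ?sqr_ge0 // sqrtr_sqr (gtr0_norm s0) mul1r.
    rewrite mul1r.
    rewrite (_ : - (x / s) ^+ 2 / (1 *+ 2) = - x ^+ 2 / (s ^+ 2 *+ 2)); last by field.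
    field.
    by rewrite sn0 gt_eqF // sqrtr_gt0 pmulrn_lgt0 // pi_gt0.
  - by move=> x y xy; rewrite ltr_pM2r ?invr_gt0.
  - by rewrite d1; move=> x; exact: cvg_cst.
  - by rewrite d1; exact: is_cvg_cst.
  - by rewrite d1; exact: is_cvg_cst.
  - by move=> x.
  - by apply: gt0_cvgMlNy; [rewrite invr_gt0|exact: cvg_id].
  - by apply: gt0_cvgMly; [rewrite invr_gt0|exact: cvg_id].
  - exact: c2.
  - by move=> x; rewrite mulr_ge0 ?sqr_ge0 ?normal_pdf_ge0.
have mf : measurable_fun setT (fun x : R => ((x ^+ 2)%:E * (normal_pdf 0 s x)%:E)%E).
  apply: emeasurable_funM; apply/measurable_EFinP; first exact: exprn_measurable.
  exact: measurable_normal_pdf.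
have f0 (x : R) : (0 <= (x ^+ 2)%:E * (normal_pdf 0 s x)%:E)%E.
  by rewrite mule_ge0 ?lee_fin ?sqr_ge0 ?normal_pdf_ge0.
rewrite EFinM /gauss_m2 fineK; last first.
  rewrite ge0_fin_numE ?gauss_m2_lty //; apply: integral_ge0 => x _.
  by rewrite lee_fin mulr_ge0 ?sqr_ge0 ?normal_pdf_ge0.
rewrite E ge0_integralZl_EFin ?invr_ge0 ?sqr_ge0 //.
by rewrite muleA -EFinM mulfV ?mul1e // expf_neq0.
Qed.

Lemma normal_prob_integrable s : 0 < s -> (N s).-integrable setT (EFin \o (@id R)).
Proof.
move=> s0.
apply: (@le_integrable _ (measurableTypeR R) R (N s) setT measurableT _ (fun x : R => (1 + x ^+ 2)%:E)).
- exact/measurable_EFinP.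
- move=> x _ /=; rewrite lee_fin [leRHS]ger0_norm ?addr_ge0 ?sqr_ge0 //.
  rewrite ler_norml; apply/andP; split; nra.
under eq_fun do rewrite EFinD.
apply: integrableD => //; first exact: finite_measure_integrable_cst.
apply/integrableP; split; first by apply/measurable_EFinP; exact: exprn_measurable.
under eq_integral do rewrite /= ger0_norm ?sqr_ge0 //.
by rewrite normal_prob_sqr // ltry.
Qed.

Lemma normal_prob_opp s (A : set R) : s != 0 -> measurable A ->
  pushforward (N s) (-%R : _ -> measurableTypeR R) A = N s A.
Proof.
move=> s0 mA; rewrite /pushforward /normal_prob integral_mkcond [RHS]integral_mkcond.
rewrite -(@integral_reflect _ 0).
- apply: eq_integral => x _; rewrite !patchE sub0r.
  have -> : normal_pdf 0 s (- x) = normal_pdf 0 s x.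
    by rewrite !normal_pdfE //= /normal_fun !subr0 sqrrN.
  by congr (if _ then _ else _); apply/idP/idP; rewrite !inE /= ?opprK.
- apply/measurable_restrict => //; first by rewrite -[X in measurable X]setTI; exact: oppr_measurable.
  by apply/measurable_EFinP; apply: measurable_funTS; exact: measurable_normal_pdf.
- by move=> x; rewrite patchE; case: ifPn => // _; rewrite lee_fin normal_pdf_ge0.
Qed.

(** The law is invariant under x -> - x, so the mean equals its opposite, and integrability makes it
    finite. *)
Lemma normal_prob_mean s : 0 < s -> (\int[N s]_x x%:E = 0)%E.
Proof.
move=> s0; have sn0 : s != 0 by rewrite gt_eqF.
have i := normal_prob_integrable s0.
have E : (\int[N s]_x x%:E = - \int[N s]_x x%:E)%E.
  transitivity (\int[pushforward (N s) (-%R : _ -> measurableTypeR R)]_x x%:E)%E.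
    apply: eq_measure_integral => A mA _.
    by apply/esym; exact: normal_prob_opp.
  rewrite integral_pushforward //=; last first.
    by have := integrableN i; apply: eq_integrable.
  under eq_integral do rewrite EFinN.
  by rewrite integralN //; apply: integrable_add_def i.
have := integrable_fin_num measurableT i; move: E.
rewrite /comp /=; case: (integral _ _ _) => //= r [] rr _; congr EFin; lra.
Qed.
End gauss.

(** * Products of independent random variables *)

Section product_integral.
Context d1 d2 (X : measurableType d1) (Y : measurableType d2) (R : realType).
Variables (m1 : {sigma_finite_measure set X -> \bar R}).
Variables (m2 : {sigma_finite_measure set Y -> \bar R}).
Variables (f : X -> R) (g : Y -> R).
Hypothesis fi : m1.-integrable setT (EFin \o f).
Hypothesis gi : m2.-integrable setT (EFin \o g).

Let mf : measurable_fun setT f.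
Proof. by apply/measurable_EFinP; exact: measurable_int fi. Qed.
Let mg : measurable_fun setT g.
Proof. by apply/measurable_EFinP; exact: measurable_int gi. Qed.

Lemma integrable_prod :
  (m1 \x m2)%E.-integrable setT (fun z => (f z.1 * g z.2)%:E).
Proof.
apply/integrable12ltyP.
  apply/measurable_EFinP; apply: measurable_funM.
    exact: (measurableT_comp mf).
  exact: (measurableT_comp mg).
have -> : (\int[m1]_x \int[m2]_y `|(f (x, y).1 * g (x, y).2)%:E|)%E =
   ((\int[m1]_x `|f x|%:E) * (\int[m2]_y `|g y|%:E))%E.
  have mfe : measurable_fun setT (fun x => `|f x|%:E).
    by apply/measurable_EFinP; exact: measurableT_comp.
  have ge0g : (0 <= \int[m2]_y `|g y|%:E)%E.
    by apply: integral_ge0 => y _; rewrite lee_fin.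
  rewrite -ge0_integralZr //.
  have mge : measurable_fun setT (fun x => `|g x|%:E).
    by apply/measurable_EFinP; exact: measurableT_comp.
  apply: eq_integral => x _ /=; rewrite -ge0_integralZl_EFin //.
  by apply: eq_integral => y _ /=; rewrite normrM EFinM.
have /integrableP[_ fl] := fi; have /integrableP[_ gl] := gi.
apply: lte_mul_pinfty => //.
  by apply: integral_ge0 => x _; rewrite lee_fin.
by rewrite ge0_fin_numE //; apply: integral_ge0 => x _; rewrite lee_fin.
Qed.

Lemma Rintegral_prod :
  \int[(m1 \x m2)%E]_z (f z.1 * g z.2) = \int[m1]_x f x * \int[m2]_y g y.
Proof.
have gfin : (\int[m2]_y (g y)%:E)%E \is a fin_num by exact: integrable_fin_num.
rewrite /Rintegral -integral12_prod_meas1; last exact: integrable_prod.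
rewrite -fineM //; last exact: integrable_fin_num.
congr fine; rewrite -(fineK gfin) -integralZr //.
apply: eq_integral => x _; rewrite /fubini_F /= (fineK gfin) -integralZl //.
Qed.
End product_integral.

Section independence.
Context d (Om : measurableType d) (R : realType) (P : probability Om R).
Variables X Z : {RV P >-> R}.
Hypothesis XZ : forall U V : set R, measurable U -> measurable V ->
  P (X @^-1` U `&` Z @^-1` V) = (P (X @^-1` U) * P (Z @^-1` V))%E.
Hypothesis Xi : P.-integrable setT (EFin \o X).
Hypothesis Zi : P.-integrable setT (EFin \o Z).

Let J (w : Om) : R * R := (X w, Z w).
Let mJ : measurable_fun setT J. Proof. exact: measurable_fun_pair. Qed.
HB.instance Definition _ := isMeasurableFun.Build _ _ _ _ J mJ.

(** [XZ] is the equality on rectangles, and a product measure is determined by rectangles.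
    Expectations of products then reduce to Fubini for the product of the two laws. *)
Let JE (A : set (R * R)) : measurable A ->
  distribution P J A = (distribution P X \x distribution P Z)%E A.
Proof.
move=> mA; apply/esym; apply: (@product_measure_unique _ _ _ _ _ _ _ (distribution P J)) => //.
Qed.

Let mxy : measurable_fun setT (fun z : R * R => (z.1 * z.2)%:E).
Proof. by apply/measurable_EFinP; exact: measurable_funM. Qed.

Let Xi' : (distribution P X).-integrable setT (EFin \o @id R).
Proof. by apply: integrable_pushforward => //; exact/measurable_EFinP. Qed.
Let Zi' : (distribution P Z).-integrable setT (EFin \o @id R).
Proof. by apply: integrable_pushforward => //; exact/measurable_EFinP. Qed.

Lemma indep_integrable : P.-integrable setT (fun w => (X w * Z w)%:E).
Proof.
have /integrableP[_ h] := integrable_prod Xi' Zi'.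
apply/integrableP; split.
  by apply/measurable_EFinP; exact: measurable_funM.
apply: le_lt_trans h.
rewrite [leRHS](eq_measure_integral (distribution P J)); last by move=> A mA _; apply: (etrans (esym (JE mA))).
rewrite ge0_integral_distribution //.
exact: measurableT_comp.
Qed.

Lemma indep_Rintegral :
  \int[P]_w (X w * Z w) = \int[P]_w X w * \int[P]_w Z w.
Proof.
have XE : \int[distribution P X]_x x = \int[P]_w X w.
  by rewrite /Rintegral integral_distribution.
have ZE : \int[distribution P Z]_x x = \int[P]_w Z w.
  by rewrite /Rintegral integral_distribution.
rewrite -XE -ZE -(Rintegral_prod Xi' Zi') /Rintegral; congr fine.
rewrite [RHS](eq_measure_integral (distribution P J)); last by move=> A mA _; apply: (etrans (esym (JE mA))).
by rewrite integral_distribution //; exact: indep_integrable.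
Qed.
End independence.

(** * Functional equation of the Gamma function *)

Section gamma.
Variable R : realType.
Local Notation mu := (@lebesgue_measure R).

(** [fine] sends both infinities to 0, so a positive factor passes through it for every extended
    value. [Gamma_succ] uses this to turn an identity of extended integrals into one of reals. *)
Lemma fine_pmull (a : R) (z : \bar R) : 0 < a -> fine (a%:E * z)%E = a * fine z.
Proof.
move=> a0; case: z => [r||]; first by [].
  by rewrite gt0_muley ?lte_fin // mulr0.
by rewrite gt0_muleNy ?lte_fin // mulr0.
Qed.

(** Tonelli takes the place of integration by parts: a u^(a - 1) exp(- v) is integrated over 0 < u <
    v in both orders. Integrating v out first leaves a u^(a - 1) exp(- u), integrating u out first
    leaves v^a exp(- v). The scheme has Gamma(alpha + 1) in its drift where the equation has
    Gamma(alpha), so the identity is needed to compare them. *)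
Lemma Gamma_succ (a : R) : 0 < a -> Gamma (a + 1) = a * Gamma a.
Proof.
move=> a0; have a0' := ltW a0; rewrite /Gamma /Rintegral addrK.
have mg : measurable_fun setT (fun u : R => u `^ (a - 1) * expR (- u)).
  apply: measurable_funM; first exact: measurable_powR.
  exact: measurableT_comp.
have g0 (u : R) : 0 <= u `^ (a - 1) * expR (- u) by rewrite mulr_ge0 ?powR_ge0 ?expR_ge0.
pose D := [set z : R * R | 0 < z.1 < z.2].
pose h (z : R * R) := ((0 < z.1 < z.2)%R%:R * (a * z.1 `^ (a - 1) * expR (- z.2)))%:E.
have mD : measurable D.
  have -> : D = (fun z : R * R => (0 < z.1) && (z.1 < z.2)) @^-1` [set true].
    by apply/seteqP; split => z /=.
  rewrite -[X in measurable X]setTI.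
  apply: (@measurable_and _ _ _ (fun z : R * R => 0 < z.1) (fun z : R * R => z.1 < z.2)) => //.
    apply: measurable_fun_ltr => //; exact: measurable_fst.
  apply: measurable_fun_ltr; [exact: measurable_fst|exact: measurable_snd].
have mh : measurable_fun setT h.
  apply/measurable_EFinP; apply: measurable_funM.
    have -> : (fun z : R * R => (0 < z.1 < z.2)%R%:R) = \1_D :> (R * R -> R).
      by apply/funext => z; rewrite indicE; congr (nat_of_bool _)%:R; apply/idP/idP; rewrite inE.
    exact: measurable_indic.
  apply: measurable_funM; last first.
    apply: measurableT_comp => //; apply: measurableT_comp => //.
  apply: measurable_funM => //; apply: (measurableT_comp (measurable_powR (a - 1))) => //.
have h0 z : (0%R <= h z)%E.
  by rewrite lee_fin !mulr_ge0 ?powR_ge0 ?expR_ge0 ?(ltW a0).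
have F := @fubini_tonelli _ _ _ _ _ mu mu h mh h0.
have L : (\int[mu]_u \int[mu]_v h (u, v) =
    a%:E * \int[mu]_(u in `]0%R, +oo[) (u `^ (a - 1) * expR (- u))%:E)%E.
  have mg0 : measurable_fun (`]0%R, +oo[%classic : set R) (fun u : R => (u `^ (a - 1) * expR (- u))%:E).
    by apply/measurable_EFinP; exact: measurable_funTS.
  have <- : (\int[mu]_(u in `]0%R, +oo[) (a%:E * (u `^ (a - 1) * expR (- u))%:E) =
     a%:E * \int[mu]_(u in `]0%R, +oo[) (u `^ (a - 1) * expR (- u))%:E)%E.
    clear F mh h0 mD mg; apply: ge0_integralZl_EFin => // u _; by rewrite lee_fin.
  rewrite [RHS]integral_mkcond; apply: eq_integral => u _; rewrite patchE.
  clear F mh h0 mD mg; rewrite mem_setE in_itv /= andbT; case: ifPn => u0.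
    have me D' : measurable_fun D' (fun v : R => (expR (- v))%:E).
      by apply/measurable_EFinP; apply: measurable_funTS; exact: measurableT_comp.
    rewrite -EFinM mulrA EFinM -integral_expRN_tail -integral_itv_obnd_cbnd; last exact: me.
    have <- : (\int[mu]_(v in `]u, +oo[) ((a * u `^ (a - 1))%:E * (expR (- v))%:E) =
      (a * u `^ (a - 1))%:E * \int[mu]_(v in `]u, +oo[) (expR (- v))%:E)%E.
      by apply: ge0_integralZl_EFin => //; do ?[exact: me|
        move=> v _; rewrite lee_fin expR_ge0 //|rewrite mulr_ge0 ?powR_ge0 //].
    rewrite [RHS]integral_mkcond; apply: eq_integral => v _; rewrite patchE /h.
    rewrite !mem_setE /= u0 /= in_itv /= andbT.
    by case: ifPn => _; rewrite ?mul1r ?mul0r.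
  apply: integral0_eq => v _.
  by rewrite /h /= (negbTE u0) mul0r.
have Rt : (\int[mu]_v \int[mu]_u h (u, v) =
    \int[mu]_(v in `]0%R, +oo[) (v `^ a * expR (- v))%:E)%E.
  rewrite [RHS]integral_mkcond; apply: eq_integral => v _; rewrite patchE.
  clear F mh h0 mD mg; rewrite mem_setE in_itv /= andbT; case: ifPn => v0.
    rewrite (_ : v `^ a * expR (- v) = (a * expR (- v)) * (v `^ a / a)); last by field; rewrite gt_eqF.
    have mp D' : measurable_fun D' (fun u : R => (u `^ (a - 1))%:E).
      by apply/measurable_EFinP; apply: measurable_funTS; exact: measurable_powR.
    rewrite EFinM -integral_powR ?(ltW v0) //.
    have <- : (\int[mu]_(u in `]0%R, v]) ((a * expR (- v))%:E * (u `^ (a - 1))%:E) =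
      (a * expR (- v))%:E * \int[mu]_(u in `]0%R, v]) (u `^ (a - 1))%:E)%E.
      by apply: ge0_integralZl_EFin => //; do ?[exact: mp|
        move=> u _; rewrite lee_fin powR_ge0 //|rewrite mulr_ge0 ?expR_ge0 //].
    rewrite -integral_itv_bndo_bndc; last first.
      apply/measurable_EFinP; apply: measurable_funTS; apply: measurable_funM => //; exact: measurable_powR.
    rewrite [RHS]integral_mkcond; apply: eq_integral => u _; rewrite patchE /h.
    rewrite !mem_setE /= in_itv /=.
    case: ifPn => _; rewrite ?mul1r ?mul0r //.
    by rewrite -EFinM; congr EFin; ring.
  apply: integral0_eq => u _.
  rewrite /h /=; case: (boolP (_ < u < v)) => [/andP[u0 uv]|]; last by rewrite mul0r.
  by rewrite (lt_trans u0 uv) in v0.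
rewrite -Rt -F L; exact: fine_pmull.
Qed.
End gamma.

Lemma sqrD_le (R : realDomainType) (x y : R) :
  (x + y) ^+ 2 <= 2 * x ^+ 2 + 2 * y ^+ 2.
Proof.
rewrite -subr_ge0 (_ : _ - _ = (x - y) ^+ 2) ?sqr_ge0 //; ring.
Qed.

(** * Square integrable functions *)

Section square_integrable.
Context d (X : measurableType d) (R : realType).
Variable nu : {measure set X -> \bar R}.
Implicit Types f g : X -> R.

Definition sqint f := measurable_fun setT f /\ (\int[nu]_x (f x ^+ 2)%:E < +oo)%E.

Lemma sqint_sqr f : sqint f -> nu.-integrable setT (fun x => (f x ^+ 2)%:E).
Proof.
move=> [mf lf]; apply/integrableP; split.
  by apply/measurable_EFinP; exact: measurable_funX.
by under eq_integral do rewrite /= ger0_norm ?sqr_ge0 //.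
Qed.

Lemma sqint_mul f g : sqint f -> sqint g ->
  nu.-integrable setT (fun x => (f x * g x)%:E).
Proof.
move=> hf hg.
apply: (le_integrable _ _ _ (integrableD _ (sqint_sqr hf) (sqint_sqr hg))) => //.
  by apply/measurable_EFinP; apply: measurable_funM; [case: hf|case: hg].
move=> x _ /=; rewrite lee_fin [leRHS]ger0_norm ?addr_ge0 ?sqr_ge0 //.
rewrite ler_norml; apply/andP; split; nra.
Qed.

Lemma sqintD f g : sqint f -> sqint g -> sqint (fun x => f x + g x).
Proof.
move=> hf hg; split; first by apply: measurable_funD; [case: hf|case: hg].
have /integrableP[_] := integrableD measurableT
  (integrableZl measurableT 2 (sqint_sqr hf)) (integrableZl measurableT 2 (sqint_sqr hg)).
apply: le_lt_trans; apply: le_integral_nomeas => x _; first by rewrite lee_fin sqr_ge0.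
rewrite -!EFinM -EFinD lee_fin; apply: le_trans (ler_norm _); exact: sqrD_le.
Qed.

Lemma sqintZ (c : R) f : sqint f -> sqint (fun x => c * f x).
Proof.
move=> hf; split; first by apply: measurable_funM => //; case: hf.
have /integrableP[_] := integrableZl measurableT (c ^+ 2) (sqint_sqr hf).
apply: le_lt_trans; apply: le_integral_nomeas => x _; first by rewrite lee_fin sqr_ge0.
by rewrite -EFinM lee_fin exprMn ler_norm.
Qed.

End square_integrable.

(** * Measurability for a sub-sigma-algebra *)

Section gmeas.
Context (X : pointedType) (R : realType).
Variable G : set (set X).

Definition gmeas (f : X -> R) := forall U : set R, measurable U -> G [set x | U (f x)].

Hypothesis sG : sigma_algebra setT G.

(** Makes the closure lemmas for [measurable_fun] available for each F_t, which is only a set of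
    sets and carries no structure of its own. *)
Lemma gmeasP (f : X -> R) :
  gmeas f <-> measurable_fun setT (f : g_sigma_algebraType G -> R).
Proof.
have E : @measurable _ (g_sigma_algebraType G) = G.
  by rewrite /measurable /= sigma_algebra_id.
split => [gf _ U mU|mf U mU].
  by rewrite setTI E; exact: gf.
by rewrite -E; have := mf measurableT U mU; rewrite setTI.
Qed.

Lemma gmeasM f g : gmeas f -> gmeas g -> gmeas (fun x => f x * g x).
Proof.
by move=> /gmeasP mf /gmeasP mg; apply/gmeasP; exact: measurable_funM.
Qed.

Lemma gmeasB f g : gmeas f -> gmeas g -> gmeas (fun x => f x - g x).
Proof.
by move=> /gmeasP mf /gmeasP mg; apply/gmeasP; exact: measurable_funB.
Qed.

Lemma gmeasX f n : gmeas f -> gmeas (fun x => f x ^+ n).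
Proof. by move=> /gmeasP mf; apply/gmeasP; exact: measurable_funX. Qed.

End gmeas.

Section indep_fun.
Context d (Om : measurableType d) (R : realType) (P : probability Om R).

Lemma indep_fun (X Z : Om -> R) :
  measurable_fun setT X -> measurable_fun setT Z ->
  (forall U V : set R, measurable U -> measurable V ->
    P ([set w | U (X w)] `&` [set w | V (Z w)]) =
    (P [set w | U (X w)] * P [set w | V (Z w)])%E) ->
  P.-integrable setT (EFin \o X) -> P.-integrable setT (EFin \o Z) ->
  P.-integrable setT (fun w => (X w * Z w)%:E) /\
  \int[P]_w (X w * Z w) = \int[P]_w X w * \int[P]_w Z w.
Proof.
move=> mX mZ XZ iX iZ.
pose X' : {RV P >-> R} := mfun_Sub (mem_set mX : X \in mfun).
pose Z' : {RV P >-> R} := mfun_Sub (mem_set mZ : Z \in mfun).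
split; first exact: (@indep_integrable _ _ _ P X' Z').
exact: (@indep_Rintegral _ _ _ P X' Z').
Qed.
End indep_fun.

(** * Increments of a scalar Brownian motion against adapted factors *)

Section scalar_brownian.
Context d (Om : measurableType d) (R : realType) (P : probability Om R).
Variable F : R -> set (set Om).

Record scalar_bm (b : R -> Om -> R) : Prop := ScalarBm {
  bm_adapted : forall t, 0 <= t -> gmeas (F t) (b t);
  bm_law : forall s t (U : set R), 0 <= s -> s < t -> measurable U ->
    P [set w | U (b t w - b s w)] = normal_prob 0 (Num.sqrt (t - s)) U;
  bm_indep : forall s t E (U : set R), 0 <= s -> s < t -> F s E -> measurable U ->
    P (E `&` [set w | U (b t w - b s w)]) =
    (P E * P [set w | U (b t w - b s w)%R])%E }.

Hypothesis HF : filtration F.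
Variable b : R -> Om -> R.
Hypothesis hb : scalar_bm b.
Implicit Types (s t a e : R) (c y : Om -> R).

Local Notation incr s t := (fun w : Om => b t w - b s w).

Lemma gmeas_mono s t c : 0 <= s -> s <= t -> gmeas (F s) c -> gmeas (F t) c.
Proof. by move=> s0 st hc U mU; apply: (filtration_mono HF s0 st); exact: hc. Qed.

Lemma gmeas_measurable t c : 0 <= t -> gmeas (F t) c -> measurable_fun setT c.
Proof.
move=> t0 hc _ U mU; rewrite setTI; apply: (filtration_measurable HF t0).
exact: hc.
Qed.

Lemma gmeas_incr s t : 0 <= s -> s <= t -> gmeas (F t) (incr s t).
Proof.
move=> s0 st; have t0 := le_trans s0 st.
apply: (gmeasB (filtration_sigma HF t0)); first exact: (bm_adapted hb).
by apply: (gmeas_mono s0 st); exact: (bm_adapted hb).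
Qed.

Lemma measurable_incr s t : 0 <= s -> s <= t -> measurable_fun setT (incr s t).
Proof.
by move=> s0 st; apply: (gmeas_measurable (le_trans s0 st)); exact: gmeas_incr.
Qed.

Lemma incr_integral s t (f : R -> \bar R) : 0 <= s -> s < t ->
  measurable_fun setT f -> (forall x, (0 <= f x)%E) ->
  (\int[P]_w f (b t w - b s w)%R = \int[normal_prob 0 (Num.sqrt (t - s))]_x f x)%E.
Proof.
move=> s0 st mf f0; have mi := measurable_incr s0 (ltW st).
transitivity (\int[pushforward P (incr s t : Om -> measurableTypeR R)]_x f x)%E.
  by rewrite ge0_integral_pushforward.
apply: eq_measure_integral => A mA _; exact: (bm_law hb).
Qed.

Lemma incr_sqr s t : 0 <= s -> s <= t ->
  (\int[P]_w ((b t w - b s w) ^+ 2)%:E = ((t - s) * gauss_m2 R)%:E)%E.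
Proof.
move=> s0; rewrite le_eqVlt => /predU1P[<-|st].
  rewrite subrr mul0r; apply: integral0_eq => w _.
  by rewrite subrr expr0n.
have ts0 : 0 < t - s by rewrite subr_gt0.
rewrite (incr_integral (f := fun x => (x ^+ 2)%:E)) //.
- by rewrite normal_prob_sqr ?sqrtr_gt0 // sqr_sqrtr // ltW.
- by apply/measurable_EFinP; exact: exprn_measurable.
- by move=> x; rewrite lee_fin sqr_ge0.
Qed.

Lemma incr_sqint s t : 0 <= s -> s <= t -> sqint P (incr s t).
Proof.
move=> s0 st; split; first exact: measurable_incr.
by rewrite incr_sqr // ltry.
Qed.

Lemma sqint_integrable c : sqint P c -> P.-integrable setT (EFin \o c).
Proof.
move=> hc; have h1 : sqint P (cst 1).
  split => //; under eq_integral do rewrite /cst expr1n.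
  rewrite integral_cst // mul1e.
  by apply: (le_lt_trans (probability_le1 P measurableT)); rewrite ltry.
by have := sqint_mul hc h1; apply: eq_integrable => // w _ /=; rewrite /cst mulr1.
Qed.

Lemma incr_mean s t : 0 <= s -> s <= t -> \int[P]_w (b t w - b s w) = 0.
Proof.
move=> s0; rewrite le_eqVlt => /predU1P[<-|st].
  by rewrite /Rintegral integral0_eq // => w _; rewrite subrr.
have mi := measurable_incr s0 (ltW st).
rewrite /Rintegral.
transitivity (fine (\int[pushforward P (incr s t : Om -> measurableTypeR R)]_x x%:E)).
  congr fine; rewrite integral_pushforward //.
  exact: sqint_integrable (incr_sqint s0 (ltW st)).
transitivity (fine (\int[normal_prob 0 (Num.sqrt (t - s))]_x x%:E)).
  congr fine; apply: eq_measure_integral => A mA _; exact: (bm_law hb).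
by rewrite normal_prob_mean // sqrtr_gt0 subr_gt0.
Qed.

(** The function [k] is a parameter to cover both the increment itself ([incr_zero]) and its square
    ([incr_square]). *)
Lemma incr_indep s t y (k : R -> R) : 0 <= s -> s <= t -> gmeas (F s) y ->
  measurable_fun setT k ->
  P.-integrable setT (EFin \o y) ->
  P.-integrable setT (fun w => (k (b t w - b s w))%:E) ->
  P.-integrable setT (fun w => (y w * k (b t w - b s w))%:E) /\
  \int[P]_w (y w * k (b t w - b s w)) =
  \int[P]_w y w * \int[P]_w k (b t w - b s w).
Proof.
move=> s0 st gy mk iy ik; have mi := measurable_incr s0 st.
have mki : measurable_fun setT (fun w => k (b t w - b s w)) by exact: measurableT_comp.
apply: indep_fun => //; first exact: gmeas_measurable gy.
move=> U V mU mV.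
have mkV : measurable [set x | V (k x)].
  by have := mk measurableT V mV; rewrite setTI.
(* [bm_indep] covers s < t. For s = t the increment is the constant 0, so the event about it is
   empty or everything. *)
move: st; rewrite le_eqVlt => /predU1P[<-|st].
  have -> : [set w | V (k (b s w - b s w))] = [set w : Om | V (k 0)].
    by apply/seteqP; split => w /=; rewrite subrr.
  have [Vk|Vk] := pselect (V (k 0)).
    have -> : [set w : Om | V (k 0)] = setT by apply/seteqP; split => w.
    by rewrite setIT probability_setT mule1.
  have -> : [set w : Om | V (k 0)] = set0 by apply/seteqP; split => w.
  by rewrite setI0 measure0 mule0.
exact: (bm_indep hb s0 st (gy _ mU) mkV).
Qed.

Lemma incr_zero s t y : 0 <= s -> s <= t -> gmeas (F s) y ->
  P.-integrable setT (EFin \o y) ->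
  P.-integrable setT (fun w => (y w * (b t w - b s w))%:E) /\
  \int[P]_w (y w * (b t w - b s w)) = 0.
Proof.
move=> s0 st gy iy.
have mid : measurable_fun setT (@id R) by [].
have iD := sqint_integrable (incr_sqint s0 st).
have [i ->] := @incr_indep s t y id s0 st gy mid iy iD.
by rewrite /= incr_mean // mulr0.
Qed.

Lemma incr_square s t y : 0 <= s -> s <= t -> gmeas (F s) y ->
  P.-integrable setT (EFin \o y) ->
  P.-integrable setT (fun w => (y w * (b t w - b s w) ^+ 2)%:E) /\
  \int[P]_w (y w * (b t w - b s w) ^+ 2) = gauss_m2 R * (t - s) * \int[P]_w y w.
Proof.
move=> s0 st gy iy.
have [||i ->] := @incr_indep s t y (fun x => x ^+ 2) s0 st gy _ iy.
- exact: exprn_measurable.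
- exact: sqint_sqr (incr_sqint s0 st).
split=> //.
by rewrite [X in _ * X]/Rintegral incr_sqr //= mulrC [_ * gauss_m2 R]mulrC.
Qed.

(** A product of two square integrable functions need not be square integrable. Independence makes
    it so here, through [incr_square] applied to c^2. *)
Lemma sqint_incr s t c : 0 <= s -> s <= t -> gmeas (F s) c -> sqint P c ->
  sqint P (fun w => c w * (b t w - b s w)).
Proof.
move=> s0 st gc hc; split.
  by apply: measurable_funM; [case: hc|exact: measurable_incr].
have [|/integrableP[_ h] _] := incr_square s0 st (gmeasX (filtration_sigma HF s0) 2 gc).
  exact: sqint_sqr.
apply: le_lt_trans h; apply: le_integral_nomeas => w _; first by rewrite lee_fin sqr_ge0.
by rewrite exprMn lee_fin ler_norm.
Qed.

Definition overlap a e a' e' := Num.max 0 (Num.min e e' - Num.max a a').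

(** If e <= a', the second increment is centred and independent of all other factors. Otherwise the
    increments are cut at a', p = min e e' and q = max e e': the part of the first before a' and the
    increment over [p, q] each produce a term of mean zero, and only the square of the common
    increment over [a', p] remains. *)
Let pair_isometry_le a e a' e' c c' : 0 <= a -> a <= e -> a <= a' -> a' <= e' ->
  gmeas (F a) c -> gmeas (F a') c' -> sqint P c -> sqint P c' ->
  \int[P]_w (c w * (b e w - b a w) * (c' w * (b e' w - b a' w))) =
  gauss_m2 R * overlap a e a' e' * \int[P]_w (c w * c' w).
Proof.
move=> a0 ae aa' ae' gc gc' hc hc'.
have a'0 := le_trans a0 aa'.
have sF t : 0 <= t -> sigma_algebra setT (F t) by move=> t0; exact: filtration_sigma.
have gca' := gmeas_mono a0 aa' gc.
rewrite /overlap (max_r aa').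
have [ea'|a'e] := leP e a'.
  have -> : Num.max 0 (Num.min e e' - a') = 0.
    by apply/max_idPl; rewrite subr_le0 ge_min ea'.
  rewrite mulr0 mul0r.
  have gy : gmeas (F a') (fun w => c w * (b e w - b a w) * c' w).
    apply: (gmeasM (sF _ a'0)) => //; apply: (gmeasM (sF _ a'0)) => //.
    apply: (gmeas_mono (le_trans a0 ae) ea'); exact: gmeas_incr.
  have iy := sqint_mul (sqint_incr a0 ae gc hc) hc'.
  have [_ <-] := incr_zero a'0 ae' gy iy.
  by apply: eq_Rintegral => w _; rewrite mulrA.
pose p := Num.min e e'; pose q := Num.max e e'.
have a'p : a' <= p by rewrite le_min ae' ltW.
have pq : p <= q by rewrite ge_min le_max lexx.
have p0 := le_trans a'0 a'p.
have -> : Num.max 0 (p - a') = p - a' by apply/max_idPr; rewrite subr_ge0.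
have gcc : gmeas (F a') (fun w => c w * c' w) by exact: (gmeasM (sF _ a'0)).
have icc := sqint_mul hc hc'.
have g1 : gmeas (F a') (fun w => c w * (b a' w - b a w) * c' w).
  apply: (gmeasM (sF _ a'0)) => //; apply: (gmeasM (sF _ a'0)) => //; exact: gmeas_incr.
have [i1 E1] := incr_zero a'0 ae' g1 (sqint_mul (sqint_incr a0 aa' gc hc) hc').
have [i2 E2] := incr_square a'0 a'p gcc icc.
have [i3 _] := incr_zero a'0 a'p gcc icc.
have g3 : gmeas (F p) (fun w => c w * c' w * (b p w - b a' w)).
  apply: (gmeasM (sF _ p0)); first exact: gmeas_mono gcc.
  exact: gmeas_incr.
have [i4 E4] := incr_zero p0 pq g3 i3.
rewrite -E2.
transitivity (\int[P]_w ((c w * (b a' w - b a w) * c' w * (b e' w - b a' w)) +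
   ((c w * c' w * (b p w - b a' w) ^+ 2) +
    (c w * c' w * (b p w - b a' w) * (b q w - b p w))))).
  apply: eq_Rintegral => w _.
  rewrite /p /q; case: (leP e e') => _; ring.
rewrite RintegralD //; last by apply: eq_integrable (integrableD measurableT i2 i4).
by rewrite E1 add0r RintegralD // E4 addr0.
Qed.

Lemma pair_isometry a e a' e' c c' : 0 <= a -> a <= e -> 0 <= a' -> a' <= e' ->
  gmeas (F a) c -> gmeas (F a') c' -> sqint P c -> sqint P c' ->
  \int[P]_w (c w * (b e w - b a w) * (c' w * (b e' w - b a' w))) =
  gauss_m2 R * overlap a e a' e' * \int[P]_w (c w * c' w).
Proof.
move=> a0 ae a'0 ae' gc gc' hc hc'.
have [aa'|/ltW aa'] := leP a a'; first exact: pair_isometry_le.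
have := pair_isometry_le a'0 ae' aa' ae gc' gc hc' hc.
rewrite /overlap minC [Num.max a' a]maxC => E.
under eq_Rintegral do rewrite mulrC.
by rewrite E; congr (_ * _); apply: eq_Rintegral => w _; rewrite mulrC.
Qed.

End scalar_brownian.

(** * Measurability of compositions and of processes with continuous paths *)

Section glue.
Context d (X : measurableType d) (R : realType).

Lemma measurable_fun_glue (Z : countType) (idx : X -> Z) (psi : Z -> X -> R) :
  (forall z, measurable [set x | idx x = z]) ->
  (forall z, measurable_fun setT (psi z)) ->
  measurable_fun setT (fun x => psi (idx x) x).
Proof.
move=> midx mpsi _ U mU; rewrite setTI.
have -> : (fun x => psi (idx x) x) @^-1` U =
    \bigcup_z ([set x | idx x = z] `&` psi z @^-1` U).
  apply/seteqP; split => x /=; first by move=> Ux; exists (idx x).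
  by move=> [z _ [/= <-]].
apply: countable_bigcupT_measurable => // z.
by apply: measurableI => //; have := mpsi z measurableT U mU; rewrite setTI.
Qed.

Lemma measurable_floor_eq (V : X -> R) (z : int) : measurable_fun setT V ->
  measurable [set x | Num.floor (V x) = z].
Proof.
move=> mV.
have -> : [set x | Num.floor (V x) = z] = V @^-1` `[z%:~R, (z + 1)%:~R[%classic.
  apply/seteqP; split => x /=; rewrite in_itv /=.
    by move=> <-; rewrite floor_itv.
  by move=> h; apply/eqP; rewrite floor_eq.
by rewrite -[X in measurable X]setTI; exact: mV.
Qed.

Lemma floor_approx (k : nat) (v : R) :
  `|(Num.floor (k.+1%:R * v))%:~R / k.+1%:R - v| <= k.+1%:R^-1.
Proof.
have k0 : 0 < k.+1%:R :> R by [].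
rewrite -(ler_pM2l k0) mulfV ?gt_eqF // -{1}(gtr0_norm k0) -normrM mulrBr mulrCA mulfV ?gt_eqF // mulr1.
have /andP[h1 h2] := floor_itv (k.+1%:R * v).
rewrite intrD in h2.
rewrite ler_norml; apply/andP; split; lra.
Qed.

(** Rounding V down to the lattice of mesh 1 / (k + 1) leaves countably many values, so h of the
    rounded V is measurable piece by piece. The Lipschitz bound makes these functions converge to
    h(V). *)
Lemma measurable_lipschitz n (V : X -> 'cV[R]_n) (h : 'cV[R]_n -> R) (K : R) :
  (forall i, measurable_fun setT (fun x => V x i ord0)) ->
  (forall u v, `|h u - h v| <= K * \sum_i `|u i ord0 - v i ord0|) ->
  measurable_fun setT (fun x => h (V x)).
Proof.
move=> mV hK.
pose r k (z : 'cV[int]_n) : 'cV[R]_n := \col_i ((z i ord0)%:~R / k.+1%:R).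
pose idx k x : 'cV[int]_n := \col_i Num.floor (k.+1%:R * V x i ord0).
apply: (@measurable_fun_cvg _ _ _ _ (fun k x => h (r k (idx k x)))).
  move=> k; apply: (measurable_fun_glue (psi := fun z _ => h (r k z))) => // z.
  have -> : [set x | idx k x = z] =
      \bigcap_(i in [set: 'I_n]) [set x | Num.floor (k.+1%:R * V x i ord0) = z i ord0].
    apply/seteqP; split => x /=; first by move=> <- i _ /=; rewrite mxE.
    by move=> hx; apply/matrixP => i j; rewrite mxE (_ : j = ord0) ?(hx i I) //; exact: ord1.
  apply: fin_bigcap_measurable => // i _.
  by apply: measurable_floor_eq; exact: measurable_funM.
move=> x _.
have cv0 : (K * n%:R * k.+1%:R^-1) @[k --> \oo] --> (0 : R).
  by rewrite -[X in _ --> X](mulr0 (K * n%:R)); apply: cvgMr; exact: cvg_harmonic.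
apply/cvgrPdist_le => e e0; near=> k.
rewrite distrC; apply: le_trans (hK _ _) _.
have K0 : \sum_i `|r k (idx k x) i ord0 - V x i ord0| <= n%:R * k.+1%:R^-1.
  apply: le_trans (_ : \sum_(i < n) k.+1%:R^-1 <= _).
    by apply: ler_sum => i _; rewrite !mxE; exact: floor_approx.
  by rewrite sumr_const card_ord mulr_natl.
have [K_ge0|K_lt0] := leP 0 K.
  apply: le_trans (ler_wpM2l K_ge0 K0) _; rewrite mulrA.
  near: k; have /cvgrPdist_le/(_ e e0) := cv0.
  by apply: filterS => k; rewrite sub0r normrN; apply: le_trans; exact: ler_norm.
apply: (@le_trans _ _ 0); last exact: ltW.
by rewrite nmulr_rle0 // sumr_ge0.
Unshelve. all: by end_near. Qed.
End glue.

Section caratheodory.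
Context d (Om : measurableType d) (R : realType).

(** Rounding the time down to multiples of 1 / (k + 1) gives jointly measurable functions, which
    converge by continuity of the paths. Joint measurability of the coefficients along x, hence
    every use of Tonelli, rests on this. *)
Lemma measurable_caratheodory (phi : R -> Om -> R) :
  (forall s, measurable_fun setT (phi s)) -> (forall w, continuous (phi ^~ w)) ->
  measurable_fun setT (fun z : R * Om => phi z.1 z.2).
Proof.
move=> mphi cphi.
apply: (@measurable_fun_cvg _ _ _ _
  (fun k (z : R * Om) => phi ((Num.floor (k.+1%:R * z.1))%:~R / k.+1%:R) z.2)).
  move=> k; apply: (measurable_fun_glue (idx := fun z : R * Om => Num.floor (k.+1%:R * z.1))
     (psi := fun q (z : R * Om) => phi (q%:~R / k.+1%:R) z.2)).
    by move=> q; apply: measurable_floor_eq; apply: measurable_funM.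
  by move=> q; apply: measurableT_comp.
move=> [s w] _ /=.
apply: (cvg_comp _ (phi ^~ w)); last exact: cphi.
apply/cvgrPdist_le => e e0; near=> k.
rewrite distrC; apply: le_trans (floor_approx _ _) _.
near: k; have /cvgrPdist_le/(_ e e0) := @cvg_harmonic R.
by apply: filterS => k; rewrite sub0r normrN; apply: le_trans; exact: ler_norm.
Unshelve. all: by end_near. Qed.
End caratheodory.

Section Rintegral_sum.
Context d (X : measurableType d) (R : realType) (nu : {measure set X -> \bar R}).

Lemma integrable_sumR (I : Type) (r : seq I) (f : I -> X -> R) :
  (forall i, nu.-integrable setT (EFin \o f i)) ->
  nu.-integrable setT (fun x => (\sum_(i <- r) f i x)%:E).
Proof.
move=> fi; elim: r => [|i r IH].
  by under eq_fun do rewrite big_nil; exact: integrable0.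
under eq_fun do rewrite big_cons EFinD.
exact: integrableD (fi i) IH.
Qed.

Lemma Rintegral_sum (I : Type) (r : seq I) (f : I -> X -> R) :
  (forall i, nu.-integrable setT (EFin \o f i)) ->
  \int[nu]_x (\sum_(i <- r) f i x) = \sum_(i <- r) \int[nu]_x f i x.
Proof.
move=> fi; elim: r => [|i r IH].
  rewrite big_nil /Rintegral integral0_eq // => x _.
  by rewrite big_nil.
rewrite big_cons -IH -RintegralD //; last exact: integrable_sumR.
by apply: eq_Rintegral => x _; rewrite big_cons.
Qed.

Lemma integral_le_double (f g h : X -> R) :
  measurable_fun setT g -> measurable_fun setT h ->
  (forall x, 0 <= f x) -> (forall x, 0 <= g x) -> (forall x, 0 <= h x) ->
  (forall x, f x <= 2 * g x + 2 * h x) ->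
  (\int[nu]_x (f x)%:E <= 2%:E * \int[nu]_x (g x)%:E + 2%:E * \int[nu]_x (h x)%:E)%E.
Proof.
move=> mg mh f0 g0 h0 fgh.
have mg' : measurable_fun setT (EFin \o g) by apply/measurable_EFinP.
have mh' : measurable_fun setT (EFin \o h) by apply/measurable_EFinP.
have <- : (\int[nu]_x (2%:E * (g x)%:E) = 2%:E * \int[nu]_x (g x)%:E)%E.
  by apply: ge0_integralZl_EFin => // x _; rewrite lee_fin.
have <- : (\int[nu]_x (2%:E * (h x)%:E) = 2%:E * \int[nu]_x (h x)%:E)%E.
  by apply: ge0_integralZl_EFin => // x _; rewrite lee_fin.
have mg2 : measurable_fun setT (fun x => (2%:E * (g x)%:E)%E).
  by apply: emeasurable_funM.
have mh2 : measurable_fun setT (fun x => (2%:E * (h x)%:E)%E).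
  by apply: emeasurable_funM.
rewrite -ge0_integralD //; last 2 first.
- by move=> x _; rewrite -EFinM lee_fin mulr_ge0.
- by move=> x _; rewrite -EFinM lee_fin mulr_ge0.
apply: le_integral_nomeas => x _; first by rewrite lee_fin.
by rewrite -!EFinM -EFinD lee_fin.
Qed.
End Rintegral_sum.

(** * Isometry for sums over possibly overlapping intervals *)

Section isometry.
Context d (Om : measurableType d) (R : realType) (P : probability Om R).
Variable F : R -> set (set Om).
Hypothesis HF : filtration F.
Variable b : R -> Om -> R.
Hypothesis hb : scalar_bm P F b.
Local Notation mu := (@lebesgue_measure R).
Variables (I : finType) (a e : I -> R) (c : I -> Om -> R).
Hypothesis a0 : forall k, 0 <= a k.
Hypothesis ae : forall k, a k <= e k.
Hypothesis gc : forall k, gmeas (F (a k)) (c k).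
Hypothesis ic : forall k, sqint P (c k).

Let X k w := c k w * (b (e k) w - b (a k) w).
Let one k (s : R) : R := (s \in `]a k, e k])%:R.

Let sX k : sqint P (X k).
Proof. exact: (sqint_incr HF hb (a0 k) (ae k) (gc k) (ic k)). Qed.

Let one2 k l s : one k s * one l s =
  \1_(`]Num.max (a k) (a l), Num.min (e k) (e l)]%classic : set R) s.
Proof.
rewrite indicE mem_setE /one -natrM mulnb; congr (_%:R); congr nat_of_bool.
by rewrite !in_itv /= gt_max le_min; apply/idP/idP; [case/andP=> /andP[-> ->] /andP[-> ->]|
  case/andP=> /andP[-> ->] /andP[-> ->]].
Qed.

Let int_one2 k l : \int[mu]_s (one k s * one l s) = overlap (a k) (e k) (a l) (e l).
Proof.
under eq_Rintegral do rewrite one2.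
rewrite /Rintegral integral_indic //= setIT lebesgue_measure_itv/= lte_fin /overlap.
case: ifPn => [lt|]; first by rewrite /= (@max_r _ _ 0) // subr_ge0 ltW.
by rewrite -leNgt => le; rewrite /= (@max_l _ _ 0) // subr_le0.
Qed.

Let i_one2 k l : mu.-integrable setT (EFin \o (fun s => one k s * one l s)).
Proof.
have h : mu.-integrable setT
    (EFin \o \1_(`]Num.max (a k) (a l), Num.min (e k) (e l)]%classic : set R)).
  exact: integrable_indic_itv.
by apply: eq_integrable h => // s _ /=; rewrite one2.
Qed.

Let sq_sum (f : I -> R) : (\sum_k f k) ^+ 2 = \sum_k \sum_l (f k * f l).
Proof. by rewrite expr2 mulr_suml; apply: eq_bigr => k _; rewrite mulr_sumr. Qed.

Let iXX k l : P.-integrable setT (EFin \o (fun w => X k w * X l w)).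
Proof. exact: sqint_mul (sX k) (sX l). Qed.

Let icc k l : P.-integrable setT (EFin \o (fun w => c k w * c l w)).
Proof. exact: sqint_mul. Qed.

Let iQ k l := @integrable_prod _ _ _ _ _ mu P _ _ (i_one2 k l) (icc k l).

(** Both squares are expanded into double sums over pairs of intervals. The terms agree by
    [pair_isometry], since the length of the overlap is the integral of the product of the two
    indicators. *)
Lemma scalar_isometry :
  (\int[P]_w ((\sum_k c k w * (b (e k) w - b (a k) w)) ^+ 2)%:E =
   (gauss_m2 R)%:E * \int[(mu \x P)%E]_z
     ((\sum_k (z.1 \in `]a k, e k])%:R * c k z.2) ^+ 2)%:E)%E.
Proof.
have L : (\int[P]_w ((\sum_k c k w * (b (e k) w - b (a k) w)) ^+ 2)%:E =
   (\sum_k \sum_l \int[P]_w (X k w * X l w))%:E)%E.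
  under eq_integral do rewrite sq_sum.
  rewrite -[LHS]fineK; last first.
    apply: integrable_fin_num => //; apply: integrable_sumR => k.
    exact: integrable_sumR (iXX k).
  congr EFin; rewrite -/(Rintegral _ _ _) Rintegral_sum; last first.
    by move=> k; exact: integrable_sumR (iXX k).
  by apply: eq_bigr => k _; rewrite Rintegral_sum //; exact: iXX.
have Q : (\int[(mu \x P)%E]_z ((\sum_k (z.1 \in `]a k, e k])%:R * c k z.2) ^+ 2)%:E =
   (\sum_k \sum_l overlap (a k) (e k) (a l) (e l) * \int[P]_w (c k w * c l w))%:E)%E.
  have E (z : R * Om) : (\sum_k (z.1 \in `]a k, e k])%:R * c k z.2) ^+ 2 =
      \sum_k \sum_l (one k z.1 * one l z.1 * (c k z.2 * c l z.2)).
    rewrite sq_sum; apply: eq_bigr => k _; apply: eq_bigr => l _; rewrite /one; ring.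
  under eq_integral do rewrite E.
  rewrite -[LHS]fineK; last first.
    apply: integrable_fin_num => //; apply: integrable_sumR => k.
    by apply: integrable_sumR => l; exact: iQ.
  congr EFin; rewrite -/(Rintegral _ _ _) Rintegral_sum; last first.
    by move=> k; apply: integrable_sumR => l; exact: iQ.
  apply: eq_bigr => k _; rewrite Rintegral_sum; last by move=> l; exact: iQ.
  apply: eq_bigr => l _.
  by rewrite (@Rintegral_prod _ _ _ _ _ mu P _ _ (i_one2 k l) (icc k l)) int_one2.
rewrite L Q -EFinM; congr EFin; rewrite mulr_sumr; apply: eq_bigr => k _.
rewrite mulr_sumr; apply: eq_bigr => l _.
by rewrite mulrA (pair_isometry HF hb).
Qed.
End isometry.

(** * Squared Hilbert-Schmidt norms and matrix-valued measurable functions *)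

Section nsq.
Context (R : realType).

Definition nsq p q (A : 'M[R]_(p, q)) : R := \sum_i \sum_j A i j ^+ 2.

Lemma nsq_ge0 p q (A : 'M[R]_(p, q)) : 0 <= nsq A.
Proof. by apply: sumr_ge0 => i _; apply: sumr_ge0 => j _; exact: sqr_ge0. Qed.

Lemma frob_sqr p q (A : 'M[R]_(p, q)) : frob A ^+ 2 = nsq A.
Proof. by rewrite /frob sqr_sqrtr // nsq_ge0. Qed.

Lemma nsqD_le p q (A C : 'M[R]_(p, q)) : nsq (A + C) <= 2 * nsq A + 2 * nsq C.
Proof.
rewrite /nsq !mulr_sumr -big_split; apply: ler_sum => i _ /=.
rewrite !mulr_sumr -big_split; apply: ler_sum => j _ /=.
by rewrite mxE sqrD_le.
Qed.

Lemma nsqN p q (A : 'M[R]_(p, q)) : nsq (- A) = nsq A.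
Proof. by apply: eq_bigr => i _; apply: eq_bigr => j _; rewrite mxE sqrrN. Qed.

Lemma nsqZ p q (k : R) (A : 'M[R]_(p, q)) : nsq (k *: A) = k ^+ 2 * nsq A.
Proof.
rewrite /nsq mulr_sumr; apply: eq_bigr => i _; rewrite mulr_sumr.
by apply: eq_bigr => j _; rewrite mxE exprMn.
Qed.

Lemma nsq0 p q : nsq (0 : 'M[R]_(p, q)) = 0.
Proof. by rewrite -(scale0r 0) nsqZ expr0n mul0r. Qed.

Lemma sqr_sum_le m (x : 'I_m -> R) :
  (\sum_i x i) ^+ 2 <= m%:R * \sum_i x i ^+ 2.
Proof.
have -> : (\sum_i x i) ^+ 2 = \sum_i \sum_j x i * x j.
  by rewrite expr2 mulr_suml; apply: eq_bigr => i _; rewrite mulr_sumr.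
have -> : m%:R * \sum_i x i ^+ 2 = \sum_i \sum_j (x i ^+ 2 / 2 + x j ^+ 2 / 2).
  transitivity (\sum_i (x i ^+ 2 * (m%:R / 2) + (\sum_j x j ^+ 2) / 2)).
    rewrite big_split /= -mulr_suml sumr_const card_ord -[_ *+ m]mulr_natl; by field.
  apply: eq_bigr => i _.
  rewrite big_split /= sumr_const card_ord -mulr_suml -[_ *+ m]mulr_natl.
  by congr (_ + _); field.
apply: ler_sum => i _; apply: ler_sum => j _.
rewrite -subr_ge0 (_ : _ - _ = (x i - x j) ^+ 2 / 2); last by field.
by rewrite divr_ge0 // sqr_ge0.
Qed.

Lemma nsq_entry p q (A : 'M[R]_(p, q)) i j : A i j ^+ 2 <= nsq A.
Proof.
rewrite /nsq (bigD1 i) //= (bigD1 j) //= -addrA lerDl addr_ge0 //.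
  by apply: sumr_ge0 => k _; exact: sqr_ge0.
by apply: sumr_ge0 => k _; apply: sumr_ge0 => l _; exact: sqr_ge0.
Qed.

Definition mxmeas d (X : measurableType d) p q (H : X -> 'M[R]_(p, q)) :=
  forall i j, measurable_fun setT (fun x => H x i j).

Lemma measurable_nsq d (X : measurableType d) p q (H : X -> 'M[R]_(p, q)) :
  mxmeas H -> measurable_fun setT (fun x => nsq (H x)).
Proof.
move=> mH; apply: measurable_sum => i; apply: measurable_sum => j.
exact: measurable_funX.
Qed.

Lemma mxmeasB d (X : measurableType d) p q (H K : X -> 'M[R]_(p, q)) :
  mxmeas H -> mxmeas K -> mxmeas (fun x => H x - K x).
Proof.
move=> mH mK i j; under eq_fun do rewrite !mxE.
exact: measurable_funB.
Qed.

Lemma mxmeasZ d (X : measurableType d) p q (k : X -> R) (H : X -> 'M[R]_(p, q)) :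
  measurable_fun setT k -> mxmeas H -> mxmeas (fun x => k x *: H x).
Proof.
move=> mk mH i j; under eq_fun do rewrite !mxE.
exact: measurable_funM.
Qed.

Lemma mxmeas_sum d (X : measurableType d) p q (I : Type) (r : seq I)
    (H : I -> X -> 'M[R]_(p, q)) :
  (forall k, mxmeas (H k)) -> mxmeas (fun x => \sum_(k <- r) H k x).
Proof.
move=> mH i j; under eq_fun do rewrite summxE.
by apply: measurable_sum => k; exact: mH.
Qed.

Lemma integral_nsq_le d (X : measurableType d) (nu : {measure set X -> \bar R})
    p q (A C D : X -> 'M[R]_(p, q)) :
  mxmeas A -> mxmeas C -> (forall x, D x = A x + C x) ->
  (\int[nu]_x (nsq (D x))%:E <=
    2%:E * \int[nu]_x (nsq (A x))%:E + 2%:E * \int[nu]_x (nsq (C x))%:E)%E.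
Proof.
move=> mA mC DE; apply: integral_le_double => [|||||x]; do ?exact: measurable_nsq.
- by move=> x; exact: nsq_ge0.
- by move=> x; exact: nsq_ge0.
- by move=> x; exact: nsq_ge0.
- by rewrite DE nsqD_le.
Qed.
End nsq.

Section component.
Context {R : realType} {d : measure_display} {Om : measurableType d}.
Variables (P : probability Om R) (F : R -> set (set Om)) (m : nat).
Variable B : R -> Om -> 'cV[R]_m.
Hypothesis HB : brownian P F B.

(** The vector clauses are tested on the boxes equal to U in direction j and to the whole line in
    the others, whose factors in the product are 1. *)
Lemma brownian_component (j : 'I_m) : scalar_bm P F (fun t w => B t w j ord0).
Proof.
pose U' (U : set R) (l : 'I_m) := if l == j then U else setT.
have mU' U : measurable U -> forall l, measurable (U' U l).
  by move=> mU l; rewrite /U'; case: ifP.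
have E (U : set R) (x : Om -> 'cV[R]_m) :
    [set w | forall l, U' U l (x w l ord0)] = [set w | U (x w j ord0)].
  apply/seteqP; split => w /=.
    by move=> /(_ j); rewrite /U' eqxx.
  by move=> Uj l; rewrite /U'; case: eqP => [->|].
have E' (U : set R) s t : [set w | forall l, U' U l (B t w l ord0 - B s w l ord0)] =
    [set w | U (B t w j ord0 - B s w j ord0)].
  have := E U (fun w => B t w - B s w).
  under eq_set do under eq_forall do rewrite !mxE.
  by move=> ->; apply/seteqP; split => w /=; rewrite !mxE.
split.
- by move=> t t0 U mU; exact: (brownian_adapted HB t0).
- move=> s t U s0 st mU; have := brownian_gauss HB s0 st (mU' _ mU).
  rewrite E' => ->; rewrite (bigD1 j) //= {1}/U' eqxx big1 ?mule1 // => l lj.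
  by rewrite /U' (negbTE lj) probability_setT.
- move=> s t A U s0 st FA mU; have := brownian_indep HB s0 st FA (mU' _ mU).
  by rewrite E'.
Qed.
End component.

(** * Ito inequality on the half-line *)

Section ito.
Context {R : realType} {d : measure_display} {Om : measurableType d}.
Variables (P : probability Om R) (F : R -> set (set Om)).
Hypothesis HF : filtration F.
Variables (n m : nat) (B : R -> Om -> 'cV[R]_m).
Hypothesis HB : brownian P F B.
Local Notation mu := (@lebesgue_measure R).
Local Notation Q := (mu \x P)%E.

(* Unlike the simple processes of ito_integral, the intervals may overlap, so that
   the difference of two such sums is again one, and the coefficients need only
   be square integrable, as those of the Euler scheme are. *)
Record step := Step {
  step_index : finType;
  step_a : step_index -> R;
  step_e : step_index -> R;
  step_c : step_index -> Om -> 'M[R]_(n, m) }.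

Definition step_value (S : step) (z : R * Om) : 'M[R]_(n, m) :=
  \sum_(k : step_index S) (z.1 \in `]step_a k, step_e k])%:R *: step_c k z.2.

Definition step_integral (S : step) (w : Om) : 'cV[R]_n :=
  \sum_(k : step_index S) step_c k w *m (B (step_e k) w - B (step_a k) w).

Record step_ok (S : step) : Prop := StepOk {
  step_a0 : forall k : step_index S, 0 <= step_a k;
  step_ae : forall k : step_index S, step_a k <= step_e k;
  step_meas : forall (k : step_index S) i j, gmeas (F (step_a k)) (fun w => step_c k w i j);
  step_sqint : forall (k : step_index S) i j, sqint P (fun w => step_c k w i j) }.

Lemma mxmeas_B t : 0 <= t -> mxmeas (B t).
Proof.
move=> t0 i j; rewrite (ord1 j).
apply: (gmeas_measurable HF t0); exact: (bm_adapted (brownian_component HB i)).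
Qed.

Lemma mxmeas_step_value S : step_ok S -> mxmeas (step_value S).
Proof.
move=> oS i j; apply: mxmeas_sum => k; apply: mxmeasZ.
  have -> : (fun z : R * Om => (z.1 \in `]step_a k, step_e k])%:R : R) =
      (\1_`]step_a k, step_e k]%classic : R -> R) \o fst.
    by apply/funext => z /=; rewrite indicE mem_setE.
  apply: measurableT_comp => //; exact: measurable_indic.
move=> i' j'; have [mc _] := step_sqint oS k i' j'.
exact: (measurableT_comp mc).
Qed.

Lemma mxmeas_step_integral S : step_ok S -> mxmeas (step_integral S).
Proof.
move=> oS; apply: mxmeas_sum => k i j.
under eq_fun do rewrite mxE.
apply: measurable_sum => l; apply: measurable_funM.
  by have [] := step_sqint oS k i l.
apply: (mxmeasB (mxmeas_B _) (mxmeas_B _)); last exact: (step_a0 oS).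
exact: le_trans (step_a0 oS k) (step_ae oS k).
Qed.

(* The factor m is lost by bounding the sum over the components of B crudely,
   which avoids the orthogonality of distinct components. *)
Definition ito_cst : R := m%:R * gauss_m2 R.

Lemma gauss_m2_ge0 : 0 <= gauss_m2 R.
Proof.
apply: fine_ge0; apply: integral_ge0 => x _.
by rewrite lee_fin mulr_ge0 ?sqr_ge0 ?normal_pdf_ge0.
Qed.

Lemma ito_cst_ge0 : 0 <= ito_cst.
Proof. by rewrite mulr_ge0 // gauss_m2_ge0. Qed.

Lemma step_isometry S : step_ok S ->
  (\int[P]_w (nsq (step_integral S w))%:E <=
   ito_cst%:E * \int[Q]_z (nsq (step_value S z))%:E)%E.
Proof.
move=> oS.
pose X i j w : R := \sum_k step_c k w i j *
  (B (step_e k) w j ord0 - B (@step_a S k) w j ord0).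
have E i w : step_integral S w i ord0 = \sum_j X i j w.
  rewrite /step_integral summxE /X exchange_big; apply: eq_bigr => k _ /=.
  by rewrite mxE; apply: eq_bigr => j _; rewrite !mxE.
have mX i j : measurable_fun setT (X i j).
  apply: measurable_sum => k; apply: measurable_funM.
    by have [] := step_sqint oS k i j.
  apply: measurable_funB; apply: mxmeas_B; last exact: (step_a0 oS).
  exact: le_trans (step_a0 oS k) (step_ae oS k).
have mX2 i j : measurable_fun setT (fun w => (X i j w ^+ 2)%:E).
  by apply/measurable_EFinP; exact: measurable_funX.
have mV := mxmeas_step_value oS.
have mV2 i j : measurable_fun setT (fun z => (step_value S z i j ^+ 2)%:E).
  by apply/measurable_EFinP; apply: measurable_funX; exact: mV.
apply: (@le_trans _ _ (\int[P]_w (m%:R%:E * \sum_i \sum_j (X i j w ^+ 2)%:E))%E).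
  apply: le_integral_nomeas => w _; first by rewrite lee_fin nsq_ge0.
  rewrite (_ : (_ * _)%E = (m%:R * \sum_i \sum_j X i j w ^+ 2)%:E); last first.
    by rewrite EFinM -sumEFin; congr (_ * _)%E; apply: eq_bigr => i _; rewrite sumEFin.
  rewrite lee_fin /nsq mulr_sumr; apply: ler_sum => i _.
  by rewrite big_ord1 E sqr_sum_le.
rewrite ge0_integralZl_EFin //; last 2 first.
- by move=> w _; apply: sume_ge0 => i _; apply: sume_ge0 => j _; rewrite lee_fin sqr_ge0.
- by apply: emeasurable_sum => i; apply: emeasurable_sum => j; exact: mX2.
rewrite /ito_cst EFinM -muleA; apply: lee_wpmul2l; first by rewrite lee_fin.
rewrite ge0_integral_sum //; last 2 first.
- by move=> i; apply: emeasurable_sum => j; exact: mX2.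
- by move=> i w _; apply: sume_ge0 => j _; rewrite lee_fin sqr_ge0.
under [X in (_ <= _ * X)%E]eq_integral do
  (rewrite /nsq -sumEFin; under eq_bigr do rewrite -sumEFin).
rewrite ge0_integral_sum //; last 2 first.
- by move=> i; apply: emeasurable_sum => j; exact: mV2.
- by move=> i w _; apply: sume_ge0 => j _; rewrite lee_fin sqr_ge0.
rewrite ge0_sume_distrr; last first.
  by move=> i _; apply: integral_ge0 => z _; apply: sume_ge0 => j _; rewrite lee_fin sqr_ge0.
apply: lee_sum => i _.
rewrite ge0_integral_sum //; last by move=> j w _; rewrite lee_fin sqr_ge0.
rewrite ge0_integral_sum //; last 2 first.
- by move=> j; exact: mV2.
- by move=> j w _; rewrite lee_fin sqr_ge0.
rewrite ge0_sume_distrr; last first.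
  by move=> j _; apply: integral_ge0 => z _; rewrite lee_fin sqr_ge0.
apply: lee_sum => j _.
rewrite (scalar_isometry HF (brownian_component HB j) (step_a0 oS) (step_ae oS)
  (fun k => step_meas oS k i j) (fun k => step_sqint oS k i j)).
rewrite le_eqVlt; apply/orP; left; apply/eqP; congr (_ * _)%E.
apply: eq_integral => z _; rewrite /step_value summxE; congr (_ ^+ 2)%:E.
by apply: eq_bigr => k _; rewrite mxE.
Qed.

(* I is a version of the Ito integral of H over the whole half-line: an integral
   over [0, t] is the case where H vanishes off ]0, t]. *)
Record ito_approx (H : R * Om -> 'M[R]_(n, m)) (I : Om -> 'cV[R]_n) : Prop :=
  ItoApprox {
  approx_mH : mxmeas H;
  approx_mI : mxmeas I;
  approx_step : exists S : nat -> step,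
    [/\ forall k, step_ok (S k),
        (\int[Q]_z (nsq (H z - step_value (S k) z))%:E)%E @[k --> \oo] --> 0%E &
        (\int[P]_w (nsq (I w - step_integral (S k) w))%:E)%E @[k --> \oo] --> 0%E] }.

Lemma ito_approx_step S : step_ok S -> ito_approx (step_value S) (step_integral S).
Proof.
move=> oS; split; [exact: mxmeas_step_value|exact: mxmeas_step_integral|].
exists (fun=> S); split => //.
  rewrite (_ : (fun=> _) = cst 0%E); first exact: cvg_cst.
  by apply/funext => k; apply: integral0_eq => z _; rewrite subrr nsq0.
rewrite (_ : (fun=> _) = cst 0%E); first exact: cvg_cst.
by apply/funext => k; apply: integral0_eq => z _; rewrite subrr nsq0.
Qed.

Definition step_sub (S1 S2 : step) : step := @Step
  (step_index S1 + step_index S2)%type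
  (fun k => match k with inl k => step_a k | inr k => step_a k end)
  (fun k => match k with inl k => step_e k | inr k => step_e k end)
  (fun k w => match k with inl k => step_c k w | inr k => - step_c k w end).

Lemma step_sub_ok S1 S2 : step_ok S1 -> step_ok S2 -> step_ok (step_sub S1 S2).
Proof.
move=> o1 o2; split.
- by case=> k /=; [exact: (step_a0 o1)|exact: (step_a0 o2)].
- by case=> k /=; [exact: (step_ae o1)|exact: (step_ae o2)].
- case=> k i j /=; first exact: (step_meas o1).
  have sF := filtration_sigma HF (step_a0 o2 k).
  have g0 : gmeas (F (step_a k)) (fun=> 0 : R).
    by apply/(gmeasP sF); exact: measurable_cst.
  have := gmeasB sF g0 (step_meas o2 k i j).
  by under eq_fun do rewrite sub0r; under [X in _ -> gmeas _ X]eq_fun do rewrite mxE.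
- case=> k i j /=; first exact: (step_sqint o1).
  have := sqintZ (-1) (step_sqint o2 k i j).
  by under eq_fun do rewrite mulN1r; under [X in _ -> sqint _ X]eq_fun do rewrite mxE.
Qed.

Lemma step_sub_value S1 S2 z :
  step_value (step_sub S1 S2) z = step_value S1 z - step_value S2 z.
Proof.
rewrite /step_value big_sumType /=; congr (_ + _).
by rewrite -sumrN; apply: eq_bigr => k _; rewrite scalerN.
Qed.

Lemma step_sub_integral S1 S2 w :
  step_integral (step_sub S1 S2) w = step_integral S1 w - step_integral S2 w.
Proof.
rewrite /step_integral big_sumType /=; congr (_ + _).
by rewrite -sumrN; apply: eq_bigr => k _; rewrite mulNmx.
Qed.

Lemma cvge0_double (u v w : nat -> \bar R) :
  (forall k, (0 <= w k)%E) ->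
  (forall k, (w k <= 2%:E * u k + 2%:E * v k)%E) ->
  u @ \oo --> 0%E -> v @ \oo --> 0%E -> w @ \oo --> 0%E.
Proof.
move=> w0 wuv u0 v0.
have uv0 : (2%:E * u k + 2%:E * v k)%E @[k --> \oo] --> 0%E.
  rewrite -[X in _ --> X](adde0 0%E); apply: cvgeD => //.
    by rewrite -[X in _ --> X](mule0 2%:E); apply: cvgeMl.
  by rewrite -[X in _ --> X](mule0 2%:E); apply: cvgeMl.
apply: (squeeze_cvge _ (cvg_cst 0%E) uv0).
by apply: nearW => k; rewrite w0 wuv.
Qed.

(** Allows integrals with different horizons or kernels to be subtracted before [ito_inequality] is
    applied, as for x(t) - x(t') and for x minus the scheme. *)
Lemma ito_approxB H1 I1 H2 I2 : ito_approx H1 I1 -> ito_approx H2 I2 ->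
  ito_approx (fun z => H1 z - H2 z) (fun w => I1 w - I2 w).
Proof.
move=> [mH1 mI1 [S1 [ok1 cH1 cI1]]] [mH2 mI2 [S2 [ok2 cH2 cI2]]].
split; [exact: mxmeasB|exact: mxmeasB|].
exists (fun k => step_sub (S1 k) (S2 k)); split.
- by move=> k; exact: step_sub_ok.
- apply: (cvge0_double _ _ cH1 cH2) => k.
    by apply: integral_ge0 => z _; rewrite lee_fin nsq_ge0.
  have -> : (\int[Q]_z (nsq (H2 z - step_value (S2 k) z))%:E =
      \int[Q]_z (nsq (- (H2 z - step_value (S2 k) z)))%:E)%E.
    by apply: eq_integral => z _; rewrite nsqN.
  apply: integral_nsq_le.
  - by apply: mxmeasB => //; exact: mxmeas_step_value.
  - move=> i j; under eq_fun do rewrite mxE.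
    by apply: measurable_funN; apply: mxmeasB => //; exact: mxmeas_step_value.
  - by move=> z; rewrite step_sub_value; apply/matrixP => i j; rewrite !mxE; ring.
- apply: (cvge0_double _ _ cI1 cI2) => k.
    by apply: integral_ge0 => z _; rewrite lee_fin nsq_ge0.
  have -> : (\int[P]_z (nsq (I2 z - step_integral (S2 k) z))%:E =
      \int[P]_z (nsq (- (I2 z - step_integral (S2 k) z)))%:E)%E.
    by apply: eq_integral => z _; rewrite nsqN.
  apply: integral_nsq_le.
  - by apply: mxmeasB => //; exact: mxmeas_step_integral.
  - move=> i j; under eq_fun do rewrite mxE.
    by apply: measurable_funN; apply: mxmeasB => //; exact: mxmeas_step_integral.
  - by move=> z; rewrite step_sub_integral; apply/matrixP => i j; rewrite !mxE; ring.
Qed.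

(** The factor 4 is the cost of two splittings with |a + b|^2 <= 2 |a|^2 + 2 |b|^2, one to pass from
    I to the approximating step integral and one to return from the step process to H. Both
    approximation errors vanish in the limit. *)
Lemma ito_inequality H I : ito_approx H I ->
  (\int[P]_w (nsq (I w))%:E <=
   (4 * ito_cst)%:E * \int[Q]_z (nsq (H z))%:E)%E.
Proof.
move=> [mH mI [S [okS cH cI]]].
have c0 := ito_cst_ge0.
pose J k := (\int[P]_w (nsq (I w - step_integral (S k) w))%:E)%E.
pose V k := (\int[Q]_z (nsq (H z - step_value (S k) z))%:E)%E.
set G := (\int[Q]_z (nsq (H z))%:E)%E.
have G0 : (0 <= G)%E by apply: integral_ge0 => z _; rewrite lee_fin nsq_ge0.
have V0 k : (0 <= V k)%E by apply: integral_ge0 => z _; rewrite lee_fin nsq_ge0.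
have bnd k : (\int[P]_w (nsq (I w))%:E <=
    2%:E * J k + ((4 * ito_cst)%:E * V k + (4 * ito_cst)%:E * G))%E.
  apply: (@le_trans _ _ (2%:E * J k + 2%:E * \int[P]_w (nsq (step_integral (S k) w))%:E)%E).
    apply: integral_nsq_le.
    - by apply: mxmeasB => //; exact: mxmeas_step_integral.
    - exact: mxmeas_step_integral.
    - by move=> w; rewrite subrK.
  rewrite leeD2l //.
  apply: (@le_trans _ _ (2%:E * (ito_cst%:E * (2%:E * V k + 2%:E * G)))%E); last first.
    rewrite -(ge0_muleDr (4 * ito_cst)%:E (V0 k) G0) -(ge0_muleDr 2%:E (V0 k) G0) !muleA -!EFinM.
    by rewrite (_ : 2 * ito_cst * 2 = 4 * ito_cst) //; ring.
  rewrite lee_wpmul2l // ?lee_fin //.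
  apply: le_trans (step_isometry (okS k)) _.
  rewrite lee_wpmul2l // ?lee_fin //.
  rewrite /V; have -> : (\int[Q]_z (nsq (H z - step_value (S k) z))%:E =
      \int[Q]_z (nsq (- (H z - step_value (S k) z)))%:E)%E.
    by apply: eq_integral => z _; rewrite nsqN.
  apply: integral_nsq_le => //.
  - move=> i j; under eq_fun do rewrite mxE.
    by apply: measurable_funN; apply: mxmeasB => //; exact: mxmeas_step_value.
  - by move=> z; apply/matrixP => i j; rewrite !mxE; ring.
(* The limit of the sum below is taken with a finite constant term; an infinite bound is trivial. *)
have [->|Coo] := eqVneq ((4 * ito_cst)%:E * G)%E +oo%E; first by rewrite leey.
have C0 : (0 <= (4 * ito_cst)%:E * G)%E by rewrite mule_ge0 // lee_fin mulr_ge0.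
have Cfin : ((4 * ito_cst)%:E * G)%E \is a fin_num.
  by rewrite ge0_fin_numE // lt_neqAle Coo leey.
have cv : (2%:E * J k + ((4 * ito_cst)%:E * V k + (4 * ito_cst)%:E * G))%E @[k --> \oo] -->
    ((4 * ito_cst)%:E * G)%E.
  rewrite -[X in _ --> X]add0e; apply: cvgeD.
  - by rewrite fin_num_adde_defl.
  - by rewrite -[X in _ --> X](mule0 2%:E); apply: cvgeMl.
  rewrite -[X in _ --> X]add0e; apply: cvgeD; last exact: cvg_cst.
  - by rewrite fin_num_adde_defl.
  - by rewrite -[X in _ --> X](mule0 (4 * ito_cst)%:E); apply: cvgeMl.
rewrite -(cvg_lim _ cv) //; apply: lime_ge; last by apply: nearW => k; exact: bnd.
by apply/cvg_ex; eexists; exact: cv.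
Qed.
End ito.

(** * From the Ito integral over [0, t] to the half-line *)

Section ito_simple.
Context {R : realType} {d : measure_display} {Om : measurableType d}.
Variables (P : probability Om R) (F : R -> set (set Om)).
Hypothesis HF : filtration F.
Variables (n m : nat) (B : R -> Om -> 'cV[R]_m).
Hypothesis HB : brownian P F B.
Local Notation mu := (@lebesgue_measure R).
Local Notation Q := (mu \x P)%E.

Lemma tonelli_path (h : R * Om -> R) : measurable_fun setT h -> (forall z, 0 <= h z) ->
  (\int[Q]_z (h z)%:E = \int[P]_w \int[mu]_s (h (s, w))%:E)%E.
Proof.
move=> mh h0; rewrite fubini_tonelli2 //; exact/measurable_EFinP.
Qed.

Lemma tonelli_time (h : R * Om -> R) : measurable_fun setT h -> (forall z, 0 <= h z) ->
  (\int[Q]_z (h z)%:E = \int[mu]_s \int[P]_w (h (s, w))%:E)%E.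
Proof.
move=> mh h0; rewrite fubini_tonelli1 //; exact/measurable_EFinP.
Qed.

Definition step_of_simple (S : @simple_process R d Om n m) : step n m := @Step R d Om n m
  'I_(steps S) (fun k => grid S k) (fun k => grid S k.+1) (fun k => coef S k).

Lemma sqint_bounded (X : Om -> R) (M : R) : measurable_fun setT X ->
  (forall w, X w ^+ 2 <= M) -> sqint P X.
Proof.
move=> mX XM; split => //.
have /integrableP[_] := finite_measure_integrable_cst P M measurableT.
apply: le_lt_trans; apply: le_integral_nomeas => w _; first by rewrite lee_fin sqr_ge0.
by rewrite lee_fin (le_trans (XM w)) // ler_norm.
Qed.

Lemma step_of_simple_ok t (S : @simple_process R d Om n m) : simple_adapted F t S -> step_ok P F (step_of_simple S).
Proof.
move=> [gS mS cS [M bS]]; split => /= k.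
- by have /andP[] := gS k (ltnW (ltn_ord k)).
- exact: mS.
- by move=> i j U mU; exact: (cS k (ltn_ord k)).
- move=> i j; apply: (@sqint_bounded _ (M ^+ 2)).
    have /andP[g0 _] := gS k (ltnW (ltn_ord k)).
    apply: (gmeas_measurable HF g0) => U mU; exact: (cS k (ltn_ord k)).
  move=> w; apply: le_trans (nsq_entry _ i j) _; rewrite -frob_sqr.
  by rewrite lerXn2r ?nnegrE ?sqrtr_ge0 ?(le_trans _ (bS k w (ltn_ord k))) ?sqrtr_ge0 // bS.
Qed.

(** The grid of each simple process lies in [0, t] and its intervals are open on the left, so it
    vanishes off ]0, t] just as [H'] does. The errors over [0, t] and over the half-line then
    coincide, by Tonelli. *)
Lemma ito_approx_integral t (H : R -> Om -> 'M[R]_(n, m)) (H' : R * Om -> 'M[R]_(n, m))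
    (I : Om -> 'cV[R]_n) :
  mxmeas H' -> (forall s w, H' (s, w) = (0 < s <= t)%R%:R *: H s w) ->
  ito_integral P F B t H I -> ito_approx P F B H' I.
Proof.
move=> mH' HH' [_ _ mI [S [aS cH cI]]].
have okS k := step_of_simple_ok (aS k).
split => //.
  move=> i j _ U mU; rewrite setTI; exact: mI.
exists (fun k => step_of_simple (S k)); split => //.
  rewrite (_ : (fun k => _) = (fun k => (\int[P]_w \int[lebesgue_measure]_(s in `[0%R, t])
             (frob (H s w - simple_value (S k) s w)%R ^+ 2)%:E)%E)) //.
  apply/funext => k.
  have mD : mxmeas (fun z => H' z - step_value (step_of_simple (S k)) z).
    by apply: mxmeasB => //; exact: mxmeas_step_value (okS k).
  have mN := measurable_nsq mD.
  have mNE : measurable_fun setT (fun z => (nsq (H' z - step_value (step_of_simple (S k)) z))%:E).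
    by apply/measurable_EFinP.
  apply: (etrans (tonelli_path mN (fun z => nsq_ge0 _))).
  apply: eq_integral => w _.
  have E s : (0 < s <= t)%R -> nsq (H' (s, w) - step_value (step_of_simple (S k)) (s, w)) =
      frob (H s w - simple_value (S k) s w) ^+ 2.
    by move=> st; rewrite frob_sqr HH' st scale1r.
  have msec : measurable_fun setT (fun s : R => (nsq (H' (s, w) - step_value (step_of_simple (S k)) (s, w)))%:E).
    exact: (measurableT_comp mNE).
  rewrite -integral_itv_obnd_cbnd; last first.
    apply: (eq_measurable_fun (fun s : R => (nsq (H' (s, w) - step_value (step_of_simple (S k)) (s, w)))%:E)).
      by move=> s; rewrite inE /= in_itv /= => /E ->.
    exact: measurable_funTS.
  rewrite [RHS]integral_mkcond; apply: eq_integral => s _; rewrite patchE mem_setE in_itv /=.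
  case: ifPn => [st|nst]; first by rewrite E.
  rewrite HH' (negbTE nst) scale0r sub0r nsqN (_ : step_value _ _ = 0) ?nsq0 //.
  rewrite /step_value big1 // => l _ /=; rewrite in_itv /=.
  case: andP => [[sl su]|_]; last by rewrite scale0r.
  exfalso; move/negP: nst; apply.
  have /andP[g0 _] := simple_grid (aS k) (ltnW (ltn_ord l)).
  have /andP[_ gt] := simple_grid (aS k) (ltn_ord l).
  by rewrite (le_lt_trans g0 sl) (le_trans su gt).
rewrite (_ : (fun k => _) = (fun k => ('E_P[fun w => (frob (I w - simple_integral B (S k) w) ^+ 2)%R])%E)) //.
apply/funext => k; rewrite unlock; apply: eq_integral => w _.
by rewrite frob_sqr.
Qed.
End ito_simple.

(** * Cauchy-Schwarz inequality for the drift *)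

Section cauchy_schwarz.
Variable R : realType.
Local Notation mu := (@lebesgue_measure R).

Let complete_square (T S I c : R) : c * T = I ->
  0 <= T * (S + (- (2 * c) * I + c ^+ 2 * T)) -> I ^+ 2 <= T * S.
Proof. by move=> <- h; rewrite -subr_ge0; move: h; congr (0 <= _); ring. Qed.

(** The square of f minus its mean c on ]0, T] has nonnegative integral; expanding it and
    multiplying by T gives the claim. *)
Lemma Rintegral_sqr_le (T : R) (f : R -> R) : 0 <= T ->
  mu.-integrable setT (EFin \o f) -> (forall s, ~~ (0 < s <= T) -> f s = 0) ->
  (((\int[mu]_s f s) ^+ 2)%:E <= T%:E * \int[mu]_s (f s ^+ 2)%:E)%E.
Proof.
move=> T0 fi f0.
have mf : measurable_fun setT f by apply/measurable_EFinP; exact: measurable_int fi.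
move: T0; rewrite le_eqVlt => /predU1P[T0|T0].
  rewrite /Rintegral integral0_eq ?expr0n /= -?T0 ?mul0e // => s _.
  by rewrite f0 // -T0; apply/negP => /andP[/lt_le_trans h /h]; rewrite ltxx.
have [->|fin] := eqVneq (\int[mu]_s (f s ^+ 2)%:E)%E +oo%E.
  by rewrite gt0_muley ?leey.
have f2ge0 : (0 <= \int[mu]_s (f s ^+ 2)%:E)%E.
  by apply: integral_ge0 => s _; rewrite lee_fin sqr_ge0.
have sf : sqint mu f by split => //; rewrite lt_neqAle fin leey.
have f2i : mu.-integrable setT (EFin \o (fun s => f s ^+ 2)) by exact: sqint_sqr.
pose one : R -> R := \1_(`]0, T]%classic).
have onei : mu.-integrable setT (EFin \o one) by exact: integrable_indic_itv.
have oneT : \int[mu]_s one s = T.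
  rewrite /Rintegral integral_indic //= setIT lebesgue_measure_itv /= lte_fin T0.
  by rewrite oppr0 adde0.
set I := \int[mu]_s f s; pose c := I / T.
have E s : (f s - c * one s) ^+ 2 = f s ^+ 2 + ((- (2 * c)) * f s + c ^+ 2 * one s).
  rewrite /one indicE mem_setE in_itv /=; case: (boolP (0 < s <= T)) => h; first by rewrite /=; ring.
  by rewrite (f0 _ h) /=; ring.
have iZ k (h : R -> R) : mu.-integrable setT (EFin \o h) ->
    mu.-integrable setT (EFin \o (fun s => k * h s)).
  by move=> hi; apply: eq_integrable (integrableZl measurableT k hi).
have i1 := iZ (- (2 * c)) _ fi.
have i2 := iZ (c ^+ 2) _ onei.
have i3 : mu.-integrable setT (EFin \o (fun s => (- (2 * c)) * f s + c ^+ 2 * one s)).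
  by apply: eq_integrable (integrableD measurableT i1 i2).
have pos : 0 <= \int[mu]_s (f s ^+ 2 + ((- (2 * c)) * f s + c ^+ 2 * one s)).
  by apply: Rintegral_ge0 => s _; rewrite -E sqr_ge0.
rewrite RintegralD // RintegralD // !RintegralZl // oneT -/I in pos.
have fE : (\int[mu]_s (f s ^+ 2)%:E)%E = (\int[mu]_s (f s ^+ 2))%:E.
  by rewrite /Rintegral fineK // ge0_fin_numE // lt_neqAle fin leey.
rewrite fE -EFinM lee_fin.
have cE : c * T = I by rewrite /c divfK // gt_eqF.
by apply: (complete_square cE); rewrite mulr_ge0 // ltW.
Qed.
End cauchy_schwarz.

(** * Mean square estimate for a drift plus an Ito integral *)

Section key_estimate.
Context {R : realType} {d : measure_display} {Om : measurableType d}.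
Variables (P : probability Om R) (F : R -> set (set Om)).
Hypothesis HF : filtration F.
Variables (n m : nat) (B : R -> Om -> 'cV[R]_m).
Hypothesis HB : brownian P F B.
Local Notation mu := (@lebesgue_measure R).
Local Notation Q := (mu \x P)%E.

(** The integral runs over the whole line, the integrands carrying their own cut-off, so that drifts
    with different horizons can be subtracted. *)
Definition path_integral (D : R * Om -> 'cV[R]_n) (w : Om) : 'cV[R]_n :=
  \col_i \int[mu]_s (D (s, w) i ord0).

Lemma path_integral_nsq_le (T : R) (D : R * Om -> 'cV[R]_n) w : 0 <= T ->
  mxmeas D ->
  (forall i, mu.-integrable setT (fun s => (D (s, w) i ord0)%:E)) ->
  (forall s, ~~ (0 < s <= T) -> D (s, w) = 0) ->
  ((nsq (path_integral D w))%:E <= T%:E * \int[mu]_s (nsq (D (s, w)))%:E)%E.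
Proof.
move=> T0 mD iD D0.
have nE (A : 'cV[R]_n) : nsq A = \sum_i A i ord0 ^+ 2.
  by apply: eq_bigr => i _; rewrite big_ord1.
rewrite nE -sumEFin; under [X in (_ <= _ * X)%E]eq_integral do rewrite nE -sumEFin.
have mDi i : measurable_fun setT (fun s => (D (s, w) i ord0 ^+ 2)%:E).
  apply/measurable_EFinP; apply: measurable_funX.
  exact: (measurableT_comp (mD i ord0)).
rewrite ge0_integral_sum //; last by move=> i s _; rewrite lee_fin sqr_ge0.
rewrite ge0_sume_distrr; last first.
  by move=> i _; apply: integral_ge0 => s _; rewrite lee_fin sqr_ge0.
apply: lee_sum => i _; rewrite mxE; apply: Rintegral_sqr_le => //; first exact: iD.
by move=> s /D0 ->; rewrite mxE.
Qed.

Lemma key_estimate (T gam : R) (D : R * Om -> 'cV[R]_n) (G : R * Om -> 'M[R]_(n, m))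
    (I Z : Om -> 'cV[R]_n) : 0 <= T ->
  mxmeas D ->
  (forall w i, mu.-integrable setT (fun s => (D (s, w) i ord0)%:E)) ->
  (forall s w, ~~ (0 < s <= T) -> D (s, w) = 0) ->
  ito_approx P F B G I -> mxmeas Z ->
  {ae P, forall w, Z w = gam *: path_integral D w + gam *: I w} ->
  (\int[P]_w (nsq (Z w))%:E <=
    (2 * gam ^+ 2)%:E * (T%:E * \int[Q]_z (nsq (D z))%:E +
      (4 * @ito_cst R m)%:E * \int[Q]_z (nsq (G z))%:E))%E.
Proof.
move=> T0 mD iD D0 aG mZ ZE.
have [_ mI _] := aG.
have g0 : 0 <= 2 * gam ^+ 2 by rewrite mulr_ge0 // sqr_ge0.
have mN := measurable_nsq mD.
pose Phi w := (\int[mu]_s (nsq (D (s, w)))%:E)%E.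
have Phi0 w : (0 <= Phi w)%E by apply: integral_ge0 => s _; rewrite lee_fin nsq_ge0.
have mPhi : measurable_fun setT Phi.
  apply: (measurable_fun_fubini_tonelli_G (m1 := mu) (fun z => (nsq (D z))%:E)).
    exact/measurable_EFinP.
  by move=> z; rewrite lee_fin nsq_ge0.
have mI2 : measurable_fun setT (fun w => (nsq (I w))%:E).
  by apply/measurable_EFinP; exact: measurable_nsq.
have mTP : measurable_fun setT (fun w => (T%:E * Phi w)%E) by exact: emeasurable_funM.
have TP0 w : (0 <= T%:E * Phi w)%E by rewrite mule_ge0 // lee_fin.
apply: (@le_trans _ _ (\int[P]_w ((2 * gam ^+ 2)%:E * (T%:E * Phi w + (nsq (I w))%:E)))%E).
  apply: ae_ge0_le_integral => //.
  - by move=> w _; rewrite lee_fin nsq_ge0.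
  - by apply/measurable_EFinP; exact: measurable_nsq.
  - by move=> w _; rewrite mule_ge0 ?lee_fin // adde_ge0 // lee_fin nsq_ge0.
  - apply: emeasurable_funM => //; exact: emeasurable_funD.
  apply: filterS ZE => w -> _.
  have h := path_integral_nsq_le T0 mD (iD w) (D0 ^~ w).
  rewrite -scalerDr nsqZ.
  apply: (@le_trans _ _ (((2 * gam ^+ 2)%:E * ((nsq (path_integral D w))%:E + (nsq (I w))%:E)))%E).
    rewrite -EFinD -EFinM lee_fin mulrC [2 * _]mulrC -mulrA mulrC ler_wpM2l ?sqr_ge0 //.
    by rewrite mulrDr nsqD_le.
  by rewrite lee_wpmul2l ?lee_fin // leeD2r.
rewrite ge0_integralZl_EFin //; last 2 first.
- by move=> w _; rewrite adde_ge0 // lee_fin nsq_ge0.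
- exact: emeasurable_funD.
rewrite lee_wpmul2l ?lee_fin // ge0_integralD //; last by move=> w _; rewrite lee_fin nsq_ge0.
apply: leeD; last exact: (ito_inequality HF HB aG).
rewrite ge0_integralZl_EFin //.
by rewrite -(tonelli_path P mN) // => z; exact: nsq_ge0.
Qed.

(** The bound is asked for s < t only: at the null point s = t the kernel takes the default value of
    [powR] at 0, and comparisons between kernels break down there. *)
Lemma tonelli_bound p (H : R * Om -> 'M[R]_(n, p)) (t : R) (bound : R -> R) :
  mxmeas H -> (forall s w, ~~ (0 < s <= t) -> H (s, w) = 0) ->
  (forall s, 0 <= bound s) ->
  (forall s, 0 < s < t -> (\int[P]_w (nsq (H (s, w)))%:E <= (bound s)%:E)%E) ->
  (\int[Q]_z (nsq (H z))%:E <= \int[mu]_(s in `]0%R, t]) (bound s)%:E)%E.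
Proof.
move=> mH H0 b0 Hb; have mN := measurable_nsq mH.
rewrite (tonelli_time P mN) => [|z]; last exact: nsq_ge0.
pose h s := (\int[P]_w (nsq (H (s, w)))%:E)%E.
have h0 s : (0 <= h s)%E by apply: integral_ge0 => w _; rewrite lee_fin nsq_ge0.
have mh : measurable_fun setT h.
  apply: (measurable_fun_fubini_tonelli_F (m2 := P) (fun z => (nsq (H z))%:E)).
    exact/measurable_EFinP.
  by move=> z; rewrite lee_fin nsq_ge0.
have -> : (\int[mu]_s h s = \int[mu]_(s in `]0%R, t]) h s)%E.
  rewrite [RHS]integral_mkcond; apply: eq_integral => s _; rewrite patchE mem_setE in_itv /=.
  case: ifPn => // ns; apply: integral0_eq => w _.
  by rewrite H0 // nsq0.
rewrite -integral_itv_bndo_bndc; last exact: measurable_funTS.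
rewrite integral_mkcond [leRHS]integral_mkcond; apply: le_integral_nomeas => s _.
  by rewrite patchE; case: ifP.
rewrite !patchE !mem_setE !in_itv /=; case: ifPn => [/andP[s0 st]|_].
  by rewrite s0 (ltW st) /=; apply: Hb; rewrite s0.
by case: ifP => // _; rewrite lee_fin.
Qed.
End key_estimate.

(** * L^2 continuity of the Volterra kernel in its horizon *)

Section volterra_kernel.
Variable R : realType.
Local Notation mu := (@lebesgue_measure R).
Variable alpha : R.
Hypothesis alpha_itv : 2^-1 < alpha < 1.

(** The cut-off is part of the kernel, so that kernels of different horizons are functions on the
    same line. *)
Definition kap (t s : R) : R := (0 < s <= t)%R%:R * (t - s) `^ (alpha - 1).

Lemma alpha_gt0 : 0 < alpha. Proof. by have /andP[] := alpha_itv; lra. Qed.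
Lemma beta_gt0 : 0 < 2 * alpha - 1. Proof. by have /andP[] := alpha_itv; lra. Qed.

Lemma kap_ge0 t s : 0 <= kap t s.
Proof. by rewrite mulr_ge0 ?powR_ge0 // ler0n. Qed.

Lemma kapE t s : 0 < s <= t -> kap t s = (t - s) `^ (alpha - 1).
Proof. by rewrite /kap => ->; rewrite mul1r. Qed.

Lemma kap0 t s : ~~ (0 < s <= t) -> kap t s = 0.
Proof. by rewrite /kap => /negbTE ->; rewrite mul0r. Qed.

Lemma powR_sqr (x r : R) : (x `^ r) ^+ 2 = x `^ (2 * r).
Proof. by rewrite mulrC powRrM -powR_mulrn ?powR_ge0. Qed.

Lemma kap_sqr t s : 0 < s <= t -> kap t s ^+ 2 = (t - s) `^ (2 * alpha - 1 - 1).
Proof. by move=> st; rewrite kapE // powR_sqr; congr (_ `^ _); ring. Qed.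

Lemma measurable_kap t : measurable_fun setT (kap t).
Proof.
apply: measurable_funM; last exact: measurable_kernel.
rewrite (_ : (fun s => _) = \1_(`]0, t]%classic)).
  exact: measurable_indic.
by apply/funext => s; rewrite indicE mem_setE in_itv.
Qed.

Lemma powR_decr (x y : R) : 0 < x -> x <= y -> y `^ (alpha - 1) <= x `^ (alpha - 1).
Proof.
move=> x0 xy; have /andP[_ a1] := alpha_itv; have y0 := lt_le_trans x0 xy.
rewrite -(opprK (alpha - 1)) !(powRN _ (- (alpha - 1))) lef_pV2 ?posrE ?powR_gt0 //.
by apply: ge0_ler_powR; rewrite ?nnegrE ?(ltW x0) ?(ltW y0) //; lra.
Qed.

(** Before t' one has 0 <= kap t <= kap t', hence (kap t' - kap t)^2 <= kap t'^2 - kap t^2, whose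
    integral is explicit and at most (t - t')^b / b because t'^b <= t^b. After t' only kap t
    survives, and its square integrates to (t - t')^b / b. *)
Lemma kernel_difference (t' t : R) : 0 <= t' -> t' <= t ->
  (\int[mu]_(s in `]0%R, t]) ((kap t s - kap t' s) ^+ 2)%:E <=
   (2 / (2 * alpha - 1) * (t - t') `^ (2 * alpha - 1))%:E)%E.
Proof.
move=> t'0 t't; have b0 := beta_gt0; set b := 2 * alpha - 1 in b0 *.
have a1 : alpha - 1 != 0 by have /andP[_ a1] := alpha_itv; rewrite subr_eq0 lt_eqF.
have mk : measurable_fun setT (fun s => ((kap t s - kap t' s) ^+ 2)%:E).
  apply/measurable_EFinP; apply: measurable_funX; apply: measurable_funB; exact: measurable_kap.
have mp x : measurable_fun setT (fun s : R => ((x - s) `^ (b - 1))%:E).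
  by apply/measurable_EFinP; exact: measurable_kernel.
have k0 s : (0 <= ((kap t s - kap t' s) ^+ 2)%:E :> \bar R)%E by rewrite lee_fin sqr_ge0.
have -> : `]0, t]%classic = `]0, t'[%classic `|` (`]0, t]%classic `&` `[t', t]%classic) :> set R.
  apply/seteqP; split => s /=; rewrite !in_itv /=.
    by move=> /andP[s0 st]; case: (ltP s t') => st'; [left|right]; rewrite ?s0 ?st.
  by move=> [/andP[-> /ltW/le_trans ->]|[-> _]].
rewrite ge0_integral_setU //=; last 3 first.
- exact: measurableI.
- exact: measurable_funTS.
- rewrite disj_set2E; apply/eqP; rewrite -subset0 => s [] /=.
  by rewrite !in_itv /= => /andP[_ st'] [_ /andP[/le_lt_trans/(_ st')]]; rewrite ltxx.
rewrite (_ : 2 / b = b^-1 + b^-1) ?mulrDl ?EFinD; last by field; rewrite gt_eqF.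
apply: leeD; last first.
  apply: (@le_trans _ _ (\int[mu]_(s in `[t', t]) ((t - s) `^ (b - 1))%:E)%E).
    rewrite integral_mkcond [leRHS]integral_mkcond; apply: le_integral_nomeas => s _.
      by rewrite patchE; case: ifP.
    rewrite !patchE in_setI !mem_setE !in_itv /=.
    case: (boolP (t' <= s <= t)) => [/andP[t's st]|_]; last by rewrite andbF.
    case: (boolP (0 < s <= t)) => [st0|_] /=; last by rewrite lee_fin powR_ge0.
    (* For s > t' this is the cut-off; at s = t' it holds because 0 to the nonzero power alpha - 1
       is 0. *)
    have -> : kap t' s = 0.
      have [ss|ns] := boolP (s <= t'); last by rewrite kap0 // (negbTE ns) andbF.
      have -> : s = t' by apply/eqP; rewrite eq_le ss.
      by rewrite /kap subrr powR0 ?mulr0.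
    by rewrite subr0 kap_sqr.
  by rewrite integral_kernel // subrr powR0 ?gt_eqF // subr0 mulrC.
have I1 : (\int[mu]_(s in `]0%R, t'[) ((t' - s) `^ (b - 1))%:E = (t' `^ b / b)%:E)%E.
  rewrite integral_itv_bndo_bndc; last exact: measurable_funTS.
  rewrite integral_itv_obnd_cbnd; last exact: measurable_funTS.
  by rewrite integral_kernel // subrr powR0 ?gt_eqF // !subr0.
have I2 : (\int[mu]_(s in `]0%R, t'[) ((t - s) `^ (b - 1))%:E = ((t `^ b - (t - t') `^ b) / b)%:E)%E.
  rewrite integral_itv_bndo_bndc; last exact: measurable_funTS.
  rewrite integral_itv_obnd_cbnd; last exact: measurable_funTS.
  by rewrite integral_kernel // subr0.
set J := (\int[mu]_(s in _) _)%E.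
have J0 : (0 <= J)%E by exact: integral_ge0.
(* The integral of kap t^2 stands on the left, which avoids subtracting extended reals before [J] is
   known to be finite. *)
have : (J + \int[mu]_(s in `]0%R, t'[) ((t - s) `^ (b - 1))%:E <=
    \int[mu]_(s in `]0%R, t'[) ((t' - s) `^ (b - 1))%:E)%E.
  have <- : (\int[mu]_(s in `]0%R, t'[) (((kap t s - kap t' s) ^+ 2)%:E + ((t - s) `^ (b - 1))%:E) =
      J + \int[mu]_(s in `]0%R, t'[) ((t - s) `^ (b - 1))%:E)%E.
    apply: ge0_integralD => //; first exact: measurable_funTS.
    - by move=> s _; rewrite lee_fin powR_ge0.
    - exact: (measurable_funTS (mp t)).
  apply: le_integral_nomeas => s /=; first by rewrite adde_ge0 // lee_fin powR_ge0.
  rewrite in_itv /= => /andP[s0 st']; rewrite -EFinD lee_fin.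
  have h1 : 0 < s <= t' by rewrite s0 ltW.
  have h2 : 0 < s <= t by rewrite s0 (le_trans (ltW st')).
  rewrite -(kap_sqr h1) -(kap_sqr h2).
  have : kap t s <= kap t' s.
    by rewrite !kapE //; apply: powR_decr; rewrite ?subr_gt0 // lerD2r.
  have := kap_ge0 t s; nra.
rewrite I1 I2; move: J J0 => [r||] //= r0; rewrite -?EFinD lee_fin => h.
rewrite lee_fin.
have tb : t' `^ b <= t `^ b by apply: ge0_ler_powR; rewrite ?nnegrE ?(ltW b0) // (le_trans t'0).
have : t' `^ b / b <= t `^ b / b by rewrite ler_wpM2r // invr_ge0 ltW.
rewrite mulrBl in h; rewrite mulrC; lra.
Qed.

Lemma kap_integrable t : 0 <= t -> mu.-integrable setT (EFin \o kap t).
Proof.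
move=> t0; have a0 := alpha_gt0.
apply/integrableP; split; first by apply/measurable_EFinP; exact: measurable_kap.
apply: (@le_lt_trans _ _ (\int[mu]_(s in `[0%R, t]) ((t - s) `^ (alpha - 1))%:E)%E).
  rewrite [leRHS]integral_mkcond; apply: le_integral_nomeas => s _; first exact: abse_ge0.
  rewrite patchE mem_setE in_itv /= ger0_norm ?kap_ge0 //.
  case: (boolP (0 < s <= t)) => [st|nst].
    by rewrite kapE //; have /andP[/ltW -> ->] := st.
  by rewrite kap0 //; case: ifP => _; rewrite lee_fin // powR_ge0.
by rewrite integral_kernel // ltry.
Qed.

(** At grid points these are the drift weights of the scheme, which are therefore exact integrals of
    the kernel over the cells. *)
Lemma Rintegral_kap_itv t a e : 0 <= a -> a <= e -> e <= t ->
  \int[mu]_s ((s \in `]a, e])%:R * kap t s) = ((t - a) `^ alpha - (t - e) `^ alpha) / alpha.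
Proof.
move=> a0 ae et; have al0 := alpha_gt0.
have mp x : measurable_fun setT (fun s : R => ((x - s) `^ (alpha - 1))%:E).
  by apply/measurable_EFinP; exact: measurable_kernel.
rewrite /Rintegral -[RHS]/(fine (((t - a) `^ alpha - (t - e) `^ alpha) / alpha)%:E).
rewrite -integral_kernel // -integral_itv_obnd_cbnd; last exact: measurable_funTS.
congr fine; rewrite [RHS]integral_mkcond; apply: eq_integral => s _.
rewrite patchE mem_setE; case: ifPn => [|_]; last by rewrite mul0r.
rewrite in_itv /= => /andP[as_ se]; rewrite mul1r kapE //.
by rewrite (le_lt_trans a0 as_) (le_trans se et).
Qed.

End volterra_kernel.

Section frobenius.
Context {R : realType}.

Lemma norm_entry_le_frob p q (A : 'M[R]_(p, q)) i j : `|A i j| <= frob A.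
Proof.
by rewrite -sqrtr_sqr ler_sqrt ?nsq_ge0 //; exact: nsq_entry.
Qed.

Lemma sum_sqr_le_sqr_sum (I : finType) (a : I -> R) : (forall i, 0 <= a i) ->
  \sum_i a i ^+ 2 <= (\sum_i a i) ^+ 2.
Proof.
move=> a0; rewrite [leRHS]expr2 mulr_suml; apply: ler_sum => i _.
by rewrite expr2 ler_wpM2l // (bigD1 i) //= lerDl sumr_ge0.
Qed.

Lemma frob_col_le n (u : 'cV[R]_n) : frob u <= \sum_i `|u i ord0|.
Proof.
have s0 : 0 <= \sum_i `|u i ord0| by apply: sumr_ge0.
rewrite -(ger0_norm s0) -sqrtr_sqr ler_sqrt ?sqr_ge0 //.
apply: le_trans (sum_sqr_le_sqr_sum _) => //.
by apply: ler_sum => i _; rewrite big_ord1 real_normK // num_real.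
Qed.
End frobenius.

Lemma cvg_sum (R : realType) (X : Type) (Fi : set_system X) (FF : Filter Fi)
    (I : Type) (r : seq I) (f : I -> X -> R) (l : I -> R) :
  (forall i, f i t @[t --> Fi] --> l i) ->
  (\sum_(i <- r) f i t) @[t --> Fi] --> \sum_(i <- r) l i.
Proof.
move=> fl; elim: r => [|i r IH].
  by under eq_fun do rewrite big_nil; rewrite big_nil; exact: cvg_cst.
under eq_fun do rewrite big_cons; rewrite big_cons.
exact: cvgD.
Qed.

(** * Lipschitz coefficients along a continuous path *)

Section lipschitz_map.
Context {R : realType}.
Variables (n p q : nat) (phi : R -> 'cV[R]_n -> 'M[R]_(p, q)) (K L : R).
Hypothesis K0 : 0 <= K.
Hypothesis lip : forall t1 t2 u v, 0 <= t1 -> 0 <= t2 ->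
  frob (phi t1 u - phi t2 v) <= K * (`|t1 - t2| + frob (u - v)).
Hypothesis grow : forall t, 0 <= t -> frob (phi t 0) ^+ 2 <= L.

Lemma lip_nsq t1 t2 u v : 0 <= t1 -> 0 <= t2 ->
  nsq (phi t1 u - phi t2 v) <= 2 * K ^+ 2 * ((t1 - t2) ^+ 2 + nsq (u - v)).
Proof.
move=> t10 t20; rewrite -!frob_sqr.
apply: (@le_trans _ _ ((K * (`|t1 - t2| + frob (u - v))) ^+ 2)).
  rewrite lerXn2r ?nnegrE ?sqrtr_ge0 //; last exact: lip.
  by rewrite mulr_ge0 // addr_ge0 // sqrtr_ge0.
rewrite exprMn -(real_normK (num_real (t1 - t2))) [2 * _]mulrC -[leRHS]mulrA.
by rewrite ler_wpM2l ?sqr_ge0 // mulrDr sqrD_le.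
Qed.

(** From |phi(t, u)|^2 <= 2 |phi(t, u) - phi(t, 0)|^2 + 2 |phi(t, 0)|^2, where [lip_nsq] bounds the
    first square by 2 K^2 |u|^2. *)
Definition growth_cst : R := 4 * K ^+ 2 + 2 * L.

Lemma L_ge0 : 0 <= L.
Proof. by apply: le_trans (grow (lexx 0)); rewrite sqr_ge0. Qed.

Lemma growth_cst_ge0 : 0 <= growth_cst.
Proof. by have := L_ge0; have := sqr_ge0 K; rewrite /growth_cst; lra. Qed.

Lemma lip_growth t u : 0 <= t -> nsq (phi t u) <= growth_cst * (1 + nsq u).
Proof.
move=> t0; have h1 := lip_nsq u 0 t0 t0; have h2 := grow t0.
rewrite frob_sqr in h2; rewrite subrr expr0n /= add0r subr0 in h1.
have h3 := nsqD_le (phi t u - phi t 0) (phi t 0); rewrite subrK in h3.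
apply: le_trans h3 _; rewrite /growth_cst.
have u0 := nsq_ge0 u; have Lu : 0 <= L * nsq u by rewrite mulr_ge0 // L_ge0.
have := sqr_ge0 K; nra.
Qed.

Lemma lip_entry t1 t2 u v i j : 0 <= t1 -> 0 <= t2 ->
  `|phi t1 u i j - phi t2 v i j| <= K * (`|t1 - t2| + \sum_l `|u l ord0 - v l ord0|).
Proof.
move=> t10 t20; have := norm_entry_le_frob (phi t1 u - phi t2 v) i j.
rewrite !mxE => /le_trans; apply; apply: le_trans (lip _ _ t10 t20) _.
rewrite ler_wpM2l // lerD2l; apply: le_trans (frob_col_le _) _.
by apply: ler_sum => l _; rewrite !mxE.
Qed.

Lemma lip_measurable d (X : measurableType d) (V : X -> 'cV[R]_n) t : 0 <= t ->
  mxmeas V -> mxmeas (fun x => phi t (V x)).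
Proof.
move=> t0 mV i j; apply: (@measurable_lipschitz _ _ _ _ V (fun u => phi t u i j) K).
  by move=> l; exact: mV.
move=> u v; apply: le_trans (lip_entry u v i j t0 t0) _.
by rewrite subrr normr0 add0r.
Qed.

Lemma lip_gmeas (X : pointedType) (G : set (set X)) (V : X -> 'cV[R]_n) t :
  sigma_algebra setT G -> 0 <= t ->
  (forall i, gmeas G (fun x => V x i ord0)) ->
  forall i j, gmeas G (fun x => phi t (V x) i j).
Proof.
move=> sG t0 gV i j; apply/(gmeasP sG).
apply: (@lip_measurable _ (g_sigma_algebraType G) V t t0) => k l.
by rewrite (ord1 l); exact/(gmeasP sG).
Qed.

Section path.
Context {d : measure_display} {Om : measurableType d}.
Variables (T eps : R) (x : R -> Om -> 'cV[R]_n).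
Hypothesis T0 : 0 <= T.
Hypothesis eps0 : 0 < eps.
Hypothesis mx : forall s, 0 <= s <= T -> mxmeas (x s).
Hypothesis cx : forall w, {within `[0, T], continuous (fun t => x t w)}.

(* Freezing the path outside [0, T] makes the processes below defined, continuous
   and jointly measurable for all real times. *)
Definition clamp (s : R) : R := Num.max 0 (Num.min s T).

Lemma clamp_itv s : 0 <= clamp s <= T.
Proof.
by rewrite /clamp le_max lexx /= ge_max T0 ge_min lexx orbT.
Qed.

Lemma clamp_id s : 0 <= s <= T -> clamp s = s.
Proof. by move=> /andP[s0 sT]; rewrite /clamp min_l // max_r. Qed.

Lemma clamp_lip s t : `|clamp s - clamp t| <= `|s - t|.
Proof.
have T0' := T0; wlog st : s t / s <= t => [h|].
  have [/h //|/ltW/h] := leP s t.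
  by rewrite distrC [X in _ <= X]distrC.
have cE a : [\/ a <= 0 /\ clamp a = 0, 0 <= a <= T /\ clamp a = a | T <= a /\ clamp a = T].
  have [a0|a0] := leP a 0.
    by constructor 1; rewrite /clamp min_l ?(le_trans a0) // max_l.
  have [aT|aT] := leP a T; first by constructor 2; rewrite clamp_id (ltW a0) // aT.
  by constructor 3; rewrite /clamp min_r ?(ltW aT) // max_r.
have h : 0 <= clamp t - clamp s <= t - s.
  have [[? ->]|[/andP[? ?] ->]|[? ->]] := cE s;
  have [[? ->]|[/andP[? ?] ->]|[? ->]] := cE t; apply/andP; split; lra.
have /andP[h1 h2] := h.
by rewrite distrC ger0_norm // distrC ger0_norm // subr_ge0.
Qed.

Lemma clamp_continuous : continuous clamp.
Proof.
move=> s; apply/cvgrPdist_le => e e0; near=> t.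
apply: le_trans (clamp_lip _ _) _.
near: t; have /cvgrPdist_le/(_ e e0) := @cvg_id _ (nbhs s).
by [].
Unshelve. all: by end_near. Qed.

Definition along (z : R * Om) : 'M[R]_(p, q) :=
  phi (clamp z.1 / eps) (x (clamp z.1) z.2).

Let clamp_eps s : 0 <= clamp s / eps.
Proof. by rewrite divr_ge0 ?(ltW eps0) //; have /andP[] := clamp_itv s. Qed.

Lemma clamped_entry_continuous w l : continuous (fun s => x (clamp s) w l ord0).
Proof.
move=> s.
have h : x (clamp t) w @[t --> s] --> x (clamp s) w.
  have cw : {within `[0, T], continuous (fun t => x t w)} := @cx w.
  move/subspace_continuousP in cw.
  have := cw (clamp s); rewrite /= in_itv /= => /(_ (clamp_itv s)) h.
  (* Continuity of x is known within [0, T] only. Since [clamp] takes its values there, the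
     restriction disappears after composition. *)
  apply: cvg_comp h; move=> A; rewrite /within /= => nA.
  have h2 : \forall t \near s, `[0, T]%classic (clamp t) -> A (clamp t) := clamp_continuous nA.
  change (\forall t \near s, A (clamp t)).
  apply: filterS h2 => t; apply.
  by rewrite /= in_itv /= clamp_itv.
apply: (cvg_comp _ _ h (@coord_continuous _ _ _ l ord0 _)).
Qed.

Lemma along_continuous w i j : continuous (fun s => along (s, w) i j).
Proof.
move=> s; apply/cvgrPdist_le => e e0.
pose g t := K * (`|t - s| / eps + \sum_l `|x (clamp t) w l ord0 - x (clamp s) w l ord0|).
have cg : g t @[t --> s] --> (0 : R).
  rewrite -[X in _ --> X](mulr0 K); apply: cvgMr.
  rewrite -[X in _ --> X]addr0; apply: cvgD.
    rewrite -[X in _ --> X](mul0r eps^-1); apply: cvgMl.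
    rewrite -[X in _ --> X](normr0 R); apply: cvg_norm; rewrite -[X in _ --> X](subrr s).
    by apply: cvgB; [exact: cvg_id|exact: cvg_cst].
  rewrite [X in _ --> X](_ : 0 = \sum_(l < n) (0 : R)); last by rewrite big1_eq.
  apply: cvg_sum => l; rewrite -[X in _ --> X](normr0 R); apply: cvg_norm.
  rewrite -[X in _ --> X](subrr (x (clamp s) w l ord0)); apply: cvgB; last exact: cvg_cst.
  exact: clamped_entry_continuous.
near=> t.
rewrite distrC; apply: le_trans (lip_entry _ _ _ _ (clamp_eps t) (clamp_eps s)) _.
apply: (@le_trans _ _ (g t)).
  rewrite /g ler_wpM2l // lerD2r -mulrBl normrM (gtr0_norm (_ : 0 < eps^-1)) ?invr_gt0 //.
  by rewrite ler_wpM2r ?invr_ge0 ?(ltW eps0) // clamp_lip.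
near: t; have /cvgrPdist_le/(_ e e0) := cg.
by apply: filterS => t; rewrite sub0r normrN; apply: le_trans; exact: ler_norm.
Unshelve. all: by end_near. Qed.

Lemma mxmeas_along : mxmeas along.
Proof.
move=> i j; apply: (@measurable_caratheodory _ _ _ (fun s w => along (s, w) i j)).
  by move=> s; exact: (lip_measurable (V := x (clamp s)) (clamp_eps s) (mx (clamp_itv s)) i j).
by move=> w; exact: along_continuous.
Qed.

(** A bound for each path separately, from compactness of [0, T]. It makes the drift integrand, a
    bounded function times the integrable kernel, integrable for every w. *)
Lemma along_bounded w i j : exists M, forall s, `|along (s, w) i j| <= M.
Proof.
have c : {within `[0, T], continuous (fun s => `|along (s, w) i j|)}.
  apply: continuous_subspaceT => s; apply: cvg_norm; exact: along_continuous.
have [c0 _ h] := EVT_max T0 c.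
exists `|along (c0, w) i j| => s.
have -> : along (s, w) = along (clamp s, w).
  by rewrite /along /= (clamp_id (clamp_itv s)).
by apply: h; rewrite in_itv /= clamp_itv.
Qed.
End path.
End lipschitz_map.

Lemma integral_prob_cst (R : realType) d (Om : measurableType d) (P : probability Om R) (c : R) :
  (\int[P]_w c%:E = c%:E)%E.
Proof. by have := expectation_cst P c; rewrite unlock. Qed.

(** * Moments and Hoelder continuity of the solution *)

Section solution.
Context {R : realType} {d : measure_display} {Om : measurableType d}.
Variables (P : probability Om R) (F : R -> set (set Om)).
Hypothesis HF : filtration F.
Variables (n m : nat) (B : R -> Om -> 'cV[R]_m).
Hypothesis HB : brownian P F B.
Variables (T alpha : R).
Hypothesis T_gt0 : 0 < T.
Hypothesis alpha_itv : 2^-1 < alpha < 1.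
Variable x0 : 'cV[R]_n.
Variables (f : R -> 'cV[R]_n -> 'cV[R]_n) (g : R -> 'cV[R]_n -> 'M[R]_(n, m)).
Variables (K L : R).
Hypothesis K_gt0 : 0 < K.
Hypothesis fg_lipschitz : forall (t1 t2 : R) (x1 x2 : 'cV[R]_n), 0 <= t1 -> 0 <= t2 ->
    Num.max (frob (f t1 x1 - f t2 x2)) (frob (g t1 x1 - g t2 x2))
      <= K * (`|t1 - t2| + frob (x1 - x2)).
Hypothesis fg_growth : forall t : R, 0 <= t ->
    Num.max (frob (f t 0) ^+ 2) (frob (g t 0) ^+ 2) <= L.
Local Notation mu := (@lebesgue_measure R).
Local Notation Q := (mu \x P)%E.
Local Notation beta := (2 * alpha - 1).
Local Notation gam := (Gamma alpha)^-1.

Lemma f_lip t1 t2 u v : 0 <= t1 -> 0 <= t2 ->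
  frob (f t1 u - f t2 v) <= K * (`|t1 - t2| + frob (u - v)).
Proof. by move=> h1 h2; have := fg_lipschitz u v h1 h2; rewrite ge_max => /andP[]. Qed.

Lemma g_lip t1 t2 u v : 0 <= t1 -> 0 <= t2 ->
  frob (g t1 u - g t2 v) <= K * (`|t1 - t2| + frob (u - v)).
Proof. by move=> h1 h2; have := fg_lipschitz u v h1 h2; rewrite ge_max => /andP[]. Qed.

Lemma f_grow t : 0 <= t -> frob (f t 0) ^+ 2 <= L.
Proof. by move=> h1; have := fg_growth h1; rewrite ge_max => /andP[]. Qed.

Lemma g_grow t : 0 <= t -> frob (g t 0) ^+ 2 <= L.
Proof. by move=> h1; have := fg_growth h1; rewrite ge_max => /andP[]. Qed.

Local Notation A1 := (growth_cst K L).

Definition energy_cst : R := 2 * gam ^+ 2 * (T + 4 * @ito_cst R m).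

Lemma energy_cst_ge0 : 0 <= energy_cst.
Proof.
apply: mulr_ge0; first by apply: mulr_ge0 => //; exact: sqr_ge0.
by apply: addr_ge0; [exact: ltW|apply: mulr_ge0 => //; exact: ito_cst_ge0].
Qed.

(** One bound [X] serves for drift and noise. The lemma is applied to x(t) - x0, to x(t) - x(t') and
    to x minus the scheme. *)
Lemma energy_estimate (D : R * Om -> 'cV[R]_n) (G : R * Om -> 'M[R]_(n, m))
    (I Z : Om -> 'cV[R]_n) (X : \bar R) :
  mxmeas D ->
  (forall w i, mu.-integrable setT (fun s => (D (s, w) i ord0)%:E)) ->
  (forall s w, ~~ (0 < s <= T) -> D (s, w) = 0) ->
  ito_approx P F B G I -> mxmeas Z ->
  {ae P, forall w, Z w = gam *: path_integral D w + gam *: I w} ->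
  (\int[Q]_z (nsq (D z))%:E <= X)%E -> (\int[Q]_z (nsq (G z))%:E <= X)%E ->
  (\int[P]_w (nsq (Z w))%:E <= energy_cst%:E * X)%E.
Proof.
move=> mD iD D0 aG mZ ZE DX GX.
have i0 : 0 <= 4 * @ito_cst R m by rewrite mulr_ge0 // ito_cst_ge0.
have X0 : (0 <= X)%E.
  by apply: le_trans DX; apply: integral_ge0 => z _; rewrite lee_fin nsq_ge0.
apply: le_trans (key_estimate HF HB (ltW T_gt0) mD iD D0 aG mZ ZE) _.
have -> : (energy_cst%:E * X = (2 * gam ^+ 2)%:E * (T%:E * X + (4 * @ito_cst R m)%:E * X))%E.
  rewrite /energy_cst EFinM -muleA EFinD ge0_muleDl ?lee_fin //; exact: ltW.
apply: lee_wpmul2l; first by rewrite lee_fin; apply: mulr_ge0 => //; exact: sqr_ge0.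
apply: leeD; apply: lee_wpmul2l => //; rewrite lee_fin //; exact: ltW.
Qed.

Section one_solution.
Variables (eps : R) (x : R -> Om -> 'cV[R]_n).
Hypothesis eps_gt0 : 0 < eps.
Hypothesis Hx : fsde_solution P F B T alpha eps x0 f g x.

Let K0 := ltW K_gt0.
Let T0 := ltW T_gt0.
Let cl := clamp T.
Let cl_itv s : 0 <= cl s <= T := clamp_itv T0 s.

Lemma sol_meas s : 0 <= s <= T -> mxmeas (x s).
Proof.
move=> sT i j _ U mU; rewrite setTI.
have /andP[s0 _] := sT.
apply: (filtration_measurable HF s0); exact: (solution_adapted Hx sT).
Qed.

Definition along_f := along f T eps x.
Definition along_g := along g T eps x.

Lemma mxmeas_along_f : mxmeas along_f.
Proof. exact: (mxmeas_along K0 f_lip T0 eps_gt0 sol_meas (solution_continuous Hx)). Qed.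

Lemma mxmeas_along_g : mxmeas along_g.
Proof. exact: (mxmeas_along K0 g_lip T0 eps_gt0 sol_meas (solution_continuous Hx)). Qed.

Definition sol_drift t (z : R * Om) := kap alpha t z.1 *: along_f z.
Definition sol_diff t (z : R * Om) := kap alpha t z.1 *: along_g z.

Lemma mxmeas_kap p q t (A : R * Om -> 'M[R]_(p, q)) : mxmeas A ->
  mxmeas (fun z : R * Om => kap alpha t z.1 *: A z).
Proof.
move=> mA; apply: mxmeasZ => //.
exact: (measurableT_comp (measurable_kap alpha t)).
Qed.

Lemma mxmeas_sol_drift t : mxmeas (sol_drift t).
Proof. exact: mxmeas_kap mxmeas_along_f. Qed.

Lemma mxmeas_sol_diff t : mxmeas (sol_diff t).
Proof. exact: mxmeas_kap mxmeas_along_g. Qed.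

Lemma sol_drift_integrable t w i : 0 <= t ->
  mu.-integrable setT (fun s => (sol_drift t (s, w) i ord0)%:E).
Proof.
move=> t0; have [M bM] := along_bounded K0 f_lip T0 eps_gt0 (solution_continuous Hx) w i ord0.
have h := integrableZl measurableT M (kap_integrable alpha_itv t0).
apply: (le_integrable measurableT _ _ h).
  apply/measurable_EFinP; exact: (measurableT_comp (@mxmeas_sol_drift t i ord0)).
move=> s _ /=; rewrite mxE lee_fin !normrM [leRHS]mulrC ler_wpM2l //.
by rewrite (le_trans (bM s)) // ler_norm.
Qed.

Lemma sol_drift0 t s w : ~~ (0 < s <= t) -> sol_drift t (s, w) = 0.
Proof. by move=> st; rewrite /sol_drift kap0 // scale0r. Qed.

Lemma sol_diff0 t s w : ~~ (0 < s <= t) -> sol_diff t (s, w) = 0.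
Proof. by move=> st; rewrite /sol_diff kap0 // scale0r. Qed.

(** The integral equation with the horizon moved from the domains of integration into the
    kernels. *)
Lemma solution_repr t : 0 <= t <= T ->
  exists2 I, ito_approx P F B (sol_diff t) I &
  {ae P, forall w, x t w = x0 + (gam *: path_integral (sol_drift t) w + gam *: I w)}.
Proof.
move=> /andP[t0 tT]; have tT' : 0 <= t <= T by rewrite t0.
have [I hI ae] := solution_eq Hx tT'; exists I.
  have HH s w : sol_diff t (s, w) =
      (0 < s <= t)%R%:R *: ((t - s) `^ (alpha - 1) *: g (s / eps) (x s w)).
    rewrite /sol_diff /kap /=; case: (boolP (0 < s <= t)) => st; last by rewrite mul0r !scale0r.
    rewrite mul1r scale1r /along_g /along /= clamp_id //.
    by have /andP[/ltW -> /le_trans ->] := st.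
  exact: (ito_approx_integral HF (@mxmeas_sol_diff t) HH hI).
suff pE w : vint t (fun s => (t - s) `^ (alpha - 1) *: f (s / eps) (x s w)) =
    path_integral (sol_drift t) w.
  by apply: filterS ae => w ->; rewrite pE addrA.
apply/matrixP => i j; rewrite (ord1 j) !mxE /Rintegral; congr fine.
have E s : 0 < s <= t -> sol_drift t (s, w) = (t - s) `^ (alpha - 1) *: f (s / eps) (x s w).
  move=> st; rewrite /sol_drift kapE // /along_f /along /= clamp_id //.
  by have /andP[/ltW -> /le_trans ->] := st.
have ms : measurable_fun setT (fun s => (sol_drift t (s, w) i ord0)%:E).
  by apply/measurable_EFinP; exact: (measurableT_comp (@mxmeas_sol_drift t i ord0)).
rewrite -integral_itv_obnd_cbnd; last first.
  apply: (eq_measurable_fun (fun s => (sol_drift t (s, w) i ord0)%:E)).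
    by move=> s; rewrite inE /= in_itv /= => /E ->.
  exact: measurable_funTS.
rewrite [LHS]integral_mkcond; apply: eq_integral => s _; rewrite patchE mem_setE in_itv /=.
case: ifPn => [/E ->//|st]; by rewrite sol_drift0 // mxE.
Qed.

Let m2 s := (\int[P]_w (nsq (x s w))%:E)%E.

Let m2_ge0 s : (0 <= m2 s)%E.
Proof. by apply: integral_ge0 => w _; rewrite lee_fin nsq_ge0. Qed.

(** This bound may depend on eps and x. It makes [fine] lossless and supplies the a priori bound [M]
    of the Gronwall inequality, whose conclusion does not involve it. *)
Lemma sol_moment_lty : exists2 M, 0 <= M & forall s, 0 <= s <= T -> (m2 s <= M%:E)%E.
Proof.
have := solution_L2 Hx; set S := (\int[P]_w _)%E => Slt.
have S_ge s : 0 <= s <= T -> (m2 s <= S)%E.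
  move=> sT; apply: le_integral_nomeas => w _; first by rewrite lee_fin nsq_ge0.
  by apply: ereal_sup_ubound; exists s; [rewrite /= in_itv /=|rewrite frob_sqr].
have S0 : (0 <= S)%E by apply: le_trans (S_ge 0 _); rewrite ?lexx ?T0.
exists (fine S); first exact: fine_ge0.
by move=> s /S_ge; rewrite fineK // ge0_fin_numE.
Qed.

Let v s : R := fine (m2 s).

Let vE s : 0 <= s <= T -> (v s)%:E = m2 s.
Proof.
move=> sT; have [M _ /(_ _ sT) h] := sol_moment_lty.
by rewrite fineK // ge0_fin_numE // (le_lt_trans h) // ltry.
Qed.

Let v_ge0 s : 0 <= v s. Proof. exact: fine_ge0. Qed.

(** Bounds the second moments of both coefficients along x. The same expression stands on both sides
    of [sol_moment_step], so the Gronwall inequality applies to it directly. *)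
Definition growth_bound s : R := A1 * (1 + v s).

Let A1_ge0 : 0 <= A1. Proof. exact: (growth_cst_ge0 _ f_grow). Qed.

Lemma growth_bound_ge0 s : 0 <= growth_bound s.
Proof. by rewrite mulr_ge0 // addr_ge0. Qed.

Lemma along_moment p q (phi : R -> 'cV[R]_n -> 'M[R]_(p, q)) s :
  (forall t u, 0 <= t -> nsq (phi t u) <= A1 * (1 + nsq u)) ->
  (\int[P]_w (nsq (along phi T eps x (s, w)))%:E <= (growth_bound (cl s))%:E)%E.
Proof.
move=> hphi; have mN := measurable_nsq (sol_meas (cl_itv s)).
apply: (@le_trans _ _ (\int[P]_w (A1%:E * (1 + (nsq (x (cl s) w))%:E)))%E).
  apply: le_integral_nomeas => w _; first by rewrite lee_fin nsq_ge0.
  rewrite -EFinD -EFinM lee_fin /along /=; apply: hphi.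
  by rewrite divr_ge0 ?(ltW eps_gt0) //; have /andP[] := cl_itv s.
rewrite ge0_integralZl_EFin //; last 2 first.
- by move=> w _; rewrite adde_ge0 // lee_fin nsq_ge0.
- by apply: emeasurable_funD => //; exact/measurable_EFinP.
rewrite ge0_integralD //; last 2 first.
- by move=> w _; rewrite lee_fin nsq_ge0.
- exact/measurable_EFinP.
rewrite (integral_prob_cst P 1) -/(m2 _) -vE //.
Qed.

Let f_moment s : (\int[P]_w (nsq (along_f (s, w)))%:E <= (growth_bound (cl s))%:E)%E.
Proof. by apply: along_moment => t u; exact: (lip_growth K0 f_lip f_grow). Qed.

Let g_moment s : (\int[P]_w (nsq (along_g (s, w)))%:E <= (growth_bound (cl s))%:E)%E.
Proof. by apply: along_moment => t u; exact: (lip_growth K0 g_lip g_grow). Qed.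

Lemma integral_nsqZ p q (k : R) (A : Om -> 'M[R]_(p, q)) : mxmeas A ->
  (\int[P]_w (nsq (k *: A w))%:E = (k ^+ 2)%:E * \int[P]_w (nsq (A w))%:E)%E.
Proof.
move=> mA; under eq_integral do rewrite nsqZ EFinM.
rewrite ge0_integralZl_EFin ?sqr_ge0 //.
- by move=> w _; rewrite lee_fin nsq_ge0.
- by apply/measurable_EFinP; exact: measurable_nsq.
Qed.

Lemma mxmeas_section p q (A : R * Om -> 'M[R]_(p, q)) s : mxmeas A -> mxmeas (fun w => A (s, w)).
Proof. by move=> mA i j; exact: (measurableT_comp (mA i j)). Qed.

Lemma sol_moment_step t : 0 <= t <= T ->
  ((growth_bound t)%:E <= (A1 * (1 + 2 * nsq x0))%:E +
    (2 * A1 * energy_cst)%:E *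
    \int[mu]_(s in `]0%R, t]) ((t - s) `^ (beta - 1) * growth_bound (cl s))%:E)%E.
Proof.
move=> tT; have /andP[t0 tT'] := tT.
set X := (\int[mu]_(s in `]0%R, t]) _)%E.
have X0 : (0 <= X)%E.
  by apply: integral_ge0 => s _; rewrite lee_fin mulr_ge0 ?powR_ge0 ?growth_bound_ge0.
have [I aI ae] := solution_repr tT.
have b0 s : 0 <= (t - s) `^ (beta - 1) * growth_bound (cl s).
  by rewrite mulr_ge0 ?powR_ge0 ?growth_bound_ge0.
have DX : (\int[Q]_z (nsq (sol_drift t z))%:E <= X)%E.
  apply: (tonelli_bound (@mxmeas_sol_drift t) (@sol_drift0 t) b0) => s /andP[s0 st].
  rewrite /sol_drift /= integral_nsqZ; last exact: mxmeas_section mxmeas_along_f.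
  rewrite /= kap_sqr ?s0 ?(ltW st) // EFinM lee_wpmul2l ?lee_fin ?powR_ge0 //.
have GX : (\int[Q]_z (nsq (sol_diff t z))%:E <= X)%E.
  apply: (tonelli_bound (@mxmeas_sol_diff t) (@sol_diff0 t) b0) => s /andP[s0 st].
  rewrite /sol_diff /= integral_nsqZ; last exact: mxmeas_section mxmeas_along_g.
  rewrite /= kap_sqr ?s0 ?(ltW st) // EFinM lee_wpmul2l ?lee_fin ?powR_ge0 //.
have mZ : mxmeas (fun w => x t w - x0).
  by apply: mxmeasB; [exact: sol_meas|move=> i j; exact: measurable_cst].
have aeZ : {ae P, forall w, x t w - x0 = gam *: path_integral (sol_drift t) w + gam *: I w}.
  by apply: filterS ae => w ->; rewrite addrC addKr.
have D0 s w : ~~ (0 < s <= T) -> sol_drift t (s, w) = 0.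
  move=> st; apply: sol_drift0; apply: contra st => /andP[-> /le_trans]; exact.
have := energy_estimate (@mxmeas_sol_drift t) (fun w i => sol_drift_integrable w i t0)
  D0 aI mZ aeZ DX GX.
set Z := (\int[P]_w _)%E => hZ.
have h : (m2 t <= 2%:E * (nsq x0)%:E + 2%:E * Z)%E.
  apply: (@le_trans _ _ (2%:E * \int[P]_w (nsq x0)%:E + 2%:E * Z)%E).
    by apply: integral_nsq_le => // w; rewrite addrC subrK.
  by rewrite integral_prob_cst.
rewrite /growth_bound mulrDr mulr1 EFinD EFinM vE //.
apply: (@le_trans _ _ (A1%:E + A1%:E * (2%:E * (nsq x0)%:E + 2%:E * (energy_cst%:E * X)))%E).
  rewrite leeD2l // lee_wpmul2l ?lee_fin //; apply: le_trans h _.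
  by rewrite leeD2l // lee_wpmul2l ?lee_fin.
rewrite ge0_muleDr ?mule_ge0 ?lee_fin ?nsq_ge0 ?energy_cst_ge0 // addeA !muleA -!EFinM -EFinD.
by rewrite (_ : A1 + A1 * 2 * nsq x0 = A1 * (1 + 2 * nsq x0)) 1?(_ : A1 * 2 = 2 * A1) //; ring.
Qed.

(** The increment is a single Volterra integral with kernel kap t - kap t', and [kernel_difference]
    provides the exponent beta. *)
Lemma sol_holder A2 t' t :
  (forall s, (\int[P]_w (nsq (along_f (s, w)))%:E <= A2%:E)%E) ->
  (forall s, (\int[P]_w (nsq (along_g (s, w)))%:E <= A2%:E)%E) ->
  0 <= A2 -> 0 <= t' -> t' <= t -> t <= T ->
  (\int[P]_w (nsq (x t w - x t' w))%:E <=
    (energy_cst * (A2 * (2 / beta * (t - t') `^ beta)))%:E)%E.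
Proof.
move=> fA gA A20 t'0 t't tT; have t0 := le_trans t'0 t't; have t'T := le_trans t't tT.
have tI : 0 <= t <= T by rewrite t0.
have t'I : 0 <= t' <= T by rewrite t'0.
have [I aI ae] := solution_repr tI; have [I' aI' ae'] := solution_repr t'I.
pose dk s := kap alpha t s - kap alpha t' s.
have dk0 s : ~~ (0 < s <= t) -> dk s = 0.
  move=> st; rewrite /dk !kap0 ?subrr //; apply: contra st => /andP[-> h] /=.
  exact: le_trans h t't.
have mdk : measurable_fun setT (fun z : R * Om => dk z.1).
  by apply: (measurableT_comp (f := dk)) => //; apply: measurable_funB; exact: measurable_kap.
have mD : mxmeas (fun z => dk z.1 *: along_f z) by apply: mxmeasZ => //; exact: mxmeas_along_f.
have mG : mxmeas (fun z => dk z.1 *: along_g z) by apply: mxmeasZ => //; exact: mxmeas_along_g.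
have DE z : dk z.1 *: along_f z = sol_drift t z - sol_drift t' z by rewrite scalerBl.
have GE z : dk z.1 *: along_g z = sol_diff t z - sol_diff t' z by rewrite scalerBl.
have b0 s : 0 <= dk s ^+ 2 * A2 by rewrite mulr_ge0 // sqr_ge0.
have kd : (\int[mu]_(s in `]0%R, t]) (dk s ^+ 2 * A2)%:E <=
    (A2 * (2 / beta * (t - t') `^ beta))%:E)%E.
  under eq_integral do rewrite mulrC EFinM.
  rewrite ge0_integralZl_EFin //; last 2 first.
  - by move=> s _; rewrite lee_fin sqr_ge0.
  - apply/measurable_EFinP; apply: measurable_funX; apply: measurable_funTS.
    by apply: measurable_funB; exact: measurable_kap.
  rewrite EFinM lee_wpmul2l ?lee_fin //; exact: (kernel_difference alpha_itv).
have bound p q (A : R * Om -> 'M[R]_(p, q)) : mxmeas A ->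
    (forall s, (\int[P]_w (nsq (A (s, w)))%:E <= A2%:E)%E) ->
    forall s, 0 < s < t -> (\int[P]_w (nsq (dk (s, w).1 *: A (s, w)))%:E <= (dk s ^+ 2 * A2)%:E)%E.
  move=> mA hA s _ /=; rewrite integral_nsqZ; last exact: mxmeas_section mA.
  by rewrite [leRHS]EFinM lee_wpmul2l ?lee_fin ?sqr_ge0.
have z0 p q (A : R * Om -> 'M[R]_(p, q)) s w : ~~ (0 < s <= t) -> dk (s, w).1 *: A (s, w) = 0.
  by move=> /dk0 /= ->; rewrite scale0r.
have DX := le_trans (tonelli_bound mD (@z0 _ _ along_f) b0 (bound _ _ _ mxmeas_along_f fA)) kd.
have GX := le_trans (tonelli_bound mG (@z0 _ _ along_g) b0 (bound _ _ _ mxmeas_along_g gA)) kd.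
have mZ : mxmeas (fun w => x t w - x t' w) by apply: mxmeasB; exact: sol_meas.
have iD w i : mu.-integrable setT (fun s => ((dk (s, w).1 *: along_f (s, w)) i ord0)%:E).
  have := integrableB measurableT (sol_drift_integrable w i t0) (sol_drift_integrable w i t'0).
  by apply: eq_integrable => // s _; rewrite DE !mxE /= EFinB.
have aeZ : {ae P, forall w, x t w - x t' w =
    gam *: path_integral (fun z => dk z.1 *: along_f z) w + gam *: (I w - I' w)}.
  apply: filterS2 ae ae' => w -> ->.
  have -> : path_integral (fun z => dk z.1 *: along_f z) w =
      path_integral (sol_drift t) w - path_integral (sol_drift t') w.
    apply/matrixP => i j; rewrite (ord1 j) !mxE -RintegralB //;
      [|exact: sol_drift_integrable|exact: sol_drift_integrable].
    by apply: eq_Rintegral => s _; rewrite DE !mxE.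
  by rewrite !scalerBr opprD addrACA subrr add0r opprD addrACA.
have aG : ito_approx P F B (fun z => dk z.1 *: along_g z) (fun w => I w - I' w).
  by rewrite (funext GE); exact: ito_approxB.
have D0 s w : ~~ (0 < s <= T) -> dk (s, w).1 *: along_f (s, w) = 0.
  move=> st; apply: z0; apply: contra st => /andP[-> h] /=; exact: le_trans h tT.
have := energy_estimate mD iD D0 aG mZ aeZ DX GX.
by rewrite -EFinM.
Qed.
End one_solution.

(** The coefficients of [sol_moment_step] involve neither eps nor x, and [singular_gronwall] fixes C
    from them before the solution is introduced. *)
Lemma uniform_moment : exists2 A2, 0 <= A2 &
  forall eps x, 0 < eps -> fsde_solution P F B T alpha eps x0 f g x -> forall s,
    (\int[P]_w (nsq (along_f eps x (s, w)))%:E <= A2%:E)%E /\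
    (\int[P]_w (nsq (along_g eps x (s, w)))%:E <= A2%:E)%E.
Proof.
have A10 : 0 <= A1 by exact: (growth_cst_ge0 _ f_grow).
have T0 := ltW T_gt0.
have c0 : 0 <= 2 * A1 * energy_cst.
  by apply: mulr_ge0; [exact: mulr_ge0|exact: energy_cst_ge0].
have [C C0 gron] := singular_gronwall (beta_gt0 alpha_itv) T0 c0.
have a0 : 0 <= A1 * (1 + 2 * nsq x0).
  by apply: mulr_ge0 => //; apply: addr_ge0 => //; apply: mulr_ge0 => //; exact: nsq_ge0.
exists (C * (A1 * (1 + 2 * nsq x0))); first exact: mulr_ge0.
move=> eps x eps0 Hx.
have [M M0 hM] := sol_moment_lty Hx.
have bd s : 0 <= s <= T -> growth_bound x s <= C * (A1 * (1 + 2 * nsq x0)).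
  (* Continuous use of the inequality; [clamp T] is the identity on the times that occur and matches
     the integrand of [sol_moment_step] literally. *)
  apply: (gron R [set s | 0 <= s <= T] id (clamp T) (growth_bound x) _ (A1 * (1 + M))) => //.
  - move=> i r /andP[_ iT] /andP[r0 ri]; split; first exact: clamp_itv.
    by rewrite clamp_id // (ltW r0) (le_trans ri).
  - move=> i iT; rewrite growth_bound_ge0 /growth_bound ler_wpM2l // lerD2l.
    have h := hM i iT; rewrite -lee_fin fineK // ge0_fin_numE ?(le_lt_trans h) ?ltry //.
    by apply: integral_ge0 => w _; rewrite lee_fin nsq_ge0.
  - by move=> i iT; exact: (sol_moment_step eps0 Hx iT).
move=> s; have hs := bd _ (clamp_itv T0 s).
split; (apply: (@le_trans _ _ (growth_bound x (clamp T s))%:E); last by rewrite lee_fin).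
  by apply: along_moment => // t u; exact: (lip_growth (ltW K_gt0) f_lip f_grow).
by apply: along_moment => // t u; exact: (lip_growth (ltW K_gt0) g_lip g_grow).
Qed.
End solution.

(** * The uniform grid and its cells *)

Section uniform_grid.
Context {R : realType}.
Variable dt : R.
Hypothesis dt0 : 0 < dt.

Definition tau (i : nat) : R := i%:R * dt.
(* The i with tau i < s <= tau i.+1, for s > 0. *)
Definition cell (s : R) : nat := `|Num.ceil (s / dt)|%N.-1.

Lemma tau_ge0 i : 0 <= tau i.
Proof. by rewrite mulr_ge0 // ltW. Qed.

Lemma tau_step i : tau i.+1 = tau i + dt.
Proof. by rewrite /tau -natr1 mulrDl mul1r. Qed.

Lemma ler_tau i j : (tau i <= tau j) = (i <= j)%N.
Proof. by rewrite ler_pM2r // ler_nat. Qed.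

Lemma ltr_tau i j : (tau i < tau j) = (i < j)%N.
Proof. by rewrite ltr_pM2r // ltr_nat. Qed.

Lemma tau_cell s : 0 < s -> tau (cell s) < s <= tau (cell s).+1.
Proof.
move=> s0; have : 0 < Num.ceil (s / dt) by rewrite ceil_gt0 divr_gt0.
rewrite /tau -ltr_pdivlMr // -ler_pdivrMr // /cell; move: (ceil_itv (s / dt)).
by case: (Num.ceil (s / dt)) => [[|c]|c] //=; rewrite intS addrAC subrr add0r.
Qed.

Lemma cell_uniq i s : tau i < s <= tau i.+1 -> i = cell s.
Proof.
move=> /andP[is_ si]; have s0 := le_lt_trans (tau_ge0 i) is_.
have /andP[cs sc] := tau_cell s0.
have h1 := lt_le_trans is_ sc; have h2 := lt_le_trans cs si.
by rewrite !ltr_tau !ltnS in h1 h2; apply/eqP; rewrite eqn_leq h1.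
Qed.

Lemma cell_lt k s : 0 < s <= tau k -> (cell s < k)%N.
Proof.
move=> /andP[s0 sk]; have /andP[cs _] := tau_cell s0.
by rewrite -ltr_tau (lt_le_trans cs).
Qed.

Lemma cell_sum (V : lmodType R) k (h : nat -> V) s : 0 < s <= tau k ->
  \sum_(i < k) (s \in `]tau i, tau i.+1])%:R *: h i = h (cell s).
Proof.
move=> sk; have /andP[s0 _] := sk; rewrite (bigD1 (Ordinal (cell_lt sk))) //= big1 ?addr0.
  by rewrite in_itv /= tau_cell // scale1r.
move=> i ni; case: (boolP (s \in _)); last by rewrite scale0r.
rewrite in_itv /= => /cell_uniq iE; move: ni.
by rewrite -(inj_eq val_inj) /= iE eqxx.
Qed.

Lemma cell_sum0 (V : lmodType R) k (h : nat -> V) s : ~~ (0 < s <= tau k) ->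
  \sum_(i < k) (s \in `]tau i, tau i.+1])%:R *: h i = 0.
Proof.
move=> sk; apply: big1 => i _; case: (boolP (s \in _)); last by rewrite scale0r.
rewrite in_itv /= => /andP[is_ si]; case/negP: sk.
by rewrite (le_lt_trans (tau_ge0 i)) // (le_trans si) // ler_tau.
Qed.
End uniform_grid.

Lemma mxmeasD (R : realType) d (X : measurableType d) p q (H K : X -> 'M[R]_(p, q)) :
  mxmeas H -> mxmeas K -> mxmeas (fun x => H x + K x).
Proof.
move=> mH mK i j; under eq_fun do rewrite !mxE.
exact: measurable_funD.
Qed.

Lemma mxmeasM (R : realType) d (X : measurableType d) p q r
    (H : X -> 'M[R]_(p, q)) (K : X -> 'M[R]_(q, r)) :
  mxmeas H -> mxmeas K -> mxmeas (fun x => H x *m K x).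
Proof.
move=> mH mK i j; under eq_fun do rewrite !mxE.
by apply: measurable_sum => l; exact: measurable_funM.
Qed.

Lemma mxmeas_cst (R : realType) d (X : measurableType d) p q (A : 'M[R]_(p, q)) :
  mxmeas (fun _ : X => A).
Proof. by move=> i j; exact: measurable_cst. Qed.

Section sqint_more.
Context {R : realType} {d : measure_display} {Om : measurableType d}.
Variable P : probability Om R.

Lemma sqint_cst (c : R) : sqint P (fun _ : Om => c).
Proof. by split; [exact: measurable_cst|rewrite integral_prob_cst ltry]. Qed.

Lemma sqint_sum (I : Type) (r : seq I) (f : I -> Om -> R) :
  (forall i, sqint P (f i)) -> sqint P (fun w => \sum_(i <- r) f i w).
Proof.
move=> hf; elim: r => [|i r IH].
  by under eq_fun do rewrite big_nil; exact: sqint_cst.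
by under eq_fun do rewrite big_cons; exact: sqintD.
Qed.

Lemma sqint_nsq_lty p q (A : Om -> 'M[R]_(p, q)) :
  (forall i j, sqint P (fun w => A w i j)) -> (\int[P]_w (nsq (A w))%:E < +oo)%E.
Proof.
move=> hA; have /integrableP[_] : P.-integrable setT (fun w => (nsq (A w))%:E).
  by apply: integrable_sumR => i; apply: integrable_sumR => j; exact: sqint_sqr.
apply: le_lt_trans; apply: le_integral_nomeas => w _; first by rewrite lee_fin nsq_ge0.
by rewrite lee_fin ler_norm.
Qed.

Lemma lip_sqint n p q (phi : R -> 'cV[R]_n -> 'M[R]_(p, q)) K L (V : Om -> 'cV[R]_n) t :
  0 <= K ->
  (forall t1 t2 u v, 0 <= t1 -> 0 <= t2 ->
    frob (phi t1 u - phi t2 v) <= K * (`|t1 - t2| + frob (u - v))) ->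
  (forall t, 0 <= t -> frob (phi t 0) ^+ 2 <= L) -> 0 <= t ->
  (forall i j, sqint P (fun w => V w i j)) ->
  forall i j, sqint P (fun w => phi t (V w) i j).
Proof.
move=> K0 lip grow t0 hV i j.
have mV : mxmeas V by move=> k l; have [] := hV k l.
split; first exact: (lip_measurable K0 lip t0 mV).
have /integrableP[_] : P.-integrable setT
    (fun w => (growth_cst K L)%:E * (1%:E + (nsq (V w))%:E))%E.
  apply: integrableZl => //; apply: integrableD => //.
    by have := sqint_sqr (sqint_cst 1); under eq_fun do rewrite expr1n.
  by apply: integrable_sumR => k; apply: integrable_sumR => l; exact: sqint_sqr.
apply: le_lt_trans; apply: le_integral_nomeas => w _; first by rewrite lee_fin sqr_ge0.
rewrite -EFinD -EFinM lee_fin; apply: le_trans (ler_norm _).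
exact: le_trans (nsq_entry _ i j) (lip_growth K0 lip grow _ t0).
Qed.
End sqint_more.

(** * Integral form of the Euler-Maruyama scheme *)

Section euler.
Context {R : realType} {d : measure_display} {Om : measurableType d}.
Variables (P : probability Om R) (F : R -> set (set Om)).
Hypothesis HF : filtration F.
Variables (n m : nat) (B : R -> Om -> 'cV[R]_m).
Hypothesis HB : brownian P F B.
Variables (T alpha : R).
Hypothesis T_gt0 : 0 < T.
Hypothesis alpha_itv : 2^-1 < alpha < 1.
Variable x0 : 'cV[R]_n.
Variables (f : R -> 'cV[R]_n -> 'cV[R]_n) (g : R -> 'cV[R]_n -> 'M[R]_(n, m)).
Variables (K L : R).
Hypothesis K0 : 0 <= K.
Hypothesis f_lip : forall t1 t2 u v, 0 <= t1 -> 0 <= t2 ->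
  frob (f t1 u - f t2 v) <= K * (`|t1 - t2| + frob (u - v)).
Hypothesis g_lip : forall t1 t2 u v, 0 <= t1 -> 0 <= t2 ->
  frob (g t1 u - g t2 v) <= K * (`|t1 - t2| + frob (u - v)).
Hypothesis f_grow : forall t, 0 <= t -> frob (f t 0) ^+ 2 <= L.
Hypothesis g_grow : forall t, 0 <= t -> frob (g t 0) ^+ 2 <= L.
Variables (eps : R) (N : nat) (y : nat -> Om -> 'cV[R]_n).
Hypothesis eps_gt0 : 0 < eps.
Hypothesis N_gt0 : (0 < N)%N.
Hypothesis Hy : euler_maruyama B T alpha eps x0 f g N y.
Local Notation mu := (@lebesgue_measure R).
Local Notation gam := (Gamma alpha)^-1.
Local Notation dt := (T / N%:R).
Local Notation t_ := (tau dt).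

Lemma dt_gt0 : 0 < dt. Proof. by rewrite divr_gt0 // ltr0n. Qed.

Lemma tau_le_T k : (k <= N)%N -> t_ k <= T.
Proof.
move=> kN; apply: (@le_trans _ _ (t_ N)); first by rewrite ler_tau // dt_gt0.
by rewrite /tau mulrC divfK // pnatr_eq0 -lt0n.
Qed.

Let tB i k : (i <= k)%N -> t_ k - t_ i = (k - i)%:R * dt.
Proof. by move=> ik; rewrite /tau -mulrBl natrB. Qed.

Let tepsi i : 0 <= t_ i / eps.
Proof. by rewrite divr_ge0 ?(ltW eps_gt0) // tau_ge0 // dt_gt0. Qed.

(** By Gamma(alpha + 1) = alpha Gamma(alpha), and with the powers of dt absorbed into differences of
    grid times, both sums get the common factor 1 / Gamma(alpha). For k = 0 the sums are empty and
    [em_start] applies. *)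
Lemma euler_eq k w : (k <= N)%N -> y k w = x0
  + (gam *: \sum_(i < k) (((t_ k - t_ i) `^ alpha - (t_ k - t_ i.+1) `^ alpha) / alpha) *:
       f (t_ i / eps) (y i w)
  + gam *: \sum_(i < k) ((t_ k - t_ i) `^ (alpha - 1) *: g (t_ i / eps) (y i w)) *m
       (B (t_ i.+1) w - B (t_ i) w)).
Proof.
case: k => [|k] kN; first by rewrite !big_ord0 (em_start Hy) !scaler0 !addr0.
have pM a b : (a%:R * dt) `^ b = a%:R `^ b * dt `^ b by rewrite powRM // ltW // dt_gt0.
have := em_step Hy (k := k.+1) w kN => /= ->; rewrite -addrA; congr (_ + (_ + _)).
  rewrite !scaler_sumr; apply: eq_bigr => i _; rewrite !scalerA; congr (_ *: _).
  have ik := ltn_ord i.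
  rewrite (tB (ltnW ik)) (tB ik) !pM Gamma_succ ?(alpha_gt0 alpha_itv) //.
  rewrite -subnDA addn1 invfM; ring.
rewrite !scaler_sumr; apply: eq_bigr => i _; rewrite -scalemxAl !scalerA; congr (_ *: _).
by rewrite (tB (ltnW (ltn_ord i))) pM; ring.
Qed.

(** The two properties are proved in one induction: square integrability of a noise term needs its
    coefficient to be adapted, so as to be independent of the increment. *)
Lemma euler_adapted k : (k <= N)%N ->
  (forall i j, gmeas (F (t_ k)) (fun w => y k w i j)) /\
  (forall i j, sqint P (fun w => y k w i j)).
Proof.
elim/ltn_ind: k => k IH kN.
have dt0 := dt_gt0.
have sF := filtration_sigma HF (tau_ge0 dt0 k).
have gB i j j' : (i <= k)%N -> gmeas (F (t_ k)) (fun w => B (t_ i) w j j').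
  move=> ik; rewrite (ord1 j'); apply: (gmeas_mono HF (tau_ge0 dt0 i)); first by rewrite ler_tau.
  exact: (bm_adapted (brownian_component HB j) (tau_ge0 dt0 i)).
have yE w := euler_eq w kN.
split=> i j.
  apply/(gmeasP sF); rewrite (funext (fun w => congr1 (fun A : 'cV_n => A i j) (yE w))).
  move: i j; apply: (@mxmeasD _ _ (g_sigma_algebraType (F (t_ k)))); first exact: mxmeas_cst.
  apply: mxmeasD; (apply: mxmeasZ; first exact: measurable_cst); apply: mxmeas_sum => l.
    apply: mxmeasZ; first exact: measurable_cst.
    have lk := ltn_ord l; have [gy _] := IH l lk (ltnW (leq_trans lk kN)).
    move=> i j; apply/(gmeasP sF); apply: (lip_gmeas K0 f_lip sF (tepsi l)) => i'.
    by apply: (gmeas_mono HF (tau_ge0 dt0 l)); [rewrite ler_tau // ltnW|exact: gy].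
  have lk := ltn_ord l; have [gy _] := IH l lk (ltnW (leq_trans lk kN)).
  apply: mxmeasM.
    apply: mxmeasZ; first exact: measurable_cst.
    move=> i j; apply/(gmeasP sF); apply: (lip_gmeas K0 g_lip sF (tepsi l)) => i'.
    by apply: (gmeas_mono HF (tau_ge0 dt0 l)); [rewrite ler_tau // ltnW|exact: gy].
  by apply: mxmeasB => i j; apply/(gmeasP sF); apply: gB => //; exact: ltnW.
rewrite (funext (fun w => congr1 (fun A : 'cV_n => A i j) (yE w))).
under eq_fun do rewrite !mxE !summxE.
apply: sqintD; first exact: sqint_cst.
apply: sqintD; apply: sqintZ; apply: sqint_sum => l;
  have lk := ltn_ord l; have [gy sy] := IH l lk (ltnW (leq_trans lk kN)).
  under eq_fun do rewrite mxE; apply: sqintZ.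
  exact: (lip_sqint K0 f_lip f_grow (tepsi l) sy).
under eq_fun do rewrite mxE.
apply: sqint_sum => r; rewrite (ord1 j); under eq_fun do rewrite !mxE -mulrA.
apply: sqintZ; apply: (sqint_incr HF (brownian_component HB r) (tau_ge0 dt0 l)).
- by rewrite ler_tau.
- apply: (lip_gmeas K0 g_lip (filtration_sigma HF (tau_ge0 dt0 l)) (tepsi l)) => i'.
  exact: gy.
- exact: (lip_sqint K0 g_lip g_grow (tepsi l) sy).
Qed.

Definition euler_diff k : @step R d Om n m := @Step R d Om n m 'I_k
  (fun i => t_ i) (fun i => t_ i.+1)
  (fun i w => (t_ k - t_ i) `^ (alpha - 1) *: g (t_ i / eps) (y i w)).

Lemma euler_diff_ok k : (k <= N)%N -> step_ok P F (euler_diff k).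
Proof.
move=> kN; have dt0 := dt_gt0; split.
- by move=> i; exact: tau_ge0.
- by move=> i /=; rewrite ler_tau.
- move=> l i j /=; have [gy _] := euler_adapted (ltnW (leq_trans (ltn_ord l) kN)).
  have sF := filtration_sigma HF (tau_ge0 dt0 l).
  apply/(gmeasP sF); move: i j; apply: mxmeasZ; first exact: measurable_cst.
  move=> i j; apply/(gmeasP sF); apply: (lip_gmeas K0 g_lip sF (tepsi l)) => i'.
  exact: gy.
- move=> l i j /=; have [_ sy] := euler_adapted (ltnW (leq_trans (ltn_ord l) kN)).
  under eq_fun do rewrite mxE; apply: sqintZ.
  exact: (lip_sqint K0 g_lip g_grow (tepsi l) sy).
Qed.

Definition euler_drift k (z : R * Om) : 'cV[R]_n :=
  kap alpha (t_ k) z.1 *: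
    \sum_(i < k) (z.1 \in `]t_ i, t_ i.+1])%:R *: f (t_ i / eps) (y i z.2).

Lemma mxmeas_euler_drift k : (k <= N)%N -> mxmeas (euler_drift k).
Proof.
move=> kN; apply: mxmeas_kap; apply: mxmeas_sum => l; apply: mxmeasZ.
  have -> : (fun z : R * Om => (z.1 \in `]t_ l, t_ l.+1])%:R : R) =
      (\1_`]t_ l, t_ l.+1]%classic : R -> R) \o fst.
    by apply/funext => z /=; rewrite indicE mem_setE.
  by apply: measurableT_comp => //; exact: measurable_indic.
have [_ sy] := euler_adapted (ltnW (leq_trans (ltn_ord l) kN)).
move=> i j; have [mf _] := lip_sqint K0 f_lip f_grow (tepsi l) sy i j.
exact: (measurableT_comp mf).
Qed.

Let drift_entry k w i s : euler_drift k (s, w) i ord0 =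
  \sum_(l < k) f (t_ l / eps) (y l w) i ord0 *
     ((s \in `]t_ l, t_ l.+1])%:R * kap alpha (t_ k) s).
Proof.
rewrite !mxE summxE mulr_sumr; apply: eq_bigr => l _; rewrite !mxE /=; ring.
Qed.

Let drift_term_integrable k (l : 'I_k) (c : R) :
  mu.-integrable setT (EFin \o (fun s => c *
     ((s \in `]t_ l, t_ l.+1])%:R * kap alpha (t_ k) s))).
Proof.
have h := integrableZl measurableT c (kap_integrable alpha_itv (tau_ge0 dt_gt0 k)).
apply: (le_integrable measurableT _ _ h).
  apply/measurable_EFinP; apply: measurable_funM => //; apply: measurable_funM.
    have -> : (fun s : R => (s \in `]t_ l, t_ l.+1])%:R : R) =
        (\1_`]t_ l, t_ l.+1]%classic : R -> R).
      by apply/funext => z /=; rewrite indicE mem_setE.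
    exact: measurable_indic.
  exact: measurable_kap.
move=> s _ /=; rewrite lee_fin !normrM ler_wpM2l //.
by rewrite ler_piMl //; case: (_ \in _); rewrite ?normr1 ?normr0.
Qed.

Lemma euler_drift_integrable k w i :
  mu.-integrable setT (fun s => (euler_drift k (s, w) i ord0)%:E).
Proof.
under eq_fun do rewrite drift_entry.
by apply: integrable_sumR => l; exact: drift_term_integrable.
Qed.

Lemma euler_repr k w : (k <= N)%N -> y k w = x0
  + (gam *: path_integral (euler_drift k) w + gam *: step_integral B (euler_diff k) w).
Proof.
move=> kN; rewrite (euler_eq _ kN); congr (_ + (_ *: _ + _)).
apply/matrixP => i j; rewrite (ord1 j) !mxE summxE.
have -> : \int[mu]_s euler_drift k (s, w) i ord0 =
    \int[mu]_s \sum_(l < k) f (t_ l / eps) (y l w) i ord0 *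
      ((s \in `]t_ l, t_ l.+1])%:R * kap alpha (t_ k) s).
  by apply: eq_Rintegral => s _; exact: drift_entry.
rewrite Rintegral_sum; last by move=> l; exact: drift_term_integrable.
apply: eq_bigr => l _; rewrite RintegralZl //; last first.
  by have := drift_term_integrable l 1; under eq_fun do rewrite /= mul1r.
rewrite (Rintegral_kap_itv alpha_itv) ?ler_tau ?dt_gt0 ?tau_ge0 ?dt_gt0 //.
by rewrite mxE mulrC.
Qed.

Lemma euler_drift_cell k s w : 0 < s <= t_ k ->
  euler_drift k (s, w) = kap alpha (t_ k) s *: f (t_ (cell dt s) / eps) (y (cell dt s) w).
Proof.
move=> sk; rewrite /euler_drift /=.
by rewrite (cell_sum dt_gt0 (fun i => f (t_ i / eps) (y i w)) sk).
Qed.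

Lemma euler_diff_cell k s w : 0 < s <= t_ k ->
  step_value (euler_diff k) (s, w) =
  (t_ k - t_ (cell dt s)) `^ (alpha - 1) *: g (t_ (cell dt s) / eps) (y (cell dt s) w).
Proof.
move=> sk; rewrite /step_value /=.
exact: (cell_sum dt_gt0 (fun i => (t_ k - t_ i) `^ (alpha - 1) *: g (t_ i / eps) (y i w)) sk).
Qed.

Lemma euler_drift0 k s w : ~~ (0 < s <= t_ k) -> euler_drift k (s, w) = 0.
Proof. by move=> sk; rewrite /euler_drift kap0 // scale0r. Qed.

Lemma euler_diff0 k s w : ~~ (0 < s <= t_ k) -> step_value (euler_diff k) (s, w) = 0.
Proof.
move=> sk; rewrite /step_value /=.
exact: (cell_sum0 dt_gt0 (fun i => (t_ k - t_ i) `^ (alpha - 1) *: g (t_ i / eps) (y i w)) sk).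
Qed.
End euler.

Lemma integral_prob_affine (R : realType) d (Om : measurableType d) (P : probability Om R)
    (a b : R) (h : Om -> R) : 0 <= a -> 0 <= b -> measurable_fun setT h ->
  (forall w, 0 <= h w) ->
  (\int[P]_w (a * (b + h w))%:E = a%:E * (b%:E + \int[P]_w (h w)%:E))%E.
Proof.
move=> a0 b0 mh h0; under eq_integral do rewrite EFinM EFinD.
have mh' : measurable_fun setT (EFin \o h) by exact/measurable_EFinP.
rewrite ge0_integralZl_EFin //; last 2 first.
- by move=> w _; rewrite adde_ge0 // lee_fin.
- by apply: emeasurable_funD => //; exact: measurable_cst.
rewrite ge0_integralD //; last by move=> w _; rewrite lee_fin.
by rewrite integral_prob_cst.
Qed.

Lemma mule_affine (R : realType) (a b c : R) (X : \bar R) :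
  0 <= b -> 0 <= c -> (0 <= X)%E ->
  (a%:E * (b%:E + c%:E * X) = (a * b)%:E + (a * c)%:E * X)%E.
Proof.
by move=> b0 c0 X0; rewrite ge0_muleDr ?lee_fin ?mule_ge0 // muleA -!EFinM.
Qed.

(** * Volterra inequality for the error of the scheme *)

Section convergence.
Context {R : realType} {d : measure_display} {Om : measurableType d}.
Variables (P : probability Om R) (F : R -> set (set Om)).
Hypothesis HF : filtration F.
Variables (n m : nat) (B : R -> Om -> 'cV[R]_m).
Hypothesis HB : brownian P F B.
Variables (T alpha : R).
Hypothesis T_gt0 : 0 < T.
Hypothesis alpha_itv : 2^-1 < alpha < 1.
Variable x0 : 'cV[R]_n.
Variables (f : R -> 'cV[R]_n -> 'cV[R]_n) (g : R -> 'cV[R]_n -> 'M[R]_(n, m)).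
Variables (K L : R).
Hypothesis K_gt0 : 0 < K.
Hypothesis fg_lipschitz : forall (t1 t2 : R) (x1 x2 : 'cV[R]_n), 0 <= t1 -> 0 <= t2 ->
    Num.max (frob (f t1 x1 - f t2 x2)) (frob (g t1 x1 - g t2 x2))
      <= K * (`|t1 - t2| + frob (x1 - x2)).
Hypothesis fg_growth : forall t : R, 0 <= t ->
    Num.max (frob (f t 0) ^+ 2) (frob (g t 0) ^+ 2) <= L.
Variable A2 : R.
Hypothesis A2_ge0 : 0 <= A2.
Local Notation mu := (@lebesgue_measure R).
Local Notation Q := (mu \x P)%E.
Local Notation beta := (2 * alpha - 1).
Local Notation gam := (Gamma alpha)^-1.
Local Notation ecst := (@energy_cst R m T alpha).

Definition holder_cst : R := ecst * (A2 * (2 / beta)).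

Let ecst0 : 0 <= ecst := energy_cst_ge0 m alpha T_gt0.
Let beta0 : 0 < beta := beta_gt0 alpha_itv.

Lemma holder_cst_ge0 : 0 <= holder_cst.
Proof. by apply: mulr_ge0 => //; apply: mulr_ge0 => //; rewrite divr_ge0 // ltW. Qed.

Variables (eps : R) (x : R -> Om -> 'cV[R]_n) (N : nat) (y : nat -> Om -> 'cV[R]_n).
Hypothesis eps_gt0 : 0 < eps.
Hypothesis N_gt0 : (0 < N)%N.
Hypothesis Hx : fsde_solution P F B T alpha eps x0 f g x.
Hypothesis Hy : euler_maruyama B T alpha eps x0 f g N y.
Hypothesis fA : forall s, (\int[P]_w (nsq (along_f T f eps x (s, w)))%:E <= A2%:E)%E.
Hypothesis gA : forall s, (\int[P]_w (nsq (along_g T g eps x (s, w)))%:E <= A2%:E)%E.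
Local Notation dt := (T / N%:R).
Local Notation t_ := (tau dt).
Let K0 := ltW K_gt0.
Let flip := f_lip fg_lipschitz.
Let glip := g_lip fg_lipschitz.
Let fgrow := f_grow fg_growth.
Let ggrow := g_grow fg_growth.
Let dt0 : 0 < dt := dt_gt0 T_gt0 N_gt0.

Let tT k : (k <= N)%N -> 0 <= t_ k <= T.
Proof. by move=> kN; rewrite (tau_ge0 dt0) (tau_le_T T_gt0 N_gt0 kN). Qed.

Let mx s : 0 <= s <= T -> mxmeas (x s).
Proof. exact: (sol_meas HF Hx). Qed.

Let y_sqint k : (k <= N)%N -> forall i j, sqint P (fun w => y k w i j).
Proof.
move=> kN; have [_ h] := euler_adapted HF HB T_gt0 alpha_itv K0 flip glip fgrow ggrow eps_gt0 N_gt0 Hy kN.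
exact: h.
Qed.

Let my k : (k <= N)%N -> mxmeas (y k).
Proof. by move=> kN i j; have [] := y_sqint kN i j. Qed.

Definition mse k : R := fine (\int[P]_w (nsq (x (t_ k) w - y k w))%:E)%E.

(** Both x and the scheme have finite second moments, so [fine] loses nothing. *)
Lemma mseE k : (k <= N)%N -> (mse k)%:E = (\int[P]_w (nsq (x (t_ k) w - y k w))%:E)%E.
Proof.
move=> kN; rewrite fineK // ge0_fin_numE; last first.
  by apply: integral_ge0 => w _; rewrite lee_fin nsq_ge0.
have [M _ hM] := sol_moment_lty T_gt0 Hx.
apply: (@le_lt_trans _ _ (2%:E * \int[P]_w (nsq (x (t_ k) w))%:E + 2%:E * \int[P]_w (nsq (- y k w))%:E)%E).
  apply: integral_nsq_le => //; first exact: mx (tT kN).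
  move=> i j; under eq_fun do rewrite mxE.
  by apply: measurable_funN; exact: my.
rewrite lte_add_pinfty // lte_mul_pinfty //.
  by apply: le_lt_trans (hM _ (tT kN)) _; rewrite ltry.
by under eq_integral do rewrite nsqN; exact: sqint_nsq_lty (y_sqint kN).
Qed.

Lemma mse_ge0 k : 0 <= mse k.
Proof. by apply: fine_ge0; apply: integral_ge0 => w _; rewrite lee_fin nsq_ge0. Qed.

(** The first term is the change of the fast time s / eps over a cell. The second is the change of x
    over a cell, doubled because x(s) is compared with the scheme through x at the left end. *)
Definition local_error : R := (dt / eps) ^+ 2 + 2 * (holder_cst * dt `^ beta).

Lemma local_error_ge0 : 0 <= local_error.
Proof.
by rewrite addr_ge0 ?sqr_ge0 // mulr_ge0 // mulr_ge0 ?powR_ge0 // holder_cst_ge0.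
Qed.

(** The Gronwall inequality is applied to this quantity rather than to [mse]: it is what occurs
    under the integral in [mse_step]. *)
Definition coef_error k : R := 2 * K ^+ 2 * (local_error + 2 * mse k).

Lemma coef_error_ge0 k : 0 <= coef_error k.
Proof.
apply: mulr_ge0; first by rewrite mulr_ge0 // sqr_ge0.
by rewrite addr_ge0 ?local_error_ge0 // mulr_ge0 // mse_ge0.
Qed.

Lemma increment_bound s : 0 < s <= T -> (cell dt s <= N)%N ->
  (\int[P]_w (nsq (x s w - y (cell dt s) w))%:E <=
    (2 * (holder_cst * dt `^ beta) + 2 * mse (cell dt s))%:E)%E.
Proof.
move=> /andP[s0 sT] iN; set i := cell dt s in iN *.
have /andP[is_ si] := tau_cell dt0 s0; rewrite -/i in is_ si.
have sI : 0 <= s <= T by rewrite ltW.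
apply: (@le_trans _ _ (2%:E * \int[P]_w (nsq (x s w - x (t_ i) w))%:E +
    2%:E * \int[P]_w (nsq (x (t_ i) w - y i w))%:E)%E).
  apply: integral_nsq_le.
  - by apply: mxmeasB; [exact: mx|exact: mx (tT iN)].
  - by apply: mxmeasB; [exact: mx (tT iN)|exact: my].
  - by move=> w; rewrite addrA subrK.
rewrite -mseE //.
have -> : (2 * (holder_cst * dt `^ beta) + 2 * mse i)%:E =
    (2%:E * (holder_cst * dt `^ beta)%:E + 2%:E * (mse i)%:E)%E by [].
rewrite leeD2r // lee_wpmul2l ?lee_fin //.
apply: le_trans (sol_holder HF HB T_gt0 alpha_itv K_gt0 fg_lipschitz eps_gt0 Hx fA gA A2_ge0
  (tau_ge0 dt0 i) (ltW is_) sT) _.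
have -> : holder_cst * dt `^ beta = ecst * (A2 * (2 / beta * dt `^ beta)).
  by rewrite /holder_cst !mulrA.
rewrite lee_fin; apply: ler_wpM2l => //; apply: ler_wpM2l => //; apply: ler_wpM2l.
  by rewrite divr_ge0 // ltW.
apply: ge0_ler_powR; rewrite ?nnegrE ?(ltW beta0) ?(ltW dt0) ?subr_ge0 ?(ltW is_) //.
by rewrite lerBlDl -tau_step.
Qed.

Lemma coef_error_bound p q (phi : R -> 'cV[R]_n -> 'M[R]_(p, q)) s :
  (forall t1 t2 u v, 0 <= t1 -> 0 <= t2 ->
    frob (phi t1 u - phi t2 v) <= K * (`|t1 - t2| + frob (u - v))) ->
  0 < s <= T -> (cell dt s <= N)%N ->
  (\int[P]_w (nsq (along phi T eps x (s, w) - phi (t_ (cell dt s) / eps) (y (cell dt s) w)))%:E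
     <= (coef_error (cell dt s))%:E)%E.
Proof.
move=> lip sT iN; have inc := increment_bound sT iN.
have /andP[s0 sT'] := sT.
set i := cell dt s in iN inc *.
have /andP[is_ si] := tau_cell dt0 s0; rewrite -/i in is_ si.
have sI : 0 <= s <= T by rewrite ltW.
have mD : mxmeas (fun w => x s w - y i w) by apply: mxmeasB; [exact: mx|exact: my].
apply: (@le_trans _ _ (\int[P]_w (2 * K ^+ 2 * ((dt / eps) ^+ 2 + nsq (x s w - y i w)))%:E)%E).
  apply: le_integral_nomeas => w _; first by rewrite lee_fin nsq_ge0.
  rewrite lee_fin /along /= clamp_id //.
  apply: le_trans (lip_nsq K0 lip _ _ _ _) _.
  - by rewrite divr_ge0 // ltW.
  - by rewrite divr_ge0 ?(ltW eps_gt0) // tau_ge0.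
  rewrite ler_wpM2l ?mulr_ge0 ?sqr_ge0 // lerD2r -mulrBl.
  have h0 : 0 <= dt / eps by rewrite ltW // divr_gt0.
  have h1 : 0 <= (s - t_ i) / eps by rewrite ltW // divr_gt0 // subr_gt0.
  have h2 : s - t_ i <= dt by rewrite lerBlDl -tau_step.
  by rewrite lerXn2r ?nnegrE // ler_wpM2r // invr_ge0 ltW.
rewrite integral_prob_affine; last 4 first.
- by rewrite mulr_ge0 // sqr_ge0.
- exact: sqr_ge0.
- exact: measurable_nsq.
- by move=> w; exact: nsq_ge0.
rewrite /coef_error [leRHS]EFinM lee_wpmul2l ?lee_fin ?mulr_ge0 ?sqr_ge0 //.
by rewrite /local_error -addrA [leRHS]EFinD leeD2l.
Qed.

Lemma mse_step k : (k <= N)%N ->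
  ((mse k)%:E <= (2 * (holder_cst * dt `^ beta))%:E + (2 * ecst)%:E *
    \int[mu]_(s in `]0%R, t_ k]) ((t_ k - s) `^ (beta - 1) * coef_error (cell dt s))%:E)%E.
Proof.
move=> kN; have tI := tT kN; have /andP[tk0 tkT] := tI.
set X := (\int[mu]_(s in `]0%R, t_ k]) _)%E.
have X0 : (0 <= X)%E.
  by apply: integral_ge0 => s _; rewrite lee_fin mulr_ge0 ?powR_ge0 ?coef_error_ge0.
have b0 s : 0 <= (t_ k - s) `^ (beta - 1) * coef_error (cell dt s).
  by rewrite mulr_ge0 ?powR_ge0 ?coef_error_ge0.
have sT s : 0 < s < t_ k -> 0 < s <= T /\ (cell dt s <= N)%N.
  move=> /andP[s0 /ltW st]; rewrite s0 (le_trans st tkT); split => //.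
  by apply: leq_trans kN; apply: ltnW; apply: cell_lt => //; rewrite s0.
have [I aI ae] := solution_repr HF T_gt0 K_gt0 fg_lipschitz eps_gt0 Hx tI.
pose S := euler_diff T alpha g eps N y k.
pose ED := euler_drift T alpha f eps N y k.
pose SD := sol_drift T alpha f eps x (t_ k).
pose SG := sol_diff T alpha g eps x (t_ k).
have okS : step_ok P F S.
  exact: (euler_diff_ok HF HB T_gt0 alpha_itv K0 flip glip fgrow ggrow eps_gt0 N_gt0 Hy kN).
have mSD : mxmeas SD := mxmeas_sol_drift HF T_gt0 K_gt0 fg_lipschitz eps_gt0 Hx (t_ k).
have mED : mxmeas ED.
  exact: (mxmeas_euler_drift HF HB T_gt0 alpha_itv K0 flip glip fgrow ggrow eps_gt0 N_gt0 Hy kN).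
have mD : mxmeas (fun z => SD z - ED z) by exact: mxmeasB.
have DX : (\int[Q]_z (nsq (SD z - ED z))%:E <= X)%E.
  apply: (tonelli_bound mD _ b0) => s.
    by move=> w st; rewrite /SD /ED sol_drift0 // euler_drift0 // subrr.
  move=> st; have [sI ci] := sT s st; have /andP[s0 /ltW st'] := st.
  have sI' : 0 < s <= t_ k by rewrite s0.
  under eq_integral => w _ do
    rewrite /SD /ED /sol_drift (euler_drift_cell alpha T_gt0 f eps y N_gt0 w sI') /= -scalerBr.
  rewrite integral_nsqZ; last first.
    apply: mxmeasB; first exact: mxmeas_section (mxmeas_along_f HF T_gt0 K_gt0 fg_lipschitz eps_gt0 Hx).
    apply: (lip_measurable K0 flip _ (my ci)).
    by rewrite divr_ge0 ?(ltW eps_gt0) // tau_ge0.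
  rewrite kap_sqr // [leRHS]EFinM lee_wpmul2l ?lee_fin ?powR_ge0 //.
  exact: (coef_error_bound flip sI ci).
have mAG := mxmeas_along_g HF T_gt0 K_gt0 fg_lipschitz eps_gt0 Hx.
have mSG : mxmeas SG := mxmeas_sol_diff HF T_gt0 K_gt0 fg_lipschitz eps_gt0 Hx (t_ k).
have mSV : mxmeas (step_value S) := mxmeas_step_value okS.
pose KE s : R := \sum_(i < k) (s \in `]t_ i, t_ i.+1])%:R *: ((t_ k - t_ i) `^ (alpha - 1) : R^o).
have KEE s : 0 < s <= t_ k -> KE s = (t_ k - t_ (cell dt s)) `^ (alpha - 1).
  exact: (cell_sum dt0 (fun i => (t_ k - t_ i) `^ (alpha - 1) : R^o)).
have KE0 s : ~~ (0 < s <= t_ k) -> KE s = 0.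
  exact: (cell_sum0 dt0 (fun i => (t_ k - t_ i) `^ (alpha - 1) : R^o)).
have mKE : measurable_fun setT KE.
  apply: measurable_sum => i; apply: measurable_funM => //.
  rewrite (_ : (fun s => _) = \1_(`]t_ i, t_ i.+1]%classic)); first exact: measurable_indic.
  by apply/funext => s; rewrite indicE mem_setE.
have mKE' : measurable_fun setT (fun z : R * Om => KE z.1) by exact: (measurableT_comp mKE).
pose GA z := (kap alpha (t_ k) z.1 - KE z.1) *: along_g T g eps x z.
pose GC z := KE z.1 *: along_g T g eps x z - step_value S z.
have mGA : mxmeas GA.
  apply: mxmeasZ => //; apply: measurable_funB => //.
  exact: (measurableT_comp (measurable_kap alpha (t_ k))).
have mGC : mxmeas GC by apply: mxmeasB => //; exact: mxmeasZ.
have GE z : SG z - step_value S z = GA z + GC z.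
  by rewrite /GA /GC scalerBl addrA subrK.
have cellP s : 0 < s < t_ k ->
    [/\ KE s = (t_ k - t_ (cell dt s)) `^ (alpha - 1), t_ (cell dt s) < s & s <= t_ (cell dt s) + dt].
  move=> /andP[s0 st]; have /andP[h1 h2] := tau_cell dt0 s0.
  by rewrite KEE ?s0 ?(ltW st) // h1 -tau_step.
have GAX : (\int[Q]_z (nsq (GA z))%:E <= (A2 * (2 / beta * dt `^ beta))%:E)%E.
  pose h s := ((kap alpha (t_ k + dt) s - kap alpha (t_ k) s) ^+ 2 * A2).
  have h0 s : 0 <= h s by rewrite mulr_ge0 // sqr_ge0.
  have mh : measurable_fun setT (fun s => (h s)%:E).
    apply/measurable_EFinP; apply: measurable_funM => //; apply: measurable_funX.
    by apply: measurable_funB; exact: measurable_kap.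
  apply: (@le_trans _ _ (\int[mu]_(s in `]0%R, t_ k]) (h s)%:E)%E).
    apply: (tonelli_bound mGA _ h0) => s.
      by move=> w st; rewrite /GA /= kap0 // KE0 // subrr scale0r.
    move=> st; rewrite /GA /= integral_nsqZ; last exact: mxmeas_section mAG.
    rewrite /h [leRHS]EFinM; apply: le_trans (lee_wpmul2l _ (gA s)) _.
      by rewrite lee_fin sqr_ge0.
    rewrite lee_wpmul2r ?lee_fin //.
    have [-> c1 c2] := cellP s st; have /andP[s0 st'] := st.
    rewrite !kapE ?s0 ?(ltW st') ?(le_trans (ltW st')) ?lerDl ?(ltW dt0) //.
    have k1 : (t_ k - t_ (cell dt s)) `^ (alpha - 1) <= (t_ k - s) `^ (alpha - 1).
      by apply: (powR_decr alpha_itv); [rewrite subr_gt0|rewrite lerD2l lerN2 ltW].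
    have k2 : (t_ k + dt - s) `^ (alpha - 1) <= (t_ k - t_ (cell dt s)) `^ (alpha - 1).
      apply: (powR_decr alpha_itv); first by rewrite subr_gt0 (lt_trans c1).
      by rewrite -addrA lerD2l lerBrDl lerBlDr addrC.
    have sq (a b c : R) : a <= b -> b <= c -> (c - b) ^+ 2 <= (a - c) ^+ 2 by nra.
    exact: sq k2 k1.
  have tk' : t_ k <= t_ k + dt by rewrite lerDl ltW.
  have kd := kernel_difference alpha_itv tk0 tk'.
  rewrite (_ : t_ k + dt - t_ k = dt) in kd; last by rewrite addrAC subrr add0r.
  (* Enlarging the domain to the larger horizon brings the integral into the form of
     [kernel_difference]. *)
  apply: (@le_trans _ _ (\int[mu]_(s in `]0%R, (t_ k + dt)%R]) (h s)%:E)%E).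
    apply: ge0_subset_integral => //.
    - exact: measurable_funTS.
    - by move=> s _; rewrite lee_fin.
    - move=> s /=; rewrite !in_itv /= => /andP[-> /le_trans]; apply.
      by rewrite lerDl ltW.
  under eq_integral do rewrite /h mulrC EFinM.
  rewrite ge0_integralZl_EFin //; last 2 first.
  - by move=> s _; rewrite lee_fin sqr_ge0.
  - apply/measurable_EFinP; apply: measurable_funX; apply: measurable_funTS.
    by apply: measurable_funB; exact: measurable_kap.
  rewrite EFinM lee_wpmul2l ?lee_fin //.
have GCX : (\int[Q]_z (nsq (GC z))%:E <= X)%E.
  apply: (tonelli_bound mGC _ b0) => s.
    by move=> w st; rewrite /GC /= KE0 // scale0r euler_diff0 // subrr.
  move=> st; have [sI ci] := sT s st; have /andP[s0 st'] := st.
  have sI' : 0 < s <= t_ k by rewrite s0 ltW.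
  under eq_integral => w _ do
    rewrite /GC /= KEE // (euler_diff_cell alpha T_gt0 g eps y N_gt0 w sI') -scalerBr.
  rewrite integral_nsqZ; last first.
    apply: mxmeasB; first exact: mxmeas_section mAG.
    apply: (lip_measurable K0 glip _ (my ci)).
    by rewrite divr_ge0 ?(ltW eps_gt0) // tau_ge0.
  rewrite [leRHS]EFinM; apply: lee_pmul; rewrite ?lee_fin ?sqr_ge0 //.
  - by apply: integral_ge0 => w _; rewrite lee_fin nsq_ge0.
  (* The kernel increases with s, so its value at the left end of the cell is at most its value at
     s. *)
  - have [_ c1 c2] := cellP s st.
    rewrite -(kap_sqr alpha sI') kapE // lerXn2r ?nnegrE ?powR_ge0 //.
    by apply: (powR_decr alpha_itv); [rewrite subr_gt0|rewrite lerD2l lerN2 ltW].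
  exact: (coef_error_bound glip sI ci).
(* The common bound required by [energy_estimate]: it is the noise bound, and it dominates the drift
   bound X. *)
pose Y := (2%:E * (A2 * (2 / beta * dt `^ beta))%:E + 2%:E * X)%E.
have c0 : 0 <= A2 * (2 / beta * dt `^ beta).
  by apply: mulr_ge0 => //; apply: mulr_ge0; rewrite ?powR_ge0 // divr_ge0 // ltW.
have DY : (\int[Q]_z (nsq (SD z - ED z))%:E <= Y)%E.
  apply: (le_trans DX); rewrite /Y -[leLHS]add0e; apply: leeD; first by rewrite mule_ge0 ?lee_fin.
  by rewrite -[leLHS]mul1e lee_wpmul2r // lee_fin ler1n.
have GY : (\int[Q]_z (nsq (SG z - step_value S z))%:E <= Y)%E.
  apply: (@le_trans _ _ (2%:E * \int[Q]_z (nsq (GA z))%:E + 2%:E * \int[Q]_z (nsq (GC z))%:E)%E).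
    exact: integral_nsq_le.
  by apply: leeD; rewrite lee_wpmul2l ?lee_fin.
have iD w i : mu.-integrable setT (fun s => ((SD (s, w) - ED (s, w)) i ord0)%:E).
  have h1 := sol_drift_integrable HF T_gt0 alpha_itv K_gt0 fg_lipschitz eps_gt0 Hx w i tk0.
  have h2 := euler_drift_integrable T_gt0 alpha_itv f eps y N_gt0 k w i.
  have := integrableB measurableT h1 h2.
  by apply: eq_integrable => // s _; rewrite !mxE /= EFinB.
have D0 s w : ~~ (0 < s <= T) -> SD (s, w) - ED (s, w) = 0.
  move=> st; have st' : ~~ (0 < s <= t_ k).
    by apply: contra st => /andP[-> h] /=; exact: le_trans h tkT.
  by rewrite /SD /ED sol_drift0 // euler_drift0 // subrr.
have mZ : mxmeas (fun w => x (t_ k) w - y k w) by apply: mxmeasB; [exact: mx|exact: my].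
have aeZ : {ae P, forall w, x (t_ k) w - y k w =
    gam *: path_integral (fun z => SD z - ED z) w + gam *: (I w - step_integral B S w)}.
  apply: filterS ae => w ->.
  rewrite (euler_repr T_gt0 alpha_itv N_gt0 Hy w kN) -/S -/ED -/SD.
  have -> : path_integral (fun z => SD z - ED z) w = path_integral SD w - path_integral ED w.
    apply/matrixP => i j; rewrite (ord1 j) !mxE -RintegralB //.
    - by apply: eq_Rintegral => s _; rewrite !mxE.
    - exact: (sol_drift_integrable HF T_gt0 alpha_itv K_gt0 fg_lipschitz eps_gt0 Hx w i tk0).
    - exact: (euler_drift_integrable T_gt0 alpha_itv f eps y N_gt0 k w i).
  by rewrite !scalerBr opprD addrACA subrr add0r opprD addrACA.
have aG := ito_approxB HF HB aI (ito_approx_step HF HB okS).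
have := energy_estimate HF HB T_gt0 mD iD D0 aG mZ aeZ DY GY.
rewrite -mseE // => /le_trans; apply.
rewrite /Y -EFinM mule_affine //; last by rewrite mulr_ge0.
rewrite [(ecst * 2)%R]mulrC leeD2r // lee_fin /holder_cst le_eqVlt.
by apply/orP; left; apply/eqP; ring.
Qed.

(** [mse_step] is inserted into [coef_error]. The 6 is 2 from [local_error] plus 2 * 2 from the free
    term of [mse_step], and the 8 is the product of the outer 2, the 2 before [mse] and the 2 before
    the integral. *)
Lemma coef_error_step k : (k <= N)%N ->
  ((coef_error k)%:E <=
    (2 * K ^+ 2 * ((dt / eps) ^+ 2 + 6 * holder_cst * dt `^ beta))%:E +
    (8 * K ^+ 2 * ecst)%:E *
    \int[mu]_(s in `]0%R, t_ k]) ((t_ k - s) `^ (beta - 1) * coef_error (cell dt s))%:E)%E.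
Proof.
move=> kN; have := mse_step kN; set X := (\int[mu]_(s in _) _)%E.
have X0 : (0 <= X)%E.
  by apply: integral_ge0 => s _; rewrite lee_fin mulr_ge0 ?powR_ge0 ?coef_error_ge0.
have K2 : 0 <= 2 * K ^+ 2 by rewrite mulr_ge0 // sqr_ge0.
have H0 := holder_cst_ge0; have p0 := powR_ge0 dt beta.
have hd0 : 0 <= 2 * (holder_cst * dt `^ beta) by rewrite mulr_ge0 // mulr_ge0.
have e0 : 0 <= 2 * ecst by rewrite mulr_ge0.
move=> h; apply: (@le_trans _ _ ((2 * K ^+ 2)%:E *
    (local_error%:E + 2%:E * ((2 * (holder_cst * dt `^ beta))%:E + (2 * ecst)%:E * X)))%E).
  rewrite /coef_error [leLHS]EFinM; apply: lee_wpmul2l; first by rewrite lee_fin.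
  by rewrite [leLHS]EFinD; apply: leeD => //; rewrite [leLHS]EFinM lee_wpmul2l // lee_fin.
have l0 := local_error_ge0.
rewrite (mule_affine 2 hd0 e0 X0) addeA -EFinD.
have s0 : 0 <= local_error + 2 * (2 * (holder_cst * dt `^ beta)).
  by apply: addr_ge0 => //; exact: mulr_ge0.
have e1 : 0 <= 2 * (2 * ecst) by exact: mulr_ge0.
rewrite (mule_affine (2 * K ^+ 2) s0 e1 X0).
rewrite le_eqVlt; apply/orP; left; apply/eqP; congr (_%:E + _%:E * _)%E; last by ring.
by rewrite /local_error; ring.
Qed.
End convergence.

(** * Choice of the constant and conclusion *)

Theorem theorem5p5 (R : realType) (d : measure_display)
  (Omega : measurableType d) (P : probability Omega R)
  (P_complete : measure_is_complete P)
  (F : R -> set (set Omega)) (F_filtration : filtration F)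
  (n m : nat) (B : R -> Omega -> 'cV[R]_m) (B_brownian : brownian P F B)
  (T alpha : R) (T_gt0 : 0 < T) (alpha_itv : 2^-1 < alpha < 1)
  (x0 : 'cV[R]_n)
  (f : R -> 'cV[R]_n -> 'cV[R]_n) (g : R -> 'cV[R]_n -> 'M[R]_(n, m))
  (K L : R) (K_gt0 : 0 < K) (L_gt0 : 0 < L)
  (fg_lipschitz : forall (t1 t2 : R) (x1 x2 : 'cV[R]_n), 0 <= t1 -> 0 <= t2 ->
    Num.max (frob (f t1 x1 - f t2 x2)) (frob (g t1 x1 - g t2 x2))
      <= K * (`|t1 - t2| + frob (x1 - x2)))
  (fg_growth : forall t : R, 0 <= t ->
    Num.max (frob (f t 0) ^+ 2) (frob (g t 0) ^+ 2) <= L) :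
  exists2 C : R, 0 < C &
  forall (eps : R) (x : R -> Omega -> 'cV[R]_n) (N : nat)
    (y : nat -> Omega -> 'cV[R]_n),
  0 < eps -> (1 <= N)%N ->
  fsde_solution P F B T alpha eps x0 f g x ->
  euler_maruyama B T alpha eps x0 f g N y ->
  let dt := T / N%:R in
  (\big[Order.max/-oo]_(k < N.+1)
      'E_P[fun w => (frob (x (k%:R * dt) w - y k w) ^+ 2)%R]
    <= (C * (dt `^ (2 * alpha - 1) + (dt / eps) ^+ 2))%:E)%E.
Proof.
have [A2 A20 moment] := uniform_moment F_filtration B_brownian T_gt0 alpha_itv x0 K_gt0
  fg_lipschitz fg_growth.
have E0 := energy_cst_ge0 m alpha T_gt0.
have H0 := holder_cst_ge0 m T_gt0 alpha_itv A20.
pose H := holder_cst m T alpha A2.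
have c0 : 0 <= 8 * K ^+ 2 * energy_cst m T alpha.
  by apply: mulr_ge0 => //; rewrite mulr_ge0 // sqr_ge0.
have [C C0 gron] := singular_gronwall (beta_gt0 alpha_itv) (ltW T_gt0) c0.
(* 1 + 6 H dominates the coefficients 1 and 6 H of the two error terms, and the last 1 makes the
   constant positive. [A2] and C were obtained before eps, N and the processes. *)
exists (C * (1 + 6 * H) + 1).
  by rewrite ltr_pwDr // mulr_ge0 // addr_ge0 // mulr_ge0.
move=> eps x N y eps0 N0 Hx Hy; cbv zeta; set dt := T / N%:R.
have dt0 : 0 < dt by rewrite divr_gt0 // ltr0n.
have fA s := (moment eps x eps0 Hx s).1.
have gA s := (moment eps x eps0 Hx s).2.
pose phi := coef_error P m T alpha K A2 eps x N y.
have phi0 k : 0 <= phi k := coef_error_ge0 P m T_gt0 alpha_itv K A20 eps x N y k.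
pose a := 2 * K ^+ 2 * ((dt / eps) ^+ 2 + 6 * H * dt `^ (2 * alpha - 1)).
have p0 := powR_ge0 dt (2 * alpha - 1).
have q0 := sqr_ge0 (dt / eps).
have a0 : 0 <= a.
  apply: mulr_ge0; first by rewrite mulr_ge0 // sqr_ge0.
  by rewrite addr_ge0 // mulr_ge0 // mulr_ge0.
have bd k : (k <= N)%N -> phi k <= C * a.
  (* Discrete use of the inequality. The finite sum of all values is the a priori bound; C does not
     depend on it. *)
  apply: (gron nat [set k | (k <= N)%N] (tau dt) (cell dt) phi a (\sum_(j < N.+1) phi j)) => //.
  - by move=> i iN; rewrite tau_ge0 // tau_le_T.
  - move=> i s iN /andP[s0 si]; have /andP[/ltW cs _] := tau_cell dt0 s0; split => //.
    by apply: leq_trans iN; apply: ltnW; apply: cell_lt => //; rewrite s0.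
  - move=> i iN; rewrite phi0 (bigD1 (Ordinal (iN : (i < N.+1)%N))) //= lerDl.
    by apply: sumr_ge0 => j _; exact: phi0.
  - move=> i iN.
    exact: (coef_error_step F_filtration B_brownian T_gt0 alpha_itv K_gt0 fg_lipschitz
      fg_growth A20 eps0 N0 Hx Hy fA gA iN).
apply: bigmax_le; first by rewrite leNye.
move=> k _; have kN : (k <= N)%N by rewrite -ltnS ltn_ord.
rewrite unlock; under eq_integral do rewrite frob_sqr.
rewrite -(mseE F_filtration B_brownian T_gt0 alpha_itv K_gt0 fg_lipschitz fg_growth eps0 N0
  Hx Hy kN) lee_fin.
have K2 : 0 < 2 * K ^+ 2 by rewrite mulr_gt0 // exprn_gt0.
(* The common factor 2 K^2 > 0 cancels; dropping the nonnegative local error then leaves a bound for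
   twice the mean square error. *)
have := bd k kN; rewrite /phi /coef_error /a (mulrCA C) ler_pM2l //.
have e0 := mse_ge0 P T x N y k.
have := local_error_ge0 m T_gt0 alpha_itv A20 eps N.
move: (local_error _ _ _ _ _ _) (mse _ _ _ _ _ _) e0 => l e e0 l0 le.
have hC : C * ((dt / eps) ^+ 2 + 6 * H * dt `^ (2 * alpha - 1)) <=
    C * ((1 + 6 * H) * (dt `^ (2 * alpha - 1) + (dt / eps) ^+ 2)).
  apply: ler_wpM2l => //; rewrite -subr_ge0.
  rewrite (_ : _ - _ = dt `^ (2 * alpha - 1) + 6 * H * (dt / eps) ^+ 2); last by ring.
  by rewrite addr_ge0 // mulr_ge0 // mulr_ge0.
rewrite mulrDl mul1r -mulrA; lra.
Qed.
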